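(* \textsc{Rendezvous in Time} can be solved in time $2^{\ell^{\mathcal{O}(\tau)}}\cdot n^{\mathcal{O}(1)}$ on input $(G,s,t,k,\tau)$, where $n=|V(G)|$ and $\ell=\mathrm{nd}(G)$ is the neighborhood diversity of $G$. In particular, \textsc{Rendezvous in Time} is fixed-parameter tractable when parameterized by $\mathrm{nd}(G)+\tau$.
   Context: Rendezvous game with adversaries. Let $G$ be a finite, simple, undirected, connected graph, let $s,t\in V(G)$ and let $k\ge 1$ be an integer. Two players play: Facilitator, who controls two agents $R$ and $J$ initially placed on $s$ and $t$ respectively, and Divider, who controls $k$ agents $D_1,\dots,D_k$ which Divider initially places on vertices of $V(G)\setminus\{s,t\}$ of his choice (several agents may share a vertex). After the initial placement the players alternate moves, Facilitator moving first. In a move, the player moves each of his agents to an adjacent vertex or leaves it where it is; no agent may be moved to a vertex currently occupied by an agent of the opponent. Both players have full information. Facilitator wins if at some moment $R$ and $J$ occupy the same vertex; Divider wins if this never happens. For an integer $\tau\ge 1$, Facilitator wins in at most $\tau$ steps if he can force $R$ and $J$ to occupy the same vertex within his first $\tau$ moves (a step is a move of Facilitator followed by a move of Divider). \textsc{Rendezvous in Time}: given $(G,s,t,k,\tau)$ with positive integers $k,\tau$, decide whether Facilitator can win in at most $\tau$ steps against Divider with $k$ agents. A set $U\subseteq V(G)$ is a module if every $v\in V(G)\setminus U$ is adjacent either to all vertices of $U$ or to none of them; it is a clique module if $U$ is moreover a clique and an independent module if $U$ is an independent set. A neighborhood decomposition of $G$ is a partition of $V(G)$ into clique modules and independent modules.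 The neighborhood diversity $\mathrm{nd}(G)$ is the minimum number of parts in a neighborhood decomposition of $G$. *)

(* Defs.v *)
From mathcomp Require Import all_boot.

Set Implicit Arguments.
Unset Strict Implicit.
Unset Printing Implicit Defensive.

Definition simple_graph n (e : rel 'I_n) : Prop :=
  (forall u v, e u v = e v u) /\ (forall u, ~~ e u u).

Definition connected_graph n (e : rel 'I_n) : Prop :=
  forall u v, connect e u v.

Definition adjc n (e : rel 'I_n) (u v : 'I_n) : bool := (u == v) || e u v.

(* fwin e m r j d : Facilitator, to move, with R on r, J on j and the  *)
(* Divider agents on d, can force R and J onto a common vertex now or  *)
(* within his next m moves.                                            *)

Fixpoint fwin n (e : rel 'I_n) k (m : nat) (r j : 'I_n)
    (d : {ffun 'I_k -> 'I_n}) {struct m} : Prop :=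
  r = j \/
  match m with
  | 0 => False
  | m'.+1 =>
      exists r' j' : 'I_n,
        [/\ adjc e r r', adjc e j j',
            (forall i, d i <> r') , (forall i, d i <> j') &
            forall d' : {ffun 'I_k -> 'I_n},
              (forall i, [/\ adjc e (d i) (d' i), d' i <> r' & d' i <> j']) ->
              fwin e m' r' j' d']
  end.

Definition rendezvous_in_time n (e : rel 'I_n) (s t : 'I_n) (k tau : nat)
    : Prop :=
  forall d0 : {ffun 'I_k -> 'I_n},
    (forall i, d0 i <> s /\ d0 i <> t) -> fwin e tau s t d0.

Definition is_module n (e : rel 'I_n) (U : {set 'I_n}) : bool :=
  [forall v in ~: U, [forall u in U, e v u] || [forall u in U, ~~ e v u]].

Definition is_clique n (e : rel 'I_n) (U : {set 'I_n}) : bool :=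
  [forall u in U, forall w in U, (u != w) ==> e u w].

Definition is_indep n (e : rel 'I_n) (U : {set 'I_n}) : bool :=
  [forall u in U, forall w in U, ~~ e u w].

Definition nbhd_decomposition n (e : rel 'I_n) (P : {set {set 'I_n}}) : bool :=
  partition P [set: 'I_n] &&
  [forall U in P, is_module e U && (is_clique e U || is_indep e U)].

(* minimum number of parts; the partition into singletons has n parts, *)
(* so n is a correct default for the minimum.                          *)
Definition nd n (e : rel 'I_n) : nat :=
  \big[minn/n]_(P : {set {set 'I_n}} | nbhd_decomposition e P) #|P|.

Inductive tm_move := MoveL | MoveR | Stay.

Record TM := {
  tm_state : finType;
  tm_sym : finType;
  tm_blank : tm_sym;
  tm_in : bool -> tm_sym;
  tm_start : tm_state;
  tm_halt : tm_state -> option bool;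
  tm_delta : tm_state -> tm_sym -> tm_state * tm_sym * tm_move
}.

(* configuration: state, reversed left part, scanned symbol, right part *)
Definition tm_config (M : TM) :=
  (tm_state M * seq (tm_sym M) * tm_sym M * seq (tm_sym M))%type.

Definition tm_step (M : TM) (c : tm_config M) : tm_config M :=
  let: (q, ls, a, rs) := c in
  if @tm_halt M q is Some _ then c else
  let: (q', b, mv) := @tm_delta M q a in
  match mv with
  | MoveL => match ls with
             | [::] => (q', [::], @tm_blank M, b :: rs)
             | x :: ls' => (q', ls', x, b :: rs)
             end
  | MoveR => match rs with
             | [::] => (q', b :: ls, @tm_blank M, [::])
             | y :: rs' => (q', b :: ls, y, rs')
             end
  | Stay => (q', ls, b, rs)
  end.

Definition tm_init (M : TM) (x : seq bool) : tm_config M :=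
  match x with
  | [::] => (@tm_start M, [::], @tm_blank M, [::])
  | b :: x' => (@tm_start M, [::], @tm_in M b, map (@tm_in M) x')
  end.

Definition tm_run (M : TM) (x : seq bool) (T : nat) : option bool :=
  let: (q, _, _, _) := iter T (@tm_step M) (tm_init M x) in @tm_halt M q.

Fixpoint bin_aux (fuel m : nat) : seq bool :=
  match fuel with
  | 0 => [::]
  | f.+1 => if m is 0 then [::] else odd m :: bin_aux f m./2
  end.

(* little-endian binary representation without leading zeros *)
Definition bin (m : nat) : seq bool := bin_aux m m.

Definition sdelim (w : seq bool) : seq bool :=
  flatten [seq [:: true; b] | b <- w] ++ [:: false].

Definition unary (m : nat) : seq bool := nseq m true ++ [:: false].

Definition encode n (e : rel 'I_n) (s t : 'I_n) (k tau : nat) : seq bool :=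
  unary n ++ [seq e i j | i <- enum 'I_n, j <- enum 'I_n]
  ++ unary s ++ unary t ++ sdelim (bin k) ++ sdelim (bin tau).

(* Main.v *)
(* Twins (vertices with the same neighbours outside the pair) form at most nd(G)
   classes, and positions matter only through the number of Divider's agents in
   each class and the number of vertices they cover there: covering as many
   vertices as possible is best, and only an independent class resists, because
   an agent that stays in it cannot change its vertex. Hence a strategy of
   Divider against the nd(G)^O(tau) histories of class moves is an integer
   solution of a linear system with nd(G)^O(tau) unknowns and rows, coefficients
   0 and +-1, and right-hand sides made of k and the class sizes, once it has been
   guessed which classes are fully blocked after which history.

   Such a system is solved bit by bit: halving all unknowns turns it into the same
   system for the halved constants, with row offsets that stay bounded by the
   number of unknowns. So there are only 2^(nd(G)^O(tau)) subproblems for each of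
   the polynomially many bit positions, and they fill one table of bits.

   The procedure is built from functions computable in time polynomial in the
   values, not in the lengths, of numbers, closed under primitive recursion with
   polynomially bounded values; a machine with counters and one bit array, whose
   counters are pebbles on the tape, computes them. The cap X on all numbers is the
   first one that exceeds 2^(Y * Y), with Y linear in the number of unknowns. Since
   nd(G)^(c * tau) = 1 when nd(G) = 1, the case where s and t are equal or
   adjacent, which includes it, is accepted at once. *)
Require Import Defs.
From Stdlib Require Import Classical FunctionalExtensionality.
From mathcomp Require Import all_boot zify.

Set Implicit Arguments.
Unset Strict Implicit.
Unset Printing Implicit Defensive.

(** * Register programs and their simulation by a Turing machine *)

(** Divider acts only by covering vertices. Within a class it does not matter which vertices are
    uncovered, only whether some are. More agents or more covered vertices never hurt Divider, so
    the rows are inequalities, and a solution bounds from below what the actual agents achieve. The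
    guess is one-sided as well: a class declared blocked must be full, while an undeclared one is
    treated as open, so a solution may also answer histories that cannot be played. Conversely, a
    winning strategy yields a solution by fixing one choice of vertices for each class history.

    The tree has only the depths below [tau], since the conditions at a node exclude a meeting in
    the move that Facilitator makes from there.

    Offsets stay bounded because unknowns in 0, 1 change a row by at most some [P]: an offset
    between [-P] and [P] changes by at most [P] and is then halved. A table of such offsets stands
    in for a general algorithm for integer programming in bounded dimension, and an explicit machine
    can fill it. *)

Definition upd (T : Type) (f : nat -> T) i x := fun j => if j == i then x else f j.

Lemma upd_ne (T : Type) (f : nat -> T) i j x : j != i -> upd f i x j = f j.
Proof. by rewrite /upd => /negbTE->. Qed.

Record store := Store { reg : nat -> nat; arr : nat -> bool }.

(** Every test looks at the cell that a register points to, which on the tape is the cell under a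
    pebble. Array bits are set and never erased, as the table is written once. *)
Inductive action := Inc | Dec | Put | TestPos | TestIn | TestNb | TestArr.

Definition exec (w : seq bool) a r (s : store) : store * bool :=
  match a with
  | Inc => (Store (upd (reg s) r (reg s r).+1) (arr s), true)
  | Dec => (Store (upd (reg s) r (reg s r).-1) (arr s), true)
  | Put => (Store (reg s) (upd (arr s) (reg s r) true), true)
  | TestPos => (s, 0 < reg s r)
  | TestIn => (s, nth false w (reg s r))
  | TestNb => (s, reg s r < size w)
  | TestArr => (s, arr s (reg s r))
  end.

(* [jump l b] is the label reached after [op l] answered [b]; [None] is the exit. *)
Record prog := Prog {
  lbl : finType;
  entry : lbl;
  op : lbl -> action * nat;
  jump : lbl -> bool -> option lbl }.

Definition pstep P w (c : option (lbl P) * store) :=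
  if c.1 is Some q then
    let: (s, b) := exec w (op q).1 (op q).2 c.2 in (jump q b, s)
  else c.

Definition runs P w s s' t :=
  iter t (@pstep P w) (Some (entry P), s) = (None, s').

Section Compile.
Variable P : prog.

Definition topreg := \max_(q : lbl P) (op q).2.

Lemma op_topreg (q : lbl P) : (op q).2 < topreg.+1.
Proof. by rewrite ltnS /topreg (leq_bigmax q). Qed.

(** A cell carries its input letter, if any, the mark of cell 0, its array bit and one flag for each
    pebble. *)
Definition sym := (option bool * bool * bool * {ffun 'I_topreg.+1 -> bool})%type.

Definition blank : sym := (None, false, false, [ffun => false]).
Definition inp b : sym := (Some b, false, false, [ffun => false]).
Definition flag (x : sym) r := x.2 (inord r).
Definition set_flag (x : sym) r b : sym :=
  (x.1, [ffun i => if i == inord r then b else x.2 i]).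
Definition home (x : sym) := x.1.1.2.

(* [None]: looking for the pebble; [Some None]: about to drop the pebble; *)
(* [Some (Some b)]: returning to cell 0 with the answer [b].              *)
Definition phase := option (option bool).
(** [inr None] is the start, where cell 0 gets its mark and all pebbles; [inl None] is at cell 0,
    about to turn the position of pebble 0 into the answer; [inl (Some b)] has halted. *)
Definition state := (option bool + option (lbl P * phase))%type.

Definition answer a (x : sym) :=
  match a with
  | TestPos => ~~ home x
  | TestIn => x.1.1.1 == Some true
  | TestNb => x.1.1.1 != None
  | TestArr => x.1.2
  | _ => true
  end.

Definition delta (q : state) (x : sym) : state * sym * tm_move :=
  match q with
  | inl None => (inl (Some (~~ flag x 0)), x, Stay)
  | inl _ => (q, x, Stay)
  | inr None =>
    (inr (Some (entry P, None)), (x.1.1.1, true, false, [ffun => true]), Stay)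
  | inr (Some (l, None)) =>
    let: (a, r) := op l in
    if ~~ flag x r then (q, x, MoveR) else
    match a with
    | Inc => (inr (Some (l, Some None)), set_flag x r false, MoveR)
    | Dec => if home x then (inr (Some (l, Some (Some true))), x, Stay)
             else (inr (Some (l, Some None)), set_flag x r false, MoveL)
    | Put => (inr (Some (l, Some (Some true))), (x.1.1, true, x.2), Stay)
    | _ => (inr (Some (l, Some (Some (answer a x)))), x, Stay)
    end
  | inr (Some (l, Some None)) =>
    (inr (Some (l, Some (Some true))), set_flag x (op l).2 true, Stay)
  | inr (Some (l, Some (Some b))) =>
    if home x then
      (if jump l b is Some l' then inr (Some (l', None)) else inl None, x, Stay)
    else (q, x, MoveL)
  end.

Definition machine : TM :=
  {| tm_state := state; tm_sym := sym; tm_blank := blank; tm_in := inp;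
     tm_start := inr None;
     tm_halt := fun q : state => if q is inl (Some b) then Some b else None;
     tm_delta := delta |}.

Notation step := (@tm_step machine).

(** A configuration stores only the visited cells, so the right part is compared with [T] through
    [nth] with default [blank]. *)
Definition at_ (q : state) (T : nat -> sym) p (c : tm_config machine) :=
  exists rs : seq sym, c = (q, rev (mkseq T p), T p, rs) /\
    forall i, nth blank rs i = T (p.+1 + i).

Lemma mkseq_upd (T : nat -> sym) p b : mkseq (upd T p b) p = mkseq T p.
Proof.
apply/eq_in_map => i; rewrite mem_iota add0n => /andP[_ ip].
by rewrite /upd; case: eqP ip => // ->; rewrite ltnn.
Qed.

Lemma rev_mkseqS (T : nat -> sym) p : rev (mkseq T p.+1) = T p :: rev (mkseq T p).
Proof. by rewrite -rev_rcons /mkseq -addn1 iotaD map_cat cats1. Qed.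

Lemma stepR q T p c q' b : at_ q T p c -> delta q (T p) = (q', b, MoveR) ->
  tm_halt (t:=machine) q = None -> at_ q' (upd T p b) p.+1 (step c).
Proof.
case=> rs [-> rsE] dE hE; rewrite /tm_step hE /= dE.
have E : upd T p b p = b by rewrite /upd eqxx.
have E' j : p < j -> upd T p b j = T j by move=> pj; rewrite /upd gtn_eqF.
case: rs rsE => [|y rs] rsE; [exists [::]|exists rs];
  rewrite rev_mkseqS mkseq_upd E E' ?(leqnSn, ltnSn) //; split=> //.
- by rewrite -[in RHS](addn0 p.+1) -rsE.
- move=> i; rewrite nth_nil E'; last by rewrite addSnnS leq_addr.
  by rewrite addSnnS -rsE nth_nil.
- by have:= rsE 0; rewrite /= addn0 => ->.
move=> i; rewrite E'; last by rewrite addSnnS leq_addr.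
by rewrite addSnnS -rsE.
Qed.

Lemma stepL q T p c q' b : at_ q T p.+1 c -> delta q (T p.+1) = (q', b, MoveL) ->
  tm_halt (t:=machine) q = None -> at_ q' (upd T p.+1 b) p (step c).
Proof.
case=> rs [-> rsE] dE hE; rewrite /tm_step hE /= dE rev_mkseqS.
exists (b :: rs); split.
  have E : upd T p.+1 b p = T p by rewrite /upd ltn_eqF.
  rewrite E; congr (_, rev _, _, _).
  apply/eq_in_map => i; rewrite mem_iota add0n => /andP[_ ip].
  by rewrite /upd ltn_eqF // leqW.
by case=> [|i] /=; rewrite /upd ?addn0 ?eqxx // rsE gtn_eqF ?addnS // ltnS leq_addr.
Qed.

Lemma stepS q T p c q' b : at_ q T p c -> delta q (T p) = (q', b, Stay) ->
  tm_halt (t:=machine) q = None -> at_ q' (upd T p b) p (step c).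
Proof.
case=> rs [-> rsE] dE hE; rewrite /tm_step hE /= dE.
exists rs; rewrite mkseq_upd {1}/upd eqxx; split=> // i.
by rewrite rsE /upd gtn_eqF // leq_addr.
Qed.

Variable w : seq bool.

(* Register [r] is a pebble lying on cell [reg s r]. *)
Definition tape (s : store) (i : nat) : sym :=
  (onth w i, i == 0, arr s i, [ffun r : 'I_topreg.+1 => reg s r == i]).

Lemma flag_tape s p (l : lbl P) : flag (tape s p) (op l).2 = (reg s (op l).2 == p).
Proof. by rewrite /flag ffunE inordK ?op_topreg. Qed.

Lemma upd_id (T : nat -> sym) p : upd T p (T p) = T.
Proof.
by apply: functional_extensionality => i; rewrite /upd; case: eqP => // ->.
Qed.

Lemma seek (l : lbl P) s p c k : reg s (op l).2 = p + k ->
  at_ (inr (Some (l, None))) (tape s) p c ->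
  at_ (inr (Some (l, None))) (tape s) (p + k) (iter k step c).
Proof.
elim: k p c => [|k IH] p c rE H; first by rewrite addn0.
rewrite iterSr addnS -addSn; apply: IH; first by rewrite addSnnS.
rewrite -[tape s](upd_id _ p); apply: (stepR H) => //=.
have := flag_tape s p l; case: (op l) rE => a r /= rE ->.
by rewrite rE gtn_eqF // -addSnnS leq_addr.
Qed.

Definition after (l : lbl P) b : state :=
  if jump l b is Some l' then inr (Some (l', None)) else inl None.

Lemma back l b s p c : at_ (inr (Some (l, Some (Some b)))) (tape s) p c ->
  at_ (after l b) (tape s) 0 (iter p.+1 step c).
Proof.
elim: p c => [|p IH] c H.
  by rewrite -[tape s](upd_id _ 0); apply: (stepS H).
by rewrite iterSr; apply: IH; rewrite -[tape s](upd_id _ p.+1); apply: (stepL H).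
Qed.

Lemma tape_upd s p r x : r < topreg.+1 ->
  set_flag (tape s p) r (x == p) = tape (Store (upd (reg s) r x) (arr s)) p.
Proof.
move=> rP; rewrite /set_flag /tape /=; congr (_, _); apply/ffunP=> i.
rewrite !ffunE /upd -val_eqE /= inordK //.
by case: (val i == r).
Qed.

Lemma tape_move s r x : r < topreg.+1 -> x != reg s r ->
  upd (upd (tape s) (reg s r) (set_flag (tape s (reg s r)) r false)) x
      (set_flag (tape s x) r true) = tape (Store (upd (reg s) r x) (arr s)).
Proof.
move=> rP xr; apply: functional_extensionality => i; rewrite {1 2}/upd.
case: eqP => [->|/eqP ix]; first by rewrite -tape_upd // eqxx.
case: eqP => [->|/eqP ir]; first by rewrite -tape_upd // (negbTE xr).
congr (_, _); apply/ffunP=> j; rewrite !ffunE /= /upd.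
by case: (eqVneq (val j) r) => // ->; rewrite !(eq_sym _ i) (negbTE ix) (negbTE ir).
Qed.

Lemma set_phase (l : lbl P) T p c : at_ (inr (Some (l, Some None))) T p c ->
  at_ (inr (Some (l, Some (Some true)))) (upd T p (set_flag (T p) (op l).2 true)) p
    (step c).
Proof. by move=> H; apply: (stepS H). Qed.

Lemma onth_nth (i : nat) : (onth w i == Some true) = nth false w i.
Proof.
by elim: w i => [|[] v IH] [|i] //=; apply: IH.
Qed.

Lemma onth_size (i : nat) : (onth w i != None) = (i < size w).
Proof. by elim: w i => [|b v IH] [|i] //=; apply: IH. Qed.

(** [v] steps lead to the pebble, and at most [v + 5] more perform the action and return to cell
    0. *)
Lemma sim_instr (l : lbl P) s c (v := reg s (op l).2) :
  let: (s', b) := exec w (op l).1 (op l).2 s in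
  at_ (inr (Some (l, None))) (tape s) 0 c ->
  exists2 t, t <= 2 * v + 5 & at_ (after l b) (tape s') 0 (iter t step c).
Proof.
have rP := op_topreg l; have fE := flag_tape s v l; rewrite eqxx in fE.
case E: (exec _ _ _ _) => [s' b] H0.
have {H0} := seek (erefl : reg s (op l).2 = 0 + v) H0.
rewrite add0n; set c1 := iter v step c => H1.
suff [t tb Ht] : exists2 t, t <= v + 5 &
    at_ (after l b) (tape s') 0 (iter t step c1).
  exists (t + v); first by lia.
  by rewrite iterD.
case oE: (op l) rP fE E => [a r] /= rP fE E.
have dE : forall q x m,
    (match a with
    | Inc => (inr (Some (l, Some None)), set_flag (tape s v) r false, MoveR)
    | Dec => if home (tape s v)
             then (inr (Some (l, Some (Some true))), (tape s v), Stay)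
             else (inr (Some (l, Some None)), set_flag (tape s v) r false, MoveL)
    | Put => (inr (Some (l, Some (Some true))),
              ((tape s v).1.1, true, (tape s v).2), Stay)
    | _ => (inr (Some (l, Some (Some (answer a (tape s v))))), (tape s v), Stay)
    end) = (q, x, m) -> delta (inr (Some (l, None))) (tape s v) = (q, x, m).
  by move=> q x m <-; rewrite /= oE fE.
have vE : v = reg s r by rewrite /v oE.
have test bb : s' = s -> b = bb ->
    delta (inr (Some (l, None))) (tape s v) =
      (inr (Some (l, Some (Some bb))), tape s v, Stay) ->
    exists2 t, t <= v + 5 & at_ (after l b) (tape s') 0 (iter t step c1).
  move=> -> -> d; exists v.+2; first by lia.
  by rewrite iterSr; apply: back; rewrite -[tape s](upd_id _ v); apply: (stepS H1).
case: a oE dE E => oE dE [] => *; subst s' b.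
- exists v.+4; first by lia.
  rewrite 2!iterSr; apply: back.
  have := set_phase (stepR H1 (dE _ _ _ erefl) erefl).
  rewrite upd_ne ?gtn_eqF // oE /= vE tape_move //.
  by rewrite gtn_eqF.
- case: (posnP v) => [v0|v0].
    apply: (test true) => //; last by apply: dE; rewrite v0.
    have {v0}r0 : reg s r = 0 by rewrite -vE.
    rewrite r0; case: (s) r0 => f g /= r0; congr Store.
    by apply: functional_extensionality => i; rewrite /upd; case: eqP => // ->.
  exists v.+2; first by lia.
  have v1 : v = v.-1.+1 by rewrite prednK.
  rewrite 2!iterSr; rewrite {1}v1.
  apply: back; rewrite v1 in H1.
  have d : delta (inr (Some (l, None))) (tape s v.-1.+1) =
    (inr (Some (l, Some None)), set_flag (tape s v.-1.+1) r false, MoveL).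
    by rewrite -v1; apply: dE; rewrite {1}v1.
  have := set_phase (stepL H1 d erefl); rewrite -v1.
  rewrite upd_ne ?oE /= ?vE ?tape_move //; last first.
    by rewrite -vE ltn_eqF // {2}v1.
  by rewrite -vE ltn_eqF // {2}v1.
- exists v.+2; first by lia.
  rewrite iterSr; apply: back; have := stepS H1 (dE _ _ _ erefl) erefl.
  congr (at_ _ _ _ _); apply: functional_extensionality => i.
  by rewrite /upd /tape /= -vE; case: eqP => // ->.
- apply: (test (0 < reg s r)) => //; apply: dE; rewrite /= /home /=.
  by rewrite vE lt0n.
- apply: (test (nth false w (reg s r))) => //; apply: dE.
  by rewrite /= onth_nth vE.
- apply: (test (reg s r < size w)) => //; apply: dE.
  by rewrite /= onth_size vE.
- by apply: (test (arr s (reg s r))) => //; apply: dE; rewrite /= vE.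
Qed.

Definition lift (q : option (lbl P)) : state :=
  if q is Some l then inr (Some (l, None)) else inl None.

Definition le_regs (s : store) m := forall r, reg s r <= m.

(** An instruction raises a register by at most 1, so during [t] instructions every pebble stays
    within [m + t]. *)
Lemma sim_run q s s' m t c : le_regs s m ->
  iter t (@pstep P w) (q, s) = (None, s') ->
  at_ (lift q) (tape s) 0 c ->
  exists2 u, u <= t * (2 * (m + t) + 5) & at_ (inl None) (tape s') 0 (iter u step c).
Proof.
elim: t q s m c => [|t IH] q s m c sm; first by case=> -> ->; exists 0.
rewrite iterSr; case: q => [l|] H H0; last first.
  rewrite /pstep /= in H.
  by have [u ub Hu] := IH _ _ _ _ sm H H0; exists u => //; nia.
move: H; rewrite /pstep /=; have := @sim_instr l s c.
case E: (exec _ _ _ _) => [s1 b] /(_ H0)[u ub Hu] H.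
have sm1 : le_regs s1 m.+1.
  move=> r; move: (sm r) (sm (op l).2) E.
  case: (op l) => a r' /=; case: a => /= h h' [] <- _ /=; rewrite /upd;
    try (case: ifP => _); lia.
have Hu' : at_ (lift (jump l b)) (tape s1) 0 (iter u step c) by [].
have [u' ub' Hu''] := IH _ _ _ _ sm1 H Hu'.
exists (u' + u); last by rewrite iterD.
by have := sm (op l).2; nia.
Qed.

Lemma sim_halt b T p c t : at_ (inl (Some b)) T p c -> iter t step c = c.
Proof. by move=> [rs [-> _]]; elim: t => //= t ->. Qed.

Definition s0 := Store (fun=> 0) (fun=> false).

(** The 2 additional steps mark cell 0 at the start and read pebble 0 at the end; a halted machine
    stays put, so any larger [u] works. *)
Lemma machine_run s t u : runs P w s0 s t -> t * (2 * t + 5) + 2 <= u ->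
  tm_run machine w u = Some (0 < reg s 0).
Proof.
move=> R tu; rewrite /tm_run.
have H0 : at_ (inr None) (fun i => (onth w i, false, false, [ffun => false])) 0
             (tm_init machine w).
  case: (w) => [|b v]; first by exists [::]; split => //= i; rewrite nth_nil.
  exists (map inp v); split => //= i.
  by elim: v i => [|b' v IH] [|i] //=; rewrite ?nth_nil.
have H1 := stepS H0 (erefl : delta (inr None) _ = (_, _, Stay)) erefl.
have {}H1 : at_ (lift (Some (entry P))) (tape s0) 0 (step (tm_init machine w)).
  suff <- : upd (fun i => (onth w i, false, false, [ffun => false])) 0
      (onth w 0, true, false, [ffun => true]) = tape s0 by [].
  apply: functional_extensionality => i; rewrite /upd /tape /=.
  case: (eqVneq i 0) => [->|i0]; congr (_, _); apply/ffunP=> r;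
    by rewrite !ffunE // eq_sym (negbTE i0).
have s00 : le_regs s0 0 by [].
have [v vb Hv] := sim_run s00 R H1.
have H2 := stepS Hv (erefl : delta (inl None) _ = (_, _, Stay)) erefl.
have -> : u = (u - v.+2) + v.+2.
  by rewrite add0n in vb; rewrite subnK //; lia.
have -> : v.+2 = 1 + v + 1 by lia.
rewrite !iterD /= (sim_halt _ H2); case: H2 => rs [-> _] /=.
by rewrite /flag ffunE inordK // lt0n.
Qed.

End Compile.

(** * Sequencing, conditionals and loops of register programs *)

Definition pop a r : prog := @Prog unit tt (fun=> (a, r)) (fun _ _ => None).

Definition pseq (P1 P2 : prog) : prog :=
  @Prog (lbl P1 + lbl P2)%type (inl (entry P1))
    (fun q => match q with inl q1 => op q1 | inr q2 => op q2 end)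
    (fun q b => match q with
       | inl q1 => if jump q1 b is Some q then Some (inl q) else Some (inr (entry P2))
       | inr q2 => omap inr (jump q2 b) end).

Definition pcond a r (P : prog) : prog :=
  @Prog (option (lbl P)) None
    (fun q => if q is Some q then op q else (a, r))
    (fun q b => match q with
       | None => if b then Some (Some (entry P)) else None
       | Some q => omap Some (jump q b) end).

Definition pwhile a r (P : prog) : prog :=
  @Prog (option (lbl P)) None
    (fun q => if q is Some q then op q else (a, r))
    (fun q b => match q with
       | None => if b then Some (Some (entry P)) else None
       | Some q => if jump q b is Some q then Some (Some q) else Some None end).

Lemma iter_exited P w s t : iter t (@pstep P w) (None, s) = (None, s).
Proof. by elim: t => //= t ->. Qed.

Section Runs.
Variable w : seq bool.

Lemma runs_le P s s' t u : runs P w s s' t -> t <= u -> runs P w s s' u.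
Proof. by rewrite /runs => H tu; rewrite -(subnK tu) iterD H iter_exited. Qed.

Lemma runs_op a r s : runs (pop a r) w s (exec w a r s).1 1.
Proof. by rewrite /runs /= /pstep /=; case: (exec _ _ _ _). Qed.

Lemma runs_seq P1 P2 s s1 s2 t1 t2 : runs P1 w s s1 t1 -> runs P2 w s1 s2 t2 ->
  runs (pseq P1 P2) w s s2 (t1 + t2).
Proof.
move=> H1 H2; rewrite /runs /=.
have H2' q x t : iter t (@pstep P2 w) (q, x) = (None, s2) ->
    iter t (@pstep (pseq P1 P2) w) (omap inr q, x) = (None, s2).
  elim: t q x => [|t IH] q x; first by case=> -> ->.
  rewrite !iterSr; case: q => [q|]; rewrite {2 4}/pstep /=; last exact: IH.
  by case: (exec _ _ _ _) => x' b; apply: IH.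
move: H1; rewrite /runs; move: (entry P1) => q; elim: t1 s q => // t1 IH s q.
rewrite addSn !iterSr {2 4}/pstep /=; case: (exec _ _ _ _) => x b.
case: (jump q b) => [q'|]; first exact: IH.
rewrite iter_exited => -[->].
by apply: (H2' (Some (entry P2))); apply: (runs_le H2); lia.
Qed.

Lemma runs_cond a r P s s' t : (exec w a r s).1 = s ->
  ((exec w a r s).2 -> runs P w s s' t) -> (~~ (exec w a r s).2 -> s' = s) ->
  runs (pcond a r P) w s s' t.+1.
Proof.
move=> sE HT HF; rewrite /runs iterSr {2}/pstep /=.
case: (exec _ _ _ _) sE HT HF => x b /= ->; case: b => [/(_ isT)|_].
  move=> + _; rewrite /runs; move: (entry P) => q; elim: t s q => // t IH s q.
  rewrite !iterSr {2 4}/pstep /=; case: (exec _ _ _ _) => y b.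
  case: (jump q b) => [q'|]; first by apply: IH.
  by rewrite iter_exited => -[->]; apply: (@iter_exited (pcond a r P)).
by move=> /(_ isT)->; apply: (@iter_exited (pcond a r P)).
Qed.

Lemma runs_while_stop a r P s : (exec w a r s).1 = s -> ~~ (exec w a r s).2 ->
  runs (pwhile a r P) w s s 1.
Proof.
move=> sE tF; rewrite /runs /= /pstep /=.
by case: (exec _ _ _ _) sE tF => x [] /= ->.
Qed.

Lemma runs_while_step a r P s s1 s2 t1 t2 :
  (exec w a r s).1 = s -> (exec w a r s).2 -> runs P w s s1 t1 ->
  runs (pwhile a r P) w s1 s2 t2 -> runs (pwhile a r P) w s s2 (t1 + t2).+1.
Proof.
move=> sE tT H1 H2; rewrite /runs iterSr {2}/pstep /=.
case: (exec _ _ _ _) sE tT => x [] //= -> _ {x}.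
move: H1; rewrite /runs; move: (entry P) => q; elim: t1 s q => // t1 IH s q.
rewrite addSn !iterSr {2 4}/pstep /=; case: (exec _ _ _ _) => x b.
case: (jump q b) => [q'|]; first exact: IH.
rewrite iter_exited => -[->].
by apply: (runs_le H2); lia.
Qed.

Lemma runs_while a r P (S : nat -> store) n T :
  (forall i, i <= n -> (exec w a r (S i)).1 = S i /\ (exec w a r (S i)).2 = (i < n)) ->
  (forall i, i < n -> runs P w (S i) (S i.+1) T) ->
  runs (pwhile a r P) w (S 0) (S n) (n * T.+1).+1.
Proof.
move=> test body.
suff H m i : m + i = n -> runs (pwhile a r P) w (S i) (S n) (m * T.+1).+1.
  by apply: H; rewrite addn0.
elim: m i => [|m IH] i E.
  rewrite add0n in E; subst i; case: (test n (leqnn _)) => E F.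
  by apply: runs_while_stop; rewrite ?F ?ltnn.
have lt_in : i < n by lia.
have [E1 F1] := test i (ltnW lt_in).
rewrite mulSn addSn -addnS; apply: runs_while_step => //; first by rewrite F1.
  exact: body.
by apply: IH; lia.
Qed.

Definition sett s d x := Store (upd (reg s) d x) (arr s).

Lemma store_ext s s' : reg s =1 reg s' -> arr s =1 arr s' -> s = s'.
Proof.
case: s s' => f g [f' g'] /= H1 H2.
by congr Store; apply: functional_extensionality.
Qed.

Definition pclear r := pwhile TestPos r (pop Dec r).

Lemma runs_clear r s : runs (pclear r) w s (sett s r 0) (reg s r * 2).+1.
Proof.
have {1}-> : s = sett s r (reg s r - 0).
  by apply: store_ext => // j /=; rewrite /upd; case: eqP => [->|//]; rewrite subn0.
rewrite -{2}(subnn (reg s r)).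
apply: (runs_while (S := fun i => sett s r (reg s r - i))) => i lei.
  by rewrite /= /upd eqxx subn_gt0.
have -> : sett s r (reg s r - i.+1) = (exec w Dec r (sett s r (reg s r - i))).1.
  apply: store_ext => // j /=; rewrite /upd eqxx; case: eqP => // _; lia.
exact: runs_op.
Qed.

Definition pmove r d := pwhile TestPos r (pseq (pop Dec r) (pop Inc d)).

Lemma runs_move r d s : r != d ->
  runs (pmove r d) w s (sett (sett s r 0) d (reg s d + reg s r)) (reg s r * 3).+1.
Proof.
move=> rd.
have {1}-> : s = sett (sett s r (reg s r - 0)) d (reg s d + 0).
  apply: store_ext => // j /=; rewrite /upd; case: eqP => [->|_]; first by rewrite addn0.
  by case: eqP => [->|//]; rewrite subn0.
rewrite -{3}(subnn (reg s r)).
apply: (runs_while (S := fun i => sett (sett s r (reg s r - i)) d (reg s d + i))).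
  by move=> i lei; rewrite /= /upd (negbTE rd) eqxx subn_gt0.
move=> i lti; rewrite -[2]/(1 + 1).
set s1 := sett _ _ _.
have -> : sett (sett s r (reg s r - i.+1)) d (reg s d + i.+1) =
   (exec w Inc d (exec w Dec r s1).1).1.
  by apply: store_ext => // j; rewrite /= /upd; do ![case: eqP => ?]; lia.
by apply: runs_seq; apply: runs_op.
Qed.

End Runs.

(** * Functions computable in time polynomial in unary *)

Ltac upd_lia :=
  repeat (let e := fresh "e" in case: eqP => e; try rewrite e); lia.

Lemma leq_wexp2r m n k : m <= n -> m ^ k <= n ^ k.
Proof. by case: k => // k mn; rewrite leq_exp2r. Qed.

(** Binding a variable extends the environment on the right; the newest variable heads the list, as
    with de Bruijn indices. *)
Definition ext (E : Type) (vs : seq (E -> nat)) : seq (E * nat -> nat) :=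
  snd :: [seq (fun e => v e.1) | v <- vs].

Section PolyBound.
Variables (E : Type) (W : E -> seq bool).
Implicit Types (vs : seq (E -> nat)) (m : E -> nat).

(* Bounds are polynomial in the values of the arguments, not in their lengths. *)
Definition sz vs e := 2 + size (W e) + \sum_(v <- vs) v e.

(** The summand 2 in [sz] serves this: constants and sums of powers are then absorbed by a larger
    exponent. *)
Lemma sz_ge2 vs e : 1 < sz vs e.
Proof. by rewrite /sz -addnA ltn_addr. Qed.

Lemma sz_gt0 vs e : 0 < sz vs e.
Proof. exact: ltnW (sz_ge2 vs e). Qed.

Definition PB vs m := exists c, forall e, m e <= sz vs e ^ c.

Lemma PB_le vs m m' : (forall e, m e <= m' e) -> PB vs m' -> PB vs m.
Proof. by move=> le_m [c Hc]; exists c => e; apply: leq_trans (le_m e) (Hc e). Qed.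

Lemma PB_const vs k : PB vs (fun=> k).
Proof.
exists k => e; apply: leq_trans (ltnW (ltn_expl k (isT : 1 < 2))) _.
exact: leq_wexp2r (sz_ge2 vs e).
Qed.

Lemma PB_sz vs : PB vs (sz vs).
Proof. by exists 1 => e; rewrite expn1. Qed.

Lemma PB_mul vs m1 m2 : PB vs m1 -> PB vs m2 -> PB vs (fun e => m1 e * m2 e).
Proof.
move=> [c1 H1] [c2 H2]; exists (c1 + c2) => e.
by rewrite expnD leq_mul.
Qed.

Lemma PB_add vs m1 m2 : PB vs m1 -> PB vs m2 -> PB vs (fun e => m1 e + m2 e).
Proof.
move=> [c1 H1] [c2 H2]; exists (c1 + c2).+1 => e.
have s2 := sz_ge2 vs e; have s1 := sz_gt0 vs e.
rewrite expnS (leq_trans _ (leq_mul s2 (leqnn _))) // mul2n -addnn.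
by apply: leq_add; [apply: leq_trans (H1 e) _|apply: leq_trans (H2 e) _];
  rewrite leq_pexp2l // ?leq_addr ?leq_addl.
Qed.

Lemma PB_exp vs m c : PB vs m -> PB vs (fun e => m e ^ c).
Proof.
move=> [d H]; exists (d * c) => e.
by rewrite expnM leq_wexp2r.
Qed.

Lemma PB_size vs : PB vs (fun e => size (W e)).
Proof. by apply: PB_le (PB_sz vs) => e; rewrite /sz addnAC leq_addl. Qed.

End PolyBound.

Lemma sz_ext E (W : E -> seq bool) vs e :
  sz (fun e => W e.1) (ext vs) e = sz W vs e.1 + e.2.
Proof. by rewrite /sz big_cons big_map /=; lia. Qed.

Ltac pb := repeat first [assumption | exact: PB_const | exact: PB_sz |
  apply: PB_add | apply: PB_mul | apply: PB_exp | apply: (PB_add (PB_const _ _ 1))].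

Section Polytime.
Variables (E : Type) (W : E -> seq bool) (A : E -> nat -> bool).
Implicit Types (vs : seq (E -> nat)) (f g m T : E -> nat).

(* Program [P] leaves [f e] in the zeroed register [d] and uses only zeroed *)
(* registers from [b] on; the arguments are read from the registers [rs].   *)
Definition computes vs f T rs d b P := forall e s,
  arr s = A e -> map (reg s) rs = [seq v e | v <- vs] -> reg s d = 0 ->
  (forall r, b <= r -> reg s r = 0) -> runs P (W e) s (sett s d (f e)) (T e).

(* [vs] are the variables that [f] may read, besides the input and the array. *)
Definition U vs f := PB W vs f /\ exists2 T, PB W vs T &
  forall rs d b, size rs = size vs -> d \notin rs -> d < b ->
    all (fun r => r < b) rs -> exists P, computes vs f T rs d b P.

Lemma U_PB vs f : U vs f -> PB W vs f.
Proof. by case. Qed.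

Lemma map_upd_notin (h : nat -> nat) r x rs : r \notin rs -> map (upd h r x) rs = map h rs.
Proof.
move=> rN; apply/eq_in_map => j jrs; rewrite upd_ne //.
by apply: contraNneq rN => <-.
Qed.

Lemma ltn_notin b rs : all (fun r => r < b) rs -> forall b', b <= b' -> b' \notin rs.
Proof.
move=> /allP H b' bb'; apply/negP => /H; lia.
Qed.

Lemma all_ltn_trans b b' rs : all (fun r => r < b) rs -> b <= b' ->
  all (fun r => r < b') rs.
Proof. by move=> H bb'; apply: sub_all H => r; lia. Qed.

Lemma U_ext vs f g : (forall e, f e = g e) -> U vs f -> U vs g.
Proof. by move=> fg; have -> : g = f by apply: functional_extensionality. Qed.

Lemma U_zero vs : U vs (fun=> 0).
Proof.
split; first exact: PB_const.
exists (fun=> 1); first exact: PB_const.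
move=> rs d b _ _ _ _; exists (pop TestPos d) => e s _ _ d0 _.
have -> : sett s d 0 = (exec (W e) TestPos d s).1.
  by apply: store_ext => // j; rewrite /= /upd; case: eqP => // ->.
exact: runs_op.
Qed.

Lemma U_succ vs f : U vs f -> U vs (fun e => (f e).+1).
Proof.
move=> [pf [T pT H]]; split; first by apply: PB_add (PB_const _ _ 1) pf.
exists (fun e => T e + 1); first by apply: PB_add pT (PB_const _ _ 1).
move=> rs d b srs dN db rsb; have [P HP] := H rs d b srs dN db rsb.
exists (pseq P (pop Inc d)) => e s As ars d0 b0.
apply: runs_seq (HP e s As ars d0 b0) _.
have -> : sett s d (f e).+1 = (exec (W e) Inc d (sett s d (f e))).1.
  by apply: store_ext => // j; rewrite /= /upd eqxx; case: eqP.
exact: runs_op.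
Qed.

(** Reading a register means counting it down. Its value is therefore moved to [d] and to a scratch
    register at once, and then moved back from the latter. *)
Lemma U_var vs i : i < size vs -> U vs (nth (fun=> 0) vs i).
Proof.
move=> ivs; have pv : PB W vs (nth (fun=> 0) vs i).
  apply: PB_le (PB_sz W vs) => e; rewrite /sz.
  rewrite -[X in _ <= X]addn0 -(cat_take_drop i vs) (drop_nth (fun=> 0) ivs).
  by rewrite big_cat big_cons /= nth_cat size_take ivs ltnn subnn /=; lia.
split=> //.
exists (fun e => (nth (fun=> 0) vs i e * 4).+1 + (nth (fun=> 0) vs i e * 3).+1).
  by apply: PB_add; apply: (PB_add (PB_const _ _ 1)); apply: PB_mul => //;
    apply: PB_const.
move=> rs d b srs dN db rsb; pose r := nth 0 rs i.
exists (pseq (pwhile TestPos r (pseq (pop Dec r) (pseq (pop Inc d) (pop Inc b)))) (pmove b r)).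
move=> e s As ars d0 b0.
have rv : reg s r = nth (fun=> 0) vs i e.
  have := congr1 (fun l => nth 0 l i) ars.
  by rewrite (nth_map 0) ?srs // (nth_map (fun=> 0)).
have rrs : r \in rs by rewrite mem_nth // srs.
have rb : r < b by apply: (allP rsb).
have rd : r != d by apply: contraNneq dN => <-.
clearbody r; rewrite -{}rv; move: {-2}(reg s r) (erefl (reg s r)) => n nr.
pose S i := sett (sett (sett s r (n - i)) d i) b i.
have E0 : s = S 0.
  apply: store_ext => // j; rewrite /S /= /upd subn0.
  by case: eqP => [->|_]; [rewrite b0|case: eqP => [->//|_]; case: eqP => [->|]].
have b0' : reg s b = 0 by rewrite b0.
have En : sett s d n = sett (sett (S n) b 0) r (reg (S n) r + reg (S n) b).
  by apply: store_ext => // j; rewrite /= /upd; upd_lia.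
rewrite En {1}E0; apply: runs_seq (_ : runs _ _ _ (S n) _) _; last first.
  rewrite -[X in (X * 3)](_ : reg (S n) b = n); last by rewrite /= /upd eqxx.
  by apply: runs_move; apply/eqP; lia.
apply: (runs_while (S := S)) => j jn.
  split=> //=; rewrite /upd; upd_lia.
rewrite -[3]/(1 + (1 + 1)).
have -> : S j.+1 = (exec (W e) Inc b (exec (W e) Inc d (exec (W e) Dec r (S j)).1).1).1.
  by apply: store_ext => // k; rewrite /= /upd; upd_lia.
by apply: runs_seq; [|apply: runs_seq]; apply: runs_op.
Qed.

Lemma U_test vs f a (t : E -> nat -> bool) :
  (forall e s r, arr s = A e -> exec (W e) a r s = (s, t e (reg s r))) ->
  U vs f -> U vs (fun e => t e (f e)).
Proof.
move=> aE [pf [T pT H]]; split.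
  by apply: PB_le (PB_const _ _ 1) => e; apply: leq_b1.
exists (fun e => T e + (2 + (f e * 2).+1)).
  apply: (PB_add pT); apply: (PB_add (PB_const _ _ 2)).
  by apply: (PB_add (PB_const _ _ 1)); apply: (PB_mul pf); apply: PB_const.
move=> rs d b srs dN db rsb.
have [P HP] := H rs b b.+1 srs (ltn_notin rsb (leqnn b)) (ltnSn b) (all_ltn_trans rsb (leqnSn b)).
exists (pseq P (pseq (pcond a b (pop Inc d)) (pclear b))) => e s As ars d0 b0.
have b0' : reg s b = 0 by rewrite b0.
apply: runs_seq (HP e s As ars b0' _) _; first by move=> r /ltnW/b0.
pose s2 := sett (sett s b (f e)) d (t e (f e)).
have -> : sett s d (t e (f e)) = sett s2 b 0.
  by apply: store_ext => // j; rewrite /= /upd; upd_lia.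
apply: runs_seq (_ : runs _ _ _ s2 _) _; last first.
  rewrite -[X in X * 2](_ : reg s2 b = f e); first exact: runs_clear.
  by rewrite /= /upd eqxx; case: eqP => //; lia.
have E1 : exec (W e) a b (sett s b (f e)) = (sett s b (f e), t e (f e)).
  by rewrite aE //= /upd eqxx.
apply: runs_cond; rewrite E1 //= => tf.
  have -> : s2 = (exec (W e) Inc d (sett s b (f e))).1.
    apply: store_ext => // j; rewrite /= /upd tf; upd_lia.
  exact: runs_op.
by apply: store_ext => // j; rewrite /= /upd (negbTE tf); upd_lia.
Qed.

Lemma U_in vs f : U vs f -> U vs (fun e => nth false (W e) (f e)).
Proof. exact: (@U_test vs f TestIn (fun e i => nth false (W e) i)). Qed.

Lemma U_arr vs f : U vs f -> U vs (fun e => A e (f e)).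
Proof. by apply: (@U_test vs f TestArr A) => e s r /= ->. Qed.

Lemma U_size vs : U vs (fun e => size (W e)).
Proof.
split; first exact: PB_size.
exists (fun e => (size (W e) * 2).+1).
  by apply: (PB_add (PB_const _ _ 1)); apply: PB_mul; [apply: PB_size|apply: PB_const].
move=> rs d b _ _ _ _; exists (pwhile TestNb d (pop Inc d)) => e s _ _ d0 _.
have {1}-> : s = sett s d 0.
  by apply: store_ext => // j; rewrite /= /upd; case: eqP => // ->.
apply: (runs_while (S := sett s d)) => i lei; first by rewrite /= /upd eqxx.
have -> : sett s d i.+1 = (exec (W e) Inc d (sett s d i)).1.
  by apply: store_ext => // j; rewrite /= /upd eqxx; case: eqP.
exact: runs_op.
Qed.

End Polytime.

Notation Uext W A vs := (U (fun e => W e.1) (fun e => A e.1) (ext vs)).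

Section Closure.
Variables (E : Type) (W : E -> seq bool) (A : E -> nat -> bool).
Variable vs : seq (E -> nat).

Fixpoint prec (x : nat) (f : nat -> nat -> nat) n :=
  if n is n.+1 then f n (prec x f n) else x.

(** The bound [m] on all intermediate values keeps the iteration polynomial; unrestricted recursion
    would define exponentials by repeated doubling. *)
Lemma U_rec (n h m : E -> nat) (g : E -> nat -> nat -> nat) :
  U W A vs n -> U W A vs h ->
  U (fun e => W e.1.1) (fun e => A e.1.1) (ext (ext vs)) (fun e => g e.1.1 e.1.2 e.2) ->
  PB W vs m -> (forall e i, i <= n e -> prec (h e) (g e) i <= m e) ->
  U W A vs (fun e => prec (h e) (g e) (n e)).
Proof.
move=> [pn [Tn pTn Hn]] [ph [Th pTh Hh]] [_ [Tg [c Tgc] Hg]] pm le_m.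
split; first by apply: PB_le pm => e; apply: le_m.
(* Cost of one round: computing the new value, clearing the old one, moving the new one in place,
   and updating the two counters. *)
pose B e := (sz W vs e + n e + m e) ^ c + ((m e * 2).+1 + ((m e * 3).+1 + 2)).
exists (fun e => Tn e + (Th e + ((n e * (B e).+1).+1 + ((m e * 3).+1 + (n e * 2).+1)))).
  have pB : PB W vs B.
    by rewrite /B; pb.
  by pb.
move=> rs d b srs dN db rsb.
have rsb4 k : all (fun r => r < b + k) rs by apply: all_ltn_trans rsb (leq_addr _ _).
have bN k : b + k \notin rs by apply: (ltn_notin rsb); apply: leq_addr.
have bl k : k < 4 -> b + k < b + 4 by lia.
have [Pn HPn] := Hn rs (b + 0) (b + 4) srs (bN 0) (bl 0 isT) (rsb4 4).
have [Ph HPh] := Hh rs (b + 2) (b + 4) srs (bN 2) (bl 2 isT) (rsb4 4).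
have [] := Hg (b + 2 :: b + 1 :: rs) (b + 3) (b + 4) _ _ _ _.
- by rewrite /= !size_map srs.
- by rewrite !inE !negb_or bN !eqn_add2l.
- lia.
- by rewrite /= rsb4 !ltn_add2l.
move=> Pg HPg.
(* [b + 0] counts the rounds left, [b + 1] is the index, [b + 2] the accumulator, and [b + 3]
   receives its next value. *)
exists (pseq Pn (pseq Ph (pseq
  (pwhile TestPos (b + 0) (pseq Pg (pseq (pclear (b + 2))
     (pseq (pmove (b + 3) (b + 2)) (pseq (pop Inc (b + 1)) (pop Dec (b + 0)))))))
  (pseq (pmove (b + 2) d) (pclear (b + 1)))))) => e s As ars d0 b0.
have b0' k : reg s (b + k) = 0 by rewrite b0 ?leq_addr.
set N := n e; pose R := prec (h e) (g e).
pose S i := sett (sett (sett s (b + 0) (N - i)) (b + 1) i) (b + 2) (R i).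
have b04 r : b + 4 <= r -> reg s r = 0.
  by move=> br; rewrite b0 //; apply: leq_trans br; apply: leq_addr.
apply: runs_seq (HPn e s As ars (b0' 0) b04) _.
apply: runs_seq (_ : runs _ _ _ (S 0) _) _.
  have -> : S 0 = sett (sett s (b + 0) N) (b + 2) (h e).
    have b1 := b0' 1; apply: store_ext => // j; rewrite /S /R /= subn0 /upd.
    by upd_lia.
  apply: HPh => //=; first by rewrite map_upd_notin.
    by rewrite upd_ne ?b0' // eqn_add2l.
  by move=> r br; rewrite upd_ne ?b04 //; apply/eqP; lia.
have RB i : i <= N -> R i <= m e by apply: le_m.
apply: runs_seq (_ : runs _ _ _ (S N) _) _; last first.
  pose s2 := sett (sett (S N) (b + 2) 0) d (reg (S N) d + reg (S N) (b + 2)).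
  have r1 : reg s2 (b + 1) = N.
    by rewrite /= /upd; upd_lia.
  have r2 : reg (S N) (b + 2) = R N by rewrite /= /upd eqxx.
  have -> : sett s d (R N) = sett s2 (b + 1) 0.
    have rd : reg (S N) d = 0 by rewrite /= /upd; upd_lia.
    apply: store_ext => // j; rewrite /s2 rd r2 add0n /S /= /upd.
    by have [z0 [z1 z2]] := (b0' 0, (b0' 1, b0' 2)); upd_lia.
  apply: runs_seq (_ : runs _ _ _ s2 _) _.
    apply: runs_le (runs_move _ _ _) _; first by apply/eqP; lia.
    by rewrite r2; have := RB N (leqnn N); lia.
  by apply: runs_le (runs_clear _ _ _) _; rewrite r1.
apply: (runs_while (S := S)) => i leiN.
  by split=> //=; rewrite /upd; upd_lia.
have RiS : R i.+1 = g e i (R i) by [].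
have Ri := RB _ (ltnW leiN); have RSi := RB _ leiN.
pose s1 := sett (S i) (b + 3) (R i.+1).
have r2 : reg s1 (b + 2) = R i by rewrite /= /upd eqn_add2l /= eqxx.
have S0 r : b + 3 <= r -> reg (S i) r = 0.
  move=> br; have : reg s r = 0 by apply: b0; lia.
  by rewrite /= /upd; upd_lia.
apply: runs_seq (_ : runs _ _ _ s1 _) _.
  rewrite /s1 RiS; apply: runs_le (HPg (e, i, R i) _ _ _ _ _) _ => //=.
  - rewrite -!map_comp !map_upd_notin ?bN //=.
    by congr [:: _, _ & _] => //; rewrite /upd; upd_lia.
  - by apply: S0.
  - by move=> r br; apply: S0; lia.
  apply: leq_trans (Tgc _) _; rewrite (sz_ext (fun e => W e.1)) (sz_ext W) /= leq_wexp2r //; lia.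
pose s2 := sett s1 (b + 2) 0.
apply: runs_seq (_ : runs _ _ _ s2 _) _.
  by apply: runs_le (runs_clear _ _ _) _; rewrite r2; lia.
pose s3 := sett (sett s2 (b + 3) 0) (b + 2) (reg s2 (b + 2) + reg s2 (b + 3)).
have r3 : reg s2 (b + 3) = R i.+1 by rewrite /= /upd; upd_lia.
apply: runs_seq (_ : runs _ _ _ s3 _) _.
  apply: runs_le (runs_move _ _ _) _; first by rewrite eqn_add2l.
  by rewrite r3; lia.
have -> : S i.+1 = (exec (W e) Dec (b + 0) (exec (W e) Inc (b + 1) s3).1).1.
  have r4 : reg s2 (b + 2) = 0 by rewrite /= /upd; upd_lia.
  apply: store_ext => // j; rewrite /s3 r3 r4 add0n /s2 /s1 /S /=.
  by rewrite /upd; have [z0 [z1 [z2 z3]]] := (b0' 0, (b0' 1, (b0' 2, b0' 3))); upd_lia.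
by rewrite -[2]/(1 + 1); apply: runs_seq; apply: runs_op.
Qed.

End Closure.

Lemma find_iota_eq (p : pred nat) n q :
  q < n -> p q -> (forall j, j < q -> ~~ p j) -> find p (iota 0 n) = q.
Proof.
move=> qn pq Hq.
rewrite -(subnKC (ltnW qn)) iotaD find_cat ifN; last first.
  by apply/hasPn => j; rewrite mem_iota; apply: Hq.
by move: qn; rewrite -subn_gt0; case: (n - q) => //= k _; rewrite size_iota pq addn0.
Qed.

(** * Arithmetic, bounded search and sums obtained from primitive recursion *)

Section Lib.
Variables (E : Type) (W : E -> seq bool) (A : E -> nat -> bool).
Variable vs : seq (E -> nat).
Local Notation U := (U W A vs).

Lemma U_weak f : U f -> Uext W A vs (fun e => f e.1).
Proof.
have PBw m : PB W vs m -> PB (fun e => W e.1) (ext vs) (fun e => m e.1).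
  move=> [c Hc]; exists c => -[e i] /=; apply: leq_trans (Hc e) _.
  by rewrite leq_wexp2r // sz_ext leq_addr.
move=> [pf [T pT H]]; split; first exact: PBw.
exists (fun e => T e.1); first exact: PBw.
case=> // r rs d b /= [srs]; rewrite inE negb_or size_map in srs *.
move=> /andP[_ dN] db /andP[_ rsb].
have [P HP] := H rs d b srs dN db rsb.
by exists P => -[e i] s As [_ ars] d0 b0; apply: HP => //; rewrite ars -map_comp.
Qed.

Lemma U_v0 : Uext W A vs (fun e => e.2).
Proof. exact: (@U_var _ (fun e => W e.1) (fun e => A e.1) (ext vs) 0). Qed.

Lemma U_const k : U (fun=> k).
Proof. by elim: k => [|k IH]; [apply: U_zero|apply: U_succ IH]. Qed.

End Lib.

(* Goals in extended environments [E * nat] are weakened by substituting an *)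
(* arbitrary value, here 0, for the variable that the function ignores.     *)
Ltac uvar := cbv beta; lazymatch goal with
  | |- @U (?E * nat)%type ?W ?A (ext ?vs) ?f =>
    first [ assumption | exact (@U_v0 E (fun e => W (e, 0)) (fun e => A (e, 0)) vs)
          | apply (@U_weak E (fun e => W (e, 0)) (fun e => A (e, 0)) vs
                     (fun e => f (e, 0))); uvar ]
  | _ => assumption end.

Lemma U_add E W A (vs : seq (E -> nat)) (a b : E -> nat) :
  U W A vs a -> U W A vs b -> U W A vs (fun e => a e + b e).
Proof.
move=> Ha Hb; have := U_rec (m := fun e => a e + b e) (g := fun _ _ x => x.+1) Ha Hb.
move=> /(_ _ _ _)/U_ext; apply.
- by move=> e; elim: (a e) => //= k ->.
- by apply: U_succ; uvar.
- by apply: PB_add; apply: (U_PB (A := A)).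
by move=> e i ia; apply: (@leq_trans (i + b e)); [elim: (i)|rewrite leq_add2r].
Qed.

(** The recursion step returns its index, and the last index of [a] rounds is the predecessor of
    [a]. *)
Lemma U_pred E W A (vs : seq (E -> nat)) (a : E -> nat) :
  U W A vs a -> U W A vs (fun e => (a e).-1).
Proof.
move=> Ha; have := U_rec (m := a) (g := fun _ i _ => i) Ha (U_zero _ _ _).
move=> /(_ _ _ _)/U_ext; apply.
- by move=> e; case: (a e).
- by uvar.
- exact: (U_PB (A := A)).
by move=> e [|i] //= /ltnW.
Qed.

Lemma U_sub E W A (vs : seq (E -> nat)) (a b : E -> nat) :
  U W A vs a -> U W A vs b -> U W A vs (fun e => a e - b e).
Proof.
move=> Ha Hb; have := U_rec (m := a) (g := fun _ _ x => x.-1) Hb Ha.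
have E1 e i : prec (a e) (fun _ => predn) i = a e - i.
  by elim: i => [|i /= ->]; rewrite ?subn0 ?subnS.
move=> /(_ _ _ _)/U_ext; apply.
- by move=> e.
- by apply: U_pred; uvar.
- exact: (U_PB (A := A)).
by move=> e i _; rewrite E1 leq_subr.
Qed.


Lemma U_mul E W A (vs : seq (E -> nat)) (a b : E -> nat) :
  U W A vs a -> U W A vs b -> U W A vs (fun e => a e * b e).
Proof.
move=> Ha Hb; have := U_rec (m := fun e => a e * b e) (g := fun e _ x => b e + x) Ha (U_zero _ _ _).
have E1 e i : prec 0 (fun _ => addn (b e)) i = i * b e.
  by elim: i => //= i ->; rewrite mulSn.
move=> /(_ _ _ _)/U_ext; apply.
- by move=> e; rewrite E1.
- by apply: U_add; uvar.
- by apply: PB_mul; apply: (U_PB (A := A)).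
by move=> e i ia; rewrite E1 leq_mul2r ia orbT.
Qed.

Lemma U_leq E W A (vs : seq (E -> nat)) (a b : E -> nat) :
  U W A vs a -> U W A vs b -> U W A vs (fun e => a e <= b e).
Proof.
move=> Ha Hb; apply: (U_ext (f := fun e => 1 - (a e - b e))).
  by move=> e; rewrite -subn_eq0; case: (a e - b e).
by apply: (U_sub (U_const _ _ _ 1)); apply: U_sub.
Qed.

Lemma U_negb E W A (vs : seq (E -> nat)) (p : E -> bool) :
  U W A vs p -> U W A vs (fun e => ~~ p e).
Proof.
move=> Hp; apply: (U_ext (f := fun e => 1 - p e)); first by move=> e; case: (p e).
exact: (U_sub (U_const _ _ _ 1)).
Qed.

Lemma U_andb E W A (vs : seq (E -> nat)) (p q : E -> bool) :
  U W A vs p -> U W A vs q -> U W A vs (fun e => p e && q e).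
Proof.
move=> Hp Hq; apply: (U_ext (f := fun e => p e * q e)); last exact: U_mul.
by move=> e; rewrite mulnb.
Qed.

Lemma U_orb E W A (vs : seq (E -> nat)) (p q : E -> bool) :
  U W A vs p -> U W A vs q -> U W A vs (fun e => p e || q e).
Proof.
move=> Hp Hq; apply: (U_ext (f := fun e => ~~ (~~ p e && ~~ q e))).
  by move=> e; rewrite negb_and !negbK.
by apply: U_negb; apply: U_andb; apply: U_negb.
Qed.

Lemma U_implyb E W A (vs : seq (E -> nat)) (p q : E -> bool) :
  U W A vs p -> U W A vs q -> U W A vs (fun e => p e ==> q e).
Proof.
move=> Hp Hq; apply: (U_ext (f := fun e => ~~ p e || q e)).
  by move=> e; rewrite implybE.
by apply: U_orb Hq; apply: U_negb.
Qed.

Lemma U_eqn E W A (vs : seq (E -> nat)) (a b : E -> nat) :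
  U W A vs a -> U W A vs b -> U W A vs (fun e => a e == b e).
Proof.
move=> Ha Hb; apply: (U_ext (f := fun e => (a e <= b e) && (b e <= a e))).
  by move=> e; rewrite -eqn_leq.
by apply: U_andb; apply: U_leq.
Qed.

Lemma U_if E W A (vs : seq (E -> nat)) (p : E -> bool) (a b : E -> nat) :
  U W A vs p -> U W A vs a -> U W A vs b -> U W A vs (fun e => if p e then a e else b e).
Proof.
move=> Hp Ha Hb; apply: (U_ext (f := fun e => p e * a e + ~~ p e * b e)).
  by move=> e; case: (p e); rewrite ?mul1n ?mul0n ?addn0.
by apply: U_add; apply: U_mul => //; apply: U_negb.
Qed.

Lemma U_minn E W A (vs : seq (E -> nat)) (a b : E -> nat) :
  U W A vs a -> U W A vs b -> U W A vs (fun e => minn (a e) (b e)).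
Proof.
move=> Ha Hb; apply: (U_ext (f := fun e => a e - (a e - b e))).
  by move=> e; rewrite minnE.
by do 2?[apply: U_sub => //].
Qed.

Lemma U_has E W A (vs : seq (E -> nat)) (n : E -> nat) (p : E -> nat -> bool) :
  U W A vs n -> Uext W A vs (fun e => p e.1 e.2) ->
  U W A vs (fun e => has (p e) (iota 0 (n e))).
Proof.
move=> Hn Hp; have := U_rec (m := fun=> 1) (g := fun e i x => (0 < x) || p e i) Hn (U_zero _ _ _).
have E1 e i : prec 0 (fun i x => (0 < x) || p e i) i = has (p e) (iota 0 i).
  by elim: i => // i IH; rewrite -[in RHS]addn1 iotaD has_cat /= orbF IH lt0b.
move=> /(_ _ _ _)/U_ext; apply.
- by move=> e; rewrite E1.
- have Hp' : U (fun e => W e.1.1) (fun e => A e.1.1) (ext (ext vs))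
     (fun e => p e.1.1 e.1.2) by uvar.
  by apply: U_orb => //; apply: U_leq; [apply: U_const|uvar].
- exact: PB_const.
by move=> e i _; rewrite E1 leq_b1.
Qed.


Lemma U_sum E W A (vs : seq (E -> nat)) (n : E -> nat) (F : E -> nat -> nat) :
  U W A vs n -> Uext W A vs (fun e => F e.1 e.2) ->
  U W A vs (fun e => \sum_(0 <= i < n e) F e i).
Proof.
move=> Hn HF; have [c Hc] := U_PB HF.
have := U_rec (m := fun e => n e * (sz W vs e + n e) ^ c) (g := fun e i x => F e i + x)
  Hn (U_zero _ _ _).
have E1 e i : prec 0 (fun i => addn (F e i)) i = \sum_(0 <= j < i) F e j.
  by elim: i => [|i IH]; rewrite ?big_nil // big_nat_recr //= IH addnC.
move=> /(_ _ _ _)/U_ext; apply.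
- by move=> e; rewrite E1.
- have HF' : U (fun e => W e.1.1) (fun e => A e.1.1) (ext (ext vs))
     (fun e => F e.1.1 e.1.2) by uvar.
  by apply: U_add => //; uvar.
- apply: PB_mul; first exact: (U_PB (A := A)).
  by apply: PB_exp; apply: PB_add; [apply: PB_sz|apply: (U_PB (A := A))].
move=> e i iN; rewrite E1; apply: (@leq_trans (\sum_(0 <= j < i) (sz W vs e + n e) ^ c)).
  rewrite big_nat [leqRHS]big_nat; apply: leq_sum => j /andP[_ ji].
  by apply: leq_trans (Hc (e, j)) _; rewrite sz_ext /= leq_wexp2r //; lia.
by rewrite sum_nat_const_nat subn0 leq_mul2r iN orbT.
Qed.

(** The accumulator keeps pace with the index until [p] first holds and is frozen from then on. *)
Lemma U_find E W A (vs : seq (E -> nat)) (n : E -> nat) (p : E -> nat -> bool) :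
  U W A vs n -> Uext W A vs (fun e => p e.1 e.2) ->
  U W A vs (fun e => find (p e) (iota 0 (n e))).
Proof.
move=> Hn Hp.
have := U_rec (m := n) (g := fun e i x => ((x == i) && ~~ p e i) + x) Hn (U_zero _ _ _).
have E1 e i : prec 0 (fun i x => ((x == i) && ~~ p e i) + x) i = find (p e) (iota 0 i).
  elim: i => // i IH; rewrite -[in RHS]addn1 iotaD find_cat /= IH add0n.
  have := has_find (p e) (iota 0 i); rewrite size_iota => ->.
  have := find_size (p e) (iota 0 i); rewrite size_iota => le_i.
  by case: ltngtP le_i => /= e1; case: (p e i); rewrite ?e1; lia.
move=> /(_ _ _ _)/U_ext; apply.
- by move=> e; rewrite E1.
- have Hp' : U (fun e => W e.1.1) (fun e => A e.1.1) (ext (ext vs))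
     (fun e => p e.1.1 e.1.2) by uvar.
  by apply: U_add; [apply: U_andb; [apply: U_eqn|apply: U_negb]|]; uvar.
- exact: (U_PB (A := A)).
move=> e i iN; rewrite E1; apply: leq_trans (find_size _ _) _.
by rewrite size_iota.
Qed.

Lemma U_all E W A (vs : seq (E -> nat)) (n : E -> nat) (p : E -> nat -> bool) :
  U W A vs n -> Uext W A vs (fun e => p e.1 e.2) ->
  U W A vs (fun e => all (p e) (iota 0 (n e))).
Proof.
move=> Hn Hp; apply: (U_ext (f := fun e => ~~ has (fun i => ~~ p e i) (iota 0 (n e)))).
  by move=> e; rewrite -all_predC; congr nat_of_bool; apply: eq_all => i /=; rewrite negbK.
by apply: U_negb; apply: U_has => //; apply: U_negb.
Qed.

Lemma U_divn E W A (vs : seq (E -> nat)) (a b : E -> nat) :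
  U W A vs a -> U W A vs b -> U W A vs (fun e => a e %/ b e).
Proof.
(* The quotient is the least [q] with [a < q.+1 * b]. The factor [0 < b e] gives the conventional
   value 0 for a zero divisor, where the search fails. *)
move=> Ha Hb; apply: (U_ext (f := fun e =>
  (0 < b e) * find (fun q => a e < q.+1 * b e) (iota 0 (a e).+1))).
  move=> e; case: posnP => [->|b0]; first by rewrite divn0.
  rewrite -[nat_of_bool _]/1 mul1n; apply: find_iota_eq.
  - by rewrite ltnS leq_div.
  - exact: ltn_ceil.
  by move=> j; rewrite leq_divRL // -leqNgt.
apply: U_mul; first by apply: U_leq; [apply: U_const|].
apply: U_find; first exact: U_succ.
apply: U_leq; first by apply: U_succ; uvar.
by apply: U_mul; [apply: U_succ|]; uvar.
Qed.

Lemma U_modn E W A (vs : seq (E -> nat)) (a b : E -> nat) :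
  U W A vs a -> U W A vs b -> U W A vs (fun e => a e %% b e).
Proof.
move=> Ha Hb; apply: (U_ext (f := fun e => a e - a e %/ b e * b e)).
  by move=> e; rewrite {1}(divn_eq (a e) (b e)) addKn.
by apply: U_sub => //; apply: U_mul => //; apply: U_divn.
Qed.

Lemma U_odd E W A (vs : seq (E -> nat)) (a : E -> nat) :
  U W A vs a -> U W A vs (fun e => odd (a e)).
Proof.
move=> Ha; apply: (U_ext (f := fun e => a e %% 2)); first by move=> e; rewrite modn2.
by apply: U_modn => //; apply: U_const.
Qed.

(** The power may exceed every polynomial bound, so it is never formed: the division by [b] is
    iterated instead. *)
Lemma U_div_exp E W A (vs : seq (E -> nat)) (a b n : E -> nat) :
  U W A vs a -> U W A vs b -> U W A vs n -> U W A vs (fun e => a e %/ b e ^ n e).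
Proof.
move=> Ha Hb Hn; have := U_rec (m := a) (g := fun e _ x => x %/ b e) Hn Ha.
have E1 e i : prec (a e) (fun _ x => x %/ b e) i = a e %/ b e ^ i.
  by elim: i => [|i /= ->]; rewrite ?divn1 // expnSr divnMA.
move=> /(_ _ _ _)/U_ext; apply.
- by move=> e; rewrite E1.
- by apply: U_divn; uvar.
- exact: (U_PB (A := A)).
by move=> e i _; rewrite E1 leq_div.
Qed.

(** * The decision procedure *)

Section Decode.
Variable w : seq bool.

(** Both scans look for the end marker [false]: here of a unary number, below of a self-delimiting
    word, whose markers stand at even distances from [p]. *)
Definition urun p := find (fun i => ~~ nth false w (p + i)) (iota 0 (size w)).
Definition dlen p := find (fun i => ~~ nth false w (p + 2 * i)) (iota 0 (size w)).

Definition dn := urun 0.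
Definition edge u v := nth false w (dn.+1 + (u * dn + v)).
(* [ps], [pt], [pk] and [ptau] are the positions of the encodings of [s], [t], *)
(* [k] and [tau].                                                             *)
Definition ps := dn.+1 + dn * dn.
Definition ds := urun ps.
Definition pt := ps + ds.+1.
Definition dt := urun pt.
Definition pk := pt + dt.+1.
Definition kbit i := (i < dlen pk) && nth false w (pk + (2 * i).+1).
Definition ptau := pk + (2 * dlen pk).+1.
(* [tau] capped by [X], so that its unary value never exceeds the time allowed. *)
Definition tauc X :=
  prec 0 (fun i x => minn X (2 * x + nth false w (ptau + (2 * (dlen ptau - i.+1)).+1)))
    (dlen ptau).

Definition twin u v := all (fun x => [|| x == u, x == v | (edge u x : nat) == edge v x])
  (iota 0 dn).
Definition rep u := find (fun v => twin v u) (iota 0 dn).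
(** Classes are numbered in the order of their least members. *)
Definition cls u := \sum_(0 <= v < rep u) (rep v == v).
Definition ncls := \sum_(0 <= v < dn) (rep v == v).
Definition cadj a b :=
  has (fun u => has (fun v => [&& cls u == a, cls v == b & edge u v]) (iota 0 dn))
    (iota 0 dn).
Definition csize a := \sum_(0 <= v < dn) (cls v == a).

End Decode.

Definition bit c j := odd (c %/ 2 ^ j).

(* Parameters of the quotient by twins: [L] classes of sizes [u], adjacency [M]
   ([M a a] iff [a] is a clique with two vertices), the classes [a0] and [b0] of
   [s] and [t]. A history of Facilitator's moves is a node of a complete
   [L * L]-ary tree in heap order: the move of [R] and [J] to classes [a] and [b]
   leads from [h] to [h * (L * L) + (a * L + b).+1].
   The unknowns at node [h] are, for [U, V < L],
     [ix h U V]: the number of Divider's agents moving from [U] to [V] on arrival,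
     [ix h U L]: the number of vertices of [U] that Divider occupies,
   while [ix 0 L U] and [ix 0 L L] hold the constants [u U] and [k]. The bits [sg]
   are guessed: [sg h L] says that [h] can be reached and [sg h U] that Divider
   occupies all vertices of [U] not held by Facilitator. *)
Section Tree.
Variables (L : nat) (M : nat -> nat -> bool) (u : nat -> nat) (a0 b0 : nat).

Definition ix h U V := (h * L.+1 + U) * L.+1 + V.
Definition parent h := h.-1 %/ (L * L).
Definition posR h := if h == 0 then a0 else h.-1 %% (L * L) %/ L.
Definition posJ h := if h == 0 then b0 else h.-1 %% (L * L) %% L.
Definition occ h V := (posR h == V) + (posJ h == V).
(** An agent can only go to a class with a vertex that Facilitator does not hold. The root stands
    for the initial placement, which is free, so there every pair of classes is allowed. *)
Definition flowok h U V := (occ h V < u V) && [|| h == 0, U == V | M U V].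

Definition inflow (x : nat -> nat) h V :=
  \sum_(0 <= U < L) flowok h U V * x (ix h U V).

Variable sg : nat -> nat -> bool.

(* Row [ty] of class [U] at node [h] reads [lhs + offL <= rhs + offR]:
   0. the agents leaving [U] were there at the parent (at most [k] at the root);
   1. at most as many occupied vertices as agents;
   2. in an independent class, agents that stay do not spread;
   3. Facilitator's vertices are not occupied;
   4. a class declared blocked is full. *)
Definition lhs (x : nat -> nat) h U ty :=
  if ty == 0 then
    if h == 0 then \sum_(0 <= U' < L) \sum_(0 <= V < L) x (ix 0 U' V)
    else \sum_(0 <= V < L) x (ix h U V)
  else if ty == 2 then
    if (h == 0) || M U U then 0 else x (ix h U L)
  else if ty == 4 then
    if sg h U then x (ix 0 L U) else 0
  else x (ix h U L).

Definition rhs (x : nat -> nat) h U ty :=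
  if ty == 0 then
    if h == 0 then x (ix 0 L L) else inflow x (parent h) U
  else if ty == 1 then inflow x h U
  else if ty == 2 then
    x (ix (parent h) U L) +
      \sum_(0 <= U' < L) ((U' != U) && flowok h U' U) * x (ix h U' U)
  else if ty == 3 then x (ix 0 L U)
  else x (ix h U L).

Definition offL h U ty := if ty == 3 then occ h U else 0.
Definition offR h U ty := if ty == 4 then occ h U else 0.

(** Staying in a class is always possible, by not moving, even when the class is blocked. *)
Definition legal h a a' := (a' == a) || M a a' && ~~ sg h a'.

(** The reachable nodes contain the root and are closed under legal moves. At each of them a meeting
    in the next move is excluded: [R] and [J] are in non-adjacent classes, and every class adjacent
    to both is blocked. *)
Definition comb H :=
  sg 0 L && all (fun h => sg h L ==>
    [&& ~~ M (posR h) (posJ h),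
        all (fun U => M (posR h) U && M (posJ h) U ==> sg h U) (iota 0 L) &
        all (fun v => (h * (L * L) + v.+1 < H) && legal h (posR h) (v %/ L)
              && legal h (posJ h) (v %% L) ==> sg (h * (L * L) + v.+1) L)
          (iota 0 (L * L))]) (iota 0 H).

Definition row h U ty := (h * L + U) * 5 + ty.

Definition rows H (P : nat -> nat -> nat -> bool) :=
  all (fun h => sg h L ==>
    all (fun U => all (P h U) (iota 0 5)) (iota 0 L)) (iota 0 H).

End Tree.

Section Params.
Variables (w : seq bool) (X : nat).

Definition nodes := prec 0 (fun _ h => minn X (1 + ncls w * ncls w * h)) (tauc w X).
Definition nvars := nodes * ((ncls w).+1 * (ncls w).+1).
(** Bound on the absolute value of row offsets. The summand 2 makes room for the initial offsets,
    which count at most the two agents of Facilitator. *)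
Definition offset := nvars + 2.
Definition base := (2 * offset).+1.
(** At least [base] and at least the number [5 * nvars] of digits in a vector of offsets, so that
    codes of such vectors are below [large ^ large], hence below [2 ^ (large * large)]. *)
Definition large := 5 * nvars + 5.
Definition enough := prec 1 (fun _ z => minn X (2 * z)) (large * large) < X.
Definition digit c r := c %/ base ^ r %% base.

Definition Lw := ncls w.
Definition Mw := cadj w.
Definition uw := csize w.
Definition aw := cls w (ds w).
Definition bw := cls w (dt w).
Definition sgw sg h V := bit sg (h * Lw.+1 + V).

Variable A : nat -> bool.

(* Level [lev] is about the numbers with their [size w - lev] low bits removed. *)
Definition slot lev sg o := (lev * X + sg) * X + o.

(** Solvability of the system for guess [sg] and offsets [o] at level [lev]. [x0] packs the lowest
    bits of all unknowns and [o'] the offsets left after halving; at level 0 all unknowns vanish and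
    only the signs of the offsets matter. *)
Definition fill z :=
  let o := z %% X in
  let sg := z %/ X %% X in
  let lev := z %/ X %/ X in
  let i := size w - lev in
  if lev == 0 then
    rows Lw (sgw sg) nodes (fun h U ty => offset <= digit o (row Lw h U ty))
  else has (fun x0 => has (fun o' =>
    [&& all (fun U => bit x0 (ix Lw 0 Lw U) ==> bit (uw U) i) (iota 0 Lw),
        all (fun U => bit (uw U) i ==> bit x0 (ix Lw 0 Lw U)) (iota 0 Lw),
        bit x0 (ix Lw 0 Lw Lw) ==> kbit w i,
        kbit w i ==> bit x0 (ix Lw 0 Lw Lw),
        rows Lw (sgw sg) nodes (fun h U ty =>
          lhs Lw Mw (sgw sg) (fun j => bit x0 j) h U ty +
            2 * digit o' (row Lw h U ty) <=
          rhs Lw Mw uw aw bw (fun j => bit x0 j) h U ty +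
            digit o (row Lw h U ty) + offset) &
        A (slot lev.-1 sg o')]) (iota 0 X)) (iota 0 X).

Definition slots := (size w).+1 * X * X.

Definition divider_wins :=
  has (fun sg => comb Lw Mw aw bw (sgw sg) nodes &&
    has (fun o => rows Lw (sgw sg) nodes (fun h U ty =>
         digit o (row Lw h U ty) + offL Lw aw bw h U ty ==
         offset + offR Lw aw bw h U ty) &&
       A (slot (size w) sg o)) (iota 0 X)) (iota 0 X).

End Params.

Definition early w := (ds w == dt w) || edge w (ds w) (dt w).

(** * The decision procedure runs in time polynomial in the cap and the input length *)

Lemma U_ifb E W A (vs : seq (E -> nat)) (p q r : E -> bool) :
  U W A vs p -> U W A vs q -> U W A vs r ->
  U W A vs (fun e => if p e then q e else r e).
Proof.
move=> Hp Hq Hr; apply: (U_ext (f := fun e => if p e then q e : nat else r e)).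
  by move=> e; case: (p e).
exact: U_if.
Qed.


Ltac ustep := cbv beta; lazymatch goal with
  | |- U _ _ _ (fun e => nat_of_bool (andb (@?p e) (@?q e))) => apply: U_andb
  | |- U _ _ _ (fun e => nat_of_bool (orb (@?p e) (@?q e))) => apply: U_orb
  | |- U _ _ _ (fun e => nat_of_bool (negb (@?p e))) => apply: U_negb
  | |- U _ _ _ (fun e => nat_of_bool (implb (@?p e) (@?q e))) => apply: U_implyb
  | |- U _ _ _ (fun e => nat_of_bool (leq (@?p e) (@?q e))) => apply: U_leq
  | |- U _ _ _ (fun e => nat_of_bool (eq_op (@?p e) (@?q e))) => apply: U_eqn
  | |- U _ _ _ (fun e => nat_of_bool (odd (@?p e))) => apply: U_odd
  | |- U _ _ _ (fun e => nat_of_bool (has _ _)) => apply: U_has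
  | |- U _ _ _ (fun e => nat_of_bool (all _ _)) => apply: U_all
  | |- U _ _ _ (fun e => find _ _) => apply: U_find
  | |- U _ _ _ (fun e => \sum_(0 <= i < _) _) => apply: U_sum
  | |- U _ _ _ (fun e => addn (@?p e) (@?q e)) => apply: U_add
  | |- U _ _ _ (fun e => muln (@?p e) (@?q e)) => apply: U_mul
  | |- U _ _ _ (fun e => subn (@?p e) (@?q e)) => apply: U_sub
  | |- U _ _ _ (fun e => minn (@?p e) (@?q e)) => apply: U_minn
  | |- U _ _ _ (fun e => predn (@?p e)) => apply: U_pred
  | |- U _ _ _ (fun e => S (@?p e)) => apply: U_succ
  | |- U _ _ _ (fun e => divn (@?p e) (expn (@?q e) (@?r e))) => apply: U_div_exp
  | |- U _ _ _ (fun e => divn (@?p e) (@?q e)) => apply: U_divn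
  | |- U _ _ _ (fun e => modn (@?p e) (@?q e)) => apply: U_modn
  | |- U _ _ _ (fun e => if _ then _ else _) => apply: U_if
  | |- U _ _ _ (fun e => nat_of_bool (if _ then _ else _)) => apply: U_ifb
  | |- U _ _ _ (fun e => nat_of_bool (nth false _ (@?p e))) => apply: U_in
  | |- U _ _ _ (fun e => size _) => apply: U_size
  end.

Create HintDb ucomp.
#[local] Hint Constants Opaque : ucomp.
#[local] Hint Extern 0 (U _ _ _ _) => ustep : ucomp.
#[local] Hint Extern 1 (U _ _ _ _) => uvar : ucomp.
#[local] Hint Extern 2 (U _ _ _ _) => apply: U_const : ucomp.
#[local] Hint Extern 3 (U _ _ _ _) => apply: U_arr : ucomp.

Ltac ucomp := solve [ auto 200 with ucomp nocore ].

Lemma U_urun E W A (vs : seq (E -> nat)) (a : E -> nat) :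
  U W A vs a -> U W A vs (fun e => urun (W e) (a e)).
Proof. by move=> Ha; rewrite /urun; ucomp. Qed.

Lemma U_dlen E W A (vs : seq (E -> nat)) (a : E -> nat) :
  U W A vs a -> U W A vs (fun e => dlen (W e) (a e)).
Proof. by move=> Ha; rewrite /dlen; ucomp. Qed.

#[local] Hint Resolve U_urun U_dlen : ucomp.

Lemma U_dn E W A (vs : seq (E -> nat)) :
   U W A vs (fun e => dn (W e)).
Proof. by rewrite /dn; ucomp. Qed.

#[local] Hint Resolve U_dn : ucomp.

Lemma U_edge E W A (vs : seq (E -> nat)) (a b : E -> nat) :
  U W A vs a -> U W A vs b -> U W A vs (fun e => edge (W e) (a e) (b e)).
Proof. by move=> Ha Hb; rewrite /edge; ucomp. Qed.

Lemma U_ps E W A (vs : seq (E -> nat)) :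
   U W A vs (fun e => ps (W e)).
Proof. by rewrite /ps; ucomp. Qed.

#[local] Hint Resolve U_edge U_ps : ucomp.

Lemma U_ds E W A (vs : seq (E -> nat)) :
   U W A vs (fun e => ds (W e)).
Proof. by rewrite /ds; ucomp. Qed.

#[local] Hint Resolve U_ds : ucomp.

Lemma U_pt E W A (vs : seq (E -> nat)) :
   U W A vs (fun e => pt (W e)).
Proof. by rewrite /pt; ucomp. Qed.

#[local] Hint Resolve U_pt : ucomp.

Lemma U_dt E W A (vs : seq (E -> nat)) :
   U W A vs (fun e => dt (W e)).
Proof. by rewrite /dt; ucomp. Qed.

#[local] Hint Resolve U_dt : ucomp.

Lemma U_pk E W A (vs : seq (E -> nat)) :
   U W A vs (fun e => pk (W e)).
Proof. by rewrite /pk; ucomp. Qed.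

#[local] Hint Resolve U_pk : ucomp.

Lemma U_kbit E W A (vs : seq (E -> nat)) (a : E -> nat) :
  U W A vs a -> U W A vs (fun e => kbit (W e) (a e)).
Proof. by move=> Ha; rewrite /kbit; ucomp. Qed.

Lemma U_ptau E W A (vs : seq (E -> nat)) :
   U W A vs (fun e => ptau (W e)).
Proof. by rewrite /ptau; ucomp. Qed.

Lemma U_twin E W A (vs : seq (E -> nat)) (a b : E -> nat) :
  U W A vs a -> U W A vs b -> U W A vs (fun e => twin (W e) (a e) (b e)).
Proof. by move=> Ha Hb; rewrite /twin; ucomp. Qed.

#[local] Hint Resolve U_kbit U_ptau U_twin : ucomp.

Lemma U_rep E W A (vs : seq (E -> nat)) (a : E -> nat) :
  U W A vs a -> U W A vs (fun e => rep (W e) (a e)).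
Proof. by move=> Ha; rewrite /rep; ucomp. Qed.

#[local] Hint Resolve U_rep : ucomp.

Lemma U_cls E W A (vs : seq (E -> nat)) (a : E -> nat) :
  U W A vs a -> U W A vs (fun e => cls (W e) (a e)).
Proof. by move=> Ha; rewrite /cls; ucomp. Qed.

Lemma U_ncls E W A (vs : seq (E -> nat)) :
   U W A vs (fun e => ncls (W e)).
Proof. by rewrite /ncls; ucomp. Qed.

#[local] Hint Resolve U_cls U_ncls : ucomp.

Lemma U_cadj E W A (vs : seq (E -> nat)) (a b : E -> nat) :
  U W A vs a -> U W A vs b -> U W A vs (fun e => cadj (W e) (a e) (b e)).
Proof. by move=> Ha Hb; rewrite /cadj; ucomp. Qed.

Lemma U_csize E W A (vs : seq (E -> nat)) (a : E -> nat) :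
  U W A vs a -> U W A vs (fun e => csize (W e) (a e)).
Proof. by move=> Ha; rewrite /csize; ucomp. Qed.

Lemma U_bit E W A (vs : seq (E -> nat)) (a b : E -> nat) :
  U W A vs a -> U W A vs b -> U W A vs (fun e => bit (a e) (b e)).
Proof. by move=> Ha Hb; rewrite /bit; ucomp. Qed.

#[local] Hint Resolve U_cadj U_csize U_bit : ucomp.

Lemma prec_le x f n m : x <= m -> (forall i y, f i y <= m) -> prec x f n <= m.
Proof. by move=> ? ?; case: n => //= n. Qed.

Lemma U_tauc E W A (vs : seq (E -> nat)) (X : E -> nat) :
  U W A vs X -> U W A vs (fun e => tauc (W e) (X e)).
Proof.
move=> HX; apply: (U_rec (m := X)); try by ucomp.
  exact: (U_PB HX).
by move=> e i _; apply: prec_le => // j y; apply: geq_minl.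
Qed.

#[local] Hint Resolve U_tauc : ucomp.

Lemma U_nodes E W A (vs : seq (E -> nat)) (X : E -> nat) :
  U W A vs X -> U W A vs (fun e => nodes (W e) (X e)).
Proof.
move=> HX; apply: (U_rec (m := X)); try by ucomp.
  exact: (U_PB HX).
by move=> e i _; apply: prec_le => // j y; apply: geq_minl.
Qed.

#[local] Hint Resolve U_nodes : ucomp.

Lemma U_enough E W A (vs : seq (E -> nat)) (X : E -> nat) :
  U W A vs X -> U W A vs (fun e => enough (W e) (X e)).
Proof.
move=> HX; rewrite /enough /large /nvars; apply: U_leq => //; apply: U_succ.
(* The initial value 1 exceeds the cap when the cap is 0, whence [X e + 1]. *)
apply: (U_rec (m := fun e => X e + 1)); try by ucomp.
  by apply: (U_PB (A := A)); ucomp.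
move=> e i _; apply: prec_le => [|j y]; first by rewrite addn1.
exact: leq_trans (geq_minl _ _) (leq_addr _ _).
Qed.

Lemma U_digit E W A (vs : seq (E -> nat)) (X a b : E -> nat) :
  U W A vs X -> U W A vs a -> U W A vs b ->
  U W A vs (fun e => digit (W e) (X e) (a e) (b e)).
Proof. by move=> HX Ha Hb; rewrite /digit /base /offset /nvars; ucomp. Qed.

#[local] Hint Resolve U_enough U_digit : ucomp.

Lemma U_Lw E W A (vs : seq (E -> nat)) : U W A vs (fun e => Lw (W e)).
Proof. exact: U_ncls. Qed.

Lemma U_Mw E W A (vs : seq (E -> nat)) (a b : E -> nat) :
  U W A vs a -> U W A vs b -> U W A vs (fun e => Mw (W e) (a e) (b e)).
Proof. exact: U_cadj. Qed.

Lemma U_uw E W A (vs : seq (E -> nat)) (a : E -> nat) :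
  U W A vs a -> U W A vs (fun e => uw (W e) (a e)).
Proof. exact: U_csize. Qed.

#[local] Hint Resolve U_Lw U_Mw U_uw : ucomp.

Lemma U_sgw E W A (vs : seq (E -> nat)) (sg h V : E -> nat) :
  U W A vs sg -> U W A vs h -> U W A vs V ->
  U W A vs (fun e => sgw (W e) (sg e) (h e) (V e)).
Proof. by move=> Hsg Hh HV; rewrite /sgw; ucomp. Qed.

Lemma U_ix E W A (vs : seq (E -> nat)) (h V V' : E -> nat) :
  U W A vs h -> U W A vs V -> U W A vs V' ->
  U W A vs (fun e => ix (Lw (W e)) (h e) (V e) (V' e)).
Proof. by move=> Hh HV HV'; rewrite /ix; ucomp. Qed.

Lemma U_row E W A (vs : seq (E -> nat)) (h V ty : E -> nat) :
  U W A vs h -> U W A vs V -> U W A vs ty ->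
  U W A vs (fun e => row (Lw (W e)) (h e) (V e) (ty e)).
Proof. by move=> Hh HV Hty; rewrite /row; ucomp. Qed.

Lemma U_parent E W A (vs : seq (E -> nat)) (h : E -> nat) :
  U W A vs h ->
  U W A vs (fun e => parent (Lw (W e)) (h e)).
Proof. by move=> Hh; rewrite /parent; ucomp. Qed.

Lemma U_posR E W A (vs : seq (E -> nat)) (h : E -> nat) :
  U W A vs h ->
  U W A vs (fun e => posR (Lw (W e)) (aw (W e)) (h e)).
Proof. by move=> Hh; rewrite /posR /aw; ucomp. Qed.

Lemma U_posJ E W A (vs : seq (E -> nat)) (h : E -> nat) :
  U W A vs h ->
  U W A vs (fun e => posJ (Lw (W e)) (bw (W e)) (h e)).
Proof. by move=> Hh; rewrite /posJ /bw; ucomp. Qed.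

#[local] Hint Resolve U_sgw U_ix U_row U_parent U_posR U_posJ : ucomp.

Lemma U_occ E W A (vs : seq (E -> nat)) (h V : E -> nat) :
  U W A vs h -> U W A vs V ->
  U W A vs (fun e => occ (Lw (W e)) (aw (W e)) (bw (W e)) (h e) (V e)).
Proof. by move=> Hh HV; rewrite /occ; ucomp. Qed.

#[local] Hint Resolve U_occ : ucomp.

Lemma U_flowok E W A (vs : seq (E -> nat)) (h V V' : E -> nat) :
  U W A vs h -> U W A vs V -> U W A vs V' ->
  U W A vs (fun e => flowok (Lw (W e)) (Mw (W e)) (uw (W e)) (aw (W e)) (bw (W e))
    (h e) (V e) (V' e)).
Proof. by move=> Hh HV HV'; rewrite /flowok; ucomp. Qed.

#[local] Hint Resolve U_flowok : ucomp.

Lemma U_inflow E W A (vs : seq (E -> nat)) (x0 h V : E -> nat) :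
  U W A vs x0 -> U W A vs h -> U W A vs V ->
  U W A vs (fun e => inflow (Lw (W e)) (Mw (W e)) (uw (W e)) (aw (W e)) (bw (W e))
    (fun j => bit (x0 e) j) (h e) (V e)).
Proof. by move=> Hx0 Hh HV; rewrite /inflow; ucomp. Qed.

#[local] Hint Resolve U_inflow : ucomp.

Lemma U_lhs E W A (vs : seq (E -> nat)) (sg x0 h V ty : E -> nat) :
  U W A vs sg -> U W A vs x0 -> U W A vs h -> U W A vs V -> U W A vs ty ->
  U W A vs (fun e => lhs (Lw (W e)) (Mw (W e)) (sgw (W e) (sg e))
    (fun j => bit (x0 e) j) (h e) (V e) (ty e)).
Proof. by move=> Hsg Hx0 Hh HV Hty; rewrite /lhs; ucomp. Qed.

Lemma U_rhs E W A (vs : seq (E -> nat)) (x0 h V ty : E -> nat) :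
  U W A vs x0 -> U W A vs h -> U W A vs V -> U W A vs ty ->
  U W A vs (fun e => rhs (Lw (W e)) (Mw (W e)) (uw (W e)) (aw (W e)) (bw (W e))
    (fun j => bit (x0 e) j) (h e) (V e) (ty e)).
Proof. by move=> Hx0 Hh HV Hty; rewrite /rhs; ucomp. Qed.

#[local] Hint Resolve U_lhs U_rhs : ucomp.

Lemma U_fill E W A (vs : seq (E -> nat)) (X z : E -> nat) :
  U W A vs X -> U W A vs z -> U W A vs (fun e => fill (W e) (X e) (A e) (z e)).
Proof.
move=> HX Hz; rewrite /fill /rows /slot /offset /nvars; lazy zeta.
by ucomp.
Qed.

Lemma U_divider_wins E W A (vs : seq (E -> nat)) (X : E -> nat) :
  U W A vs X -> U W A vs (fun e => divider_wins (W e) (X e) (A e)).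
Proof.
move=> HX; rewrite /divider_wins /comb /legal /rows /offL /offR /slot /offset /nvars.
by ucomp.
Qed.

Lemma U_slots E W A (vs : seq (E -> nat)) (X : E -> nat) :
  U W A vs X -> U W A vs (fun e => slots (W e) (X e)).
Proof. by move=> HX; rewrite /slots; ucomp. Qed.

Lemma U_early E W A (vs : seq (E -> nat)) : U W A vs (fun e => early (W e)).
Proof. by rewrite /early; ucomp. Qed.

(** * Decoding the input *)

Lemma urun_cat l m r : urun (l ++ unary m ++ r) (size l) = m.
Proof.
have H i : nth false (l ++ unary m ++ r) (size l + i) = nth false (unary m ++ r) i.
  by rewrite nth_cat ltnNge leq_addr addKn.
rewrite /urun; apply: find_iota_eq.
- by rewrite !size_cat size_nseq /=; lia.
- by rewrite H /unary -catA nth_cat size_nseq ltnn subnn.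
by move=> j jm; rewrite H /unary -catA nth_cat size_nseq jm nth_nseq jm.
Qed.

Lemma sdelim_cons b v : sdelim (b :: v) = [:: true, b & sdelim v].
Proof. by []. Qed.

Lemma size_sdelim v : size (sdelim v) = (2 * size v).+1.
Proof. by rewrite /sdelim size_cat /= addn1; elim: v => //= b v; lia. Qed.

Lemma nth_sdelim v r i : i < size v ->
  nth false (sdelim v ++ r) (2 * i) = true /\
  nth false (sdelim v ++ r) (2 * i).+1 = nth false v i.
Proof.
elim: v i => // b v IH [|i] // lei; rewrite sdelim_cons mulnS; exact: IH.
Qed.

Lemma nth_sdelim_end v r : nth false (sdelim v ++ r) (2 * size v) = false.
Proof. by elim: v => // b v IH; rewrite sdelim_cons mulnS; exact: IH. Qed.

Section DlenCat.
Variables (l v r : seq bool).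
Let w := l ++ sdelim v ++ r.

Lemma nth_cat_shift i : nth false w (size l + i) = nth false (sdelim v ++ r) i.
Proof. by rewrite /w nth_cat ltnNge leq_addr addKn. Qed.

Lemma dlen_cat : dlen w (size l) = size v.
Proof.
rewrite /dlen; apply: find_iota_eq.
- by rewrite /w !(size_sdelim, size_cat); lia.
- by rewrite nth_cat_shift nth_sdelim_end.
by move=> j /(nth_sdelim r)[H _]; rewrite nth_cat_shift H.
Qed.

Lemma dbit_cat i : i < size v -> nth false w (size l + (2 * i).+1) = nth false v i.
Proof. by move=> /(nth_sdelim r)[_ H]; rewrite nth_cat_shift. Qed.

End DlenCat.

Lemma nth_bin m i : nth false (bin m) i = odd (m %/ 2 ^ i).
Proof.
have H f k j : k <= f -> nth false (bin_aux f k) j = odd (k %/ 2 ^ j).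
  elim: f k j => [|f IH] k j; first by rewrite leqn0 => /eqP->; rewrite div0n nth_nil.
  case: k => [|k] kf; first by rewrite /= nth_nil div0n.
  case: j => [|j]; first by rewrite divn1.
  have kf' : (k.+1)./2 <= f by rewrite -divn2; lia.
  by rewrite expnS divnMA divn2 -(IH _ _ kf').
exact: H.
Qed.

Lemma bin_lt m : m < 2 ^ size (bin m).
Proof.
have H f k : k <= f -> k < 2 ^ size (bin_aux f k).
  elim: f k => [|f IH] k; first by rewrite leqn0 => /eqP->.
  case: k => [|k] kf //; rewrite [size _]/= expnS.
  have kf' : (k.+1)./2 <= f by rewrite -divn2; lia.
  have := IH _ kf'; have := odd_double_half k.+1; rewrite -mul2n /=.
  by case: (odd k) => /=; lia.
exact: H.
Qed.

Lemma eqb_nat (b c : bool) : ((b : nat) == c) = (b == c).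
Proof. by case: b c => [] []. Qed.

Section Encode.
Variables (n : nat) (e : rel 'I_n) (s t : 'I_n) (k tau : nat).
Let w := encode e s t k tau.
Let adj := [seq e i j | i <- enum 'I_n, j <- enum 'I_n].

Lemma size_adj : size adj = n * n.
Proof. by rewrite size_allpairs size_enum_ord. Qed.

Lemma nth_adj (u v : 'I_n) : nth false adj (u * n + v) = e u v.
Proof.
rewrite /adj; have H (l : seq 'I_n) i : i < size l ->
    nth false [seq e i j | i <- l, j <- enum 'I_n] (i * n + v) = e (nth u l i) v.
  elim: l i => // a l IH [|i] il /=.
    rewrite nth_cat size_map size_enum_ord mul0n add0n ltn_ord.
    by rewrite (nth_map v) ?size_enum_ord ?ltn_ord // nth_ord_enum.
  by rewrite mulSn -addnA nth_cat size_map size_enum_ord ltnNge leq_addr addKn IH.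
by rewrite H ?size_enum_ord ?ltn_ord // nth_ord_enum.
Qed.

Lemma dn_encode : dn w = n.
Proof. exact: (urun_cat [::]). Qed.

Lemma edge_encode (u v : 'I_n) : edge w u v = e u v.
Proof.
rewrite /edge dn_encode /w /encode -/adj nth_cat size_cat size_nseq /= addn1.
rewrite ltnNge leq_addr /= addKn nth_cat size_adj nth_adj.
by case: ltnP => //; have := ltn_ord u; have := ltn_ord v; nia.
Qed.

Lemma size_unary m : size (unary m) = m.+1.
Proof. by rewrite size_cat size_nseq addn1. Qed.

Lemma ds_encode : ds w = s.
Proof.
rewrite /ds; have -> : ps w = size (unary n ++ adj).
  by rewrite /ps dn_encode !(size_unary, size_cat) size_adj.
by rewrite /w /encode -/adj catA urun_cat.
Qed.

Lemma pt_encode : pt w = size (unary n ++ adj ++ unary s).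
Proof. by rewrite /pt ds_encode /ps dn_encode !(size_unary, size_cat) size_adj addnA. Qed.

Lemma dt_encode : dt w = t.
Proof.
rewrite /dt pt_encode /w /encode -/adj.
have -> r : unary n ++ adj ++ unary s ++ r = (unary n ++ adj ++ unary s) ++ r.
  by rewrite !catA.
by rewrite urun_cat.
Qed.

Let pre := unary n ++ adj ++ unary s ++ unary t.

Lemma pk_encode : pk w = size pre.
Proof. by rewrite /pk dt_encode pt_encode /pre !(size_unary, size_cat) !addnA. Qed.

Lemma encodeE : w = pre ++ sdelim (bin k) ++ sdelim (bin tau).
Proof. by rewrite /w /encode /pre -/adj !catA. Qed.

Lemma kbit_encode i : kbit w i = odd (k %/ 2 ^ i).
Proof.
rewrite /kbit pk_encode encodeE dlen_cat; case: ltnP => ik /=.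
  by rewrite dbit_cat // nth_bin.
by rewrite -nth_bin nth_default.
Qed.

Lemma ptau_encode : ptau w = size (pre ++ sdelim (bin k)).
Proof. by rewrite /ptau pk_encode encodeE dlen_cat !(size_sdelim, size_cat). Qed.

Lemma encodeE' : w = (pre ++ sdelim (bin k)) ++ sdelim (bin tau) ++ [::].
Proof. by rewrite cats0 encodeE catA. Qed.

(** Horner's rule from the most significant bit. Capping at every stage amounts to capping once,
    since [2 * x + b] reaches [X] as soon as [x] does. *)
Lemma tauc_encode X : tauc w X = minn X tau.
Proof.
rewrite /tauc ptau_encode encodeE' dlen_cat.
set z := size (bin tau).
have H i : i <= z -> prec 0 (fun i x => minn X (2 * x +
    nth false ((pre ++ sdelim (bin k)) ++ sdelim (bin tau) ++ [::])
       (size (pre ++ sdelim (bin k)) + (2 * (z - i.+1)).+1))) i = minn X (tau %/ 2 ^ (z - i)).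
  elim: i => [|i IH] iz /=.
    by rewrite subn0 divn_small ?bin_lt // minn0.
  rewrite IH; last exact: ltnW.
  rewrite dbit_cat; last by rewrite -/z; lia.
  rewrite nth_bin -subnSK // expnSr divnMA divn2.
  move: (tau %/ _) => a; have := odd_double_half a; rewrite -mul2n; lia.
by rewrite H // subnn divn1.
Qed.

(** With the next bound, which covers the class sizes, this shows that [size w] bit levels exhaust
    the constants of the system. *)
Lemma k_lt : k < 2 ^ size w.
Proof.
apply: leq_trans (bin_lt k) _; rewrite leq_exp2l // encodeE !(size_sdelim, size_cat); lia.
Qed.

Lemma n_lt : n < 2 ^ size w.
Proof.
apply: leq_trans (ltn_expl n (isT : 1 < 2)) _.
by rewrite leq_exp2l // encodeE /pre !(size_unary, size_cat); lia.
Qed.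

Hypothesis simple_e : simple_graph e.

Definition twins (u v : 'I_n) := [forall x, [|| x == u, x == v | e u x == e v x]].

Lemma twin_encode (u v : 'I_n) : twin w u v = twins u v.
Proof.
rewrite /twin dn_encode; apply/allP/forallP => [H x|H x].
  by have := H x; rewrite mem_iota add0n ltn_ord !edge_encode eqb_nat => ->.
rewrite mem_iota add0n => /andP[_ xn].
by have := H (Ordinal xn); rewrite -!(edge_encode _ (Ordinal xn)) eqb_nat.
Qed.

Lemma twins_refl u : twins u u.
Proof. by apply/forallP => x; rewrite eqxx !orbT. Qed.

Lemma twins_sym u v : twins u v = twins v u.
Proof.
by apply/forallP/forallP => H x; have := H x; rewrite orbCA (eq_sym (e _ x)).
Qed.

Lemma twins_trans u v x : twins u v -> twins v x -> twins u x.
Proof.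
have [sym irr] := simple_e.
move=> /forallP uv /forallP vx; apply/forallP => y.
case: (eqVneq y u) => //= yu; case: (eqVneq y x) => //= yx.
have := uv y; rewrite (negbTE yu) /=; case: (eqVneq y v) => [yv _|yv /= /eqP->]; last first.
  by have := vx y; rewrite (negbTE yx) (negbTE yv).
(* The remaining vertex is the middle one, [v]. The two hypotheses, read at [x] and at [u], make the
   three pairs among [u], [v], [x] equally adjacent. *)
subst y; case: (eqVneq u x) => [->//|ux].
have := uv x; rewrite (eq_sym x v) (negbTE yx) (eq_sym x u) (negbTE ux) /= => /eqP E1.
have := vx u; rewrite (eq_sym u v) (negbTE yu) (negbTE ux) /= => /eqP E2.
by rewrite sym E2 sym E1 sym.
Qed.

Lemma rep_spec (u : 'I_n) : exists v : 'I_n,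
  [/\ rep w u = v, twins v u & forall v', twins v' u -> v <= v'].
Proof.
have hasu : has (fun v => twin w v u) (iota 0 (dn w)).
  by apply/hasP; exists (u : nat); rewrite ?mem_iota ?dn_encode //= twin_encode twins_refl.
have := hasu; rewrite has_find size_iota -/(rep w u) dn_encode => lt_n.
exists (Ordinal lt_n); split=> //.
  by have := nth_find 0 hasu; rewrite -/(rep w u) nth_iota ?dn_encode // -twin_encode.
move=> v' tw; rewrite leqNgt; apply/negP => /= lt_v.
have := before_find 0 lt_v; rewrite nth_iota ?dn_encode ?ltn_ord //.
by rewrite add0n twin_encode tw.
Qed.

Lemma rep_twins (u v : 'I_n) : twins u v -> rep w u = rep w v.
Proof.
move=> uv; have [a [-> au amin]] := rep_spec u; have [b [-> bv bmin]] := rep_spec v.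
apply/eqP; rewrite eqn_leq amin ?bmin //; first exact: twins_trans au uv.
by apply: twins_trans bv _; rewrite twins_sym.
Qed.

Lemma rep_rep (u : 'I_n) : rep w (rep w u) = rep w u.
Proof. by have [v [E vu _]] := rep_spec u; rewrite {1}E (rep_twins vu). Qed.

Lemma twins_rep (u v : 'I_n) : rep w u = rep w v -> twins u v.
Proof.
have [a [-> au _]] := rep_spec u; have [b [-> bv _]] := rep_spec v.
by move/val_inj=> E; apply: twins_trans bv; rewrite -E twins_sym.
Qed.

(** The inequality is strict because [rep w u] itself is counted on the right only. *)
Lemma sum_rep_lt (u : 'I_n) m : rep w u < m -> cls w u < \sum_(0 <= v < m) (rep w v == v).
Proof.
move=> um; rewrite (big_cat_nat (n := rep w u)) ?(ltnW um) //= -/(cls w u).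
by rewrite big_ltn // rep_rep eqxx; lia.
Qed.

Lemma cls_lt (u : 'I_n) : cls w u < ncls w.
Proof.
apply: sum_rep_lt; rewrite dn_encode.
by have [v [-> _ _]] := rep_spec u.
Qed.

Lemma cls_twins (u v : 'I_n) : cls w u = cls w v -> twins u v.
Proof.
move=> E; apply: twins_rep; case: (ltngtP (rep w u) (rep w v)) => // /sum_rep_lt;
  by rewrite -/(cls w _) E ltnn.
Qed.

Lemma cadjP a b : reflect (exists u v : 'I_n, [/\ cls w u = a, cls w v = b & e u v])
  (cadj w a b).
Proof.
rewrite /cadj dn_encode; apply: (iffP hasP) => [[u]|[u [v [ua vb uv]]]].
  rewrite mem_iota add0n => /andP[_ un] /hasP[v]; rewrite mem_iota add0n => /andP[_ vn].
  case/and3P => /eqP ua /eqP vb; rewrite (edge_encode (Ordinal un) (Ordinal vn)).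
  by move=> uv; exists (Ordinal un), (Ordinal vn).
exists (u : nat); first by rewrite mem_iota add0n ltn_ord.
apply/hasP; exists (v : nat); first by rewrite mem_iota add0n ltn_ord.
by rewrite ua vb !eqxx edge_encode.
Qed.

Lemma csizeE a : csize w a = #|[set v : 'I_n | cls w v == a]|.
Proof. by rewrite /csize dn_encode big_mkord -sum1dep_card [RHS]big_mkcond. Qed.

Lemma earlyE : early w = (s == t) || e s t.
Proof. by rewrite /early ds_encode dt_encode edge_encode. Qed.

(** If all vertices were twins, a neighbour of [s] would be a twin of [t], and [s] would be adjacent
    to [t]. *)
Lemma ncls_gt1 : connected_graph e -> ~~ early w -> 1 < ncls w.
Proof.
have [sym irr] := simple_e.
rewrite earlyE negb_or => conn /andP[st nst]; rewrite ltnNge; apply/negP => le1.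
have cls0 (u : 'I_n) : cls w u = 0 by have := cls_lt u; lia.
have tw u v : twins u v by apply: cls_twins; rewrite !cls0.
have /connectP[[|x p] /= ] := conn s t; first by move=> _ /esym/eqP; rewrite (negbTE st).
case/andP=> sx _ _.
have xs : x != s by apply: contraTneq sx => ->.
have xt : x != t by apply: contraNneq nst => <-.
have := forallP (tw x t) s.
by rewrite (eq_sym s x) (negbTE xs) (negbTE st) /= sym sx sym (negbTE nst).
Qed.

Lemma module_twins U u v : is_module e U -> is_clique e U || is_indep e U ->
  u \in U -> v \in U -> twins u v.
Proof.
have [sym irr] := simple_e; move=> modU cU uU vU; apply/forallP => x.
case: (eqVneq x u) => //= xu; case: (eqVneq x v) => //= xv.
case: (boolP (x \in U)) => xU.
  case/orP: cU => /forall_inP H.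
    by rewrite !(implyP (forall_inP (H _ _) x xU)) // eq_sym.
  by rewrite !(negbTE (forall_inP (H _ _) x xU)).
have /forall_inP/(_ x) := modU; rewrite inE xU => /(_ isT)/orP[] /forall_inP H.
  by rewrite !(sym _ x) !H.
by rewrite !(sym _ x) !(negbTE (H _ _)).
Qed.

Lemma ncls_card : ncls w = #|[set v : 'I_n | rep w v == v]|.
Proof. by rewrite /ncls dn_encode big_mkord -sum1dep_card [RHS]big_mkcond. Qed.

(** Two vertices in one part of a decomposition are twins, so distinct representatives lie in
    distinct parts. *)
Lemma ncls_le_nd : ncls w <= nd e.
Proof.
rewrite /nd ncls_card; elim/big_ind: _ => [|x y xb yb|P].
- by rewrite -[leqRHS]card_ord max_card.
- by rewrite leq_min xb.
case/andP=> /and3P[/eqP coverP trivP nP] /forall_inP PU.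
have inP u : pblock P u \in P by rewrite pblock_mem // coverP.
rewrite -(card_in_imset (f := pblock P)); last first.
  move=> u v; rewrite !inE => /eqP ru /eqP rv E.
  have /andP[mU cU] := PU _ (inP u).
  have /rep_twins : twins u v.
    by apply: (module_twins mU cU); rewrite ?mem_pblock ?coverP // E mem_pblock coverP.
  by rewrite ru rv => /val_inj.
by apply: subset_leq_card; apply/subsetP => _ /imsetP[u _ ->].
Qed.

End Encode.

(** * Linear systems solved bit by bit *)

Lemma digits_exist b q (f : nat -> nat) : (forall r, r < q -> f r < b) ->
  exists2 c, c < b ^ q & forall r, r < q -> c %/ b ^ r %% b = f r.
Proof.
elim: q f => [|q IH] f fb; first by exists 0.
have [|c cb Hc] := IH (f \o succn); first by move=> r /= rq; apply: fb.
have f0 : f 0 < b by apply: fb.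
have b0 : 0 < b by apply: leq_ltn_trans f0.
exists (c * b + f 0); first by rewrite expnS; nia.
case=> [|r] rq; first by rewrite divn1 modnMDl modn_small.
by rewrite expnS divnMA divnMDl // (divn_small f0) addn0 Hc.
Qed.

Section System.
Variables (R : Type) (code : R -> nat) (decode : nat -> R) (act : R -> Prop).
Hypothesis codeK : forall r, act r -> decode (code r) = r.
Variables (lhs rhs : R -> (nat -> nat) -> nat) (N P : nat).
Variables (kn : nat -> Prop) (K : nat -> nat).

Definition linear (F : (nat -> nat) -> nat) :=
  forall x y z, (forall j, x j = 2 * y j + z j) -> F x = 2 * F y + F z.

Hypothesis lhs_linear : forall r, linear (lhs r).
Hypothesis rhs_linear : forall r, linear (rhs r).
Hypothesis lhs_le : forall r x, act r -> (forall j, x j <= 1) -> lhs r x <= P.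
Hypothesis rhs_le : forall r x, act r -> (forall j, x j <= 1) -> rhs r x <= P.
Hypothesis K_lt : forall j, kn j -> K j < 2 ^ N.

(* The offset [O r - P] of row [r] is an integer of absolute value at most *)
(* [P]; it is stored shifted by [P].                                       *)
Definition sat i (O : nat -> nat) x :=
  [/\ forall j, x j < 2 ^ (N - i), forall j, kn j -> x j = K j %/ 2 ^ i &
      forall r, act r -> lhs r x + P <= rhs r x + O (code r)].

Lemma linear0 F x : linear F -> (forall j, x j = 0) -> F x = 0.
Proof.
move=> lF x0; have H j : x j = 2 * x j + x j by rewrite x0.
by have := lF x x x H; lia.
Qed.

Lemma sat_last O : (exists x, sat N O x) <-> (forall r, act r -> P <= O (code r)).
Proof.
split=> [[x [xN _ H]] r ar|H].
  have x0 j : x j = 0 by have := xN j; rewrite subnn; lia.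
  by have := H r ar; rewrite (linear0 (@lhs_linear r) x0) (linear0 (@rhs_linear r) x0).
exists (fun=> 0); split=> [j|j kj|r ar]; first by rewrite expn_gt0.
  by rewrite divn_small ?K_lt.
by rewrite (linear0 (@lhs_linear r)) // (linear0 (@rhs_linear r)) //; apply: H.
Qed.

(** Substituting [2 * x1 + x0] for the unknowns makes each row a bound on an even number; halving it
    with rounding down loses nothing. *)
Lemma sat_step i O : i < N -> (forall r, act r -> O (code r) <= 2 * P) ->
  (exists x, sat i O x) <->
  exists x0 O' : nat -> nat,
    [/\ forall j, x0 j <= 1, forall c, O' c <= 2 * P,
        forall j, kn j -> x0 j = odd (K j %/ 2 ^ i),
        forall r, act r -> lhs r x0 + 2 * O' (code r) <= rhs r x0 + O (code r) + P &
        exists x, sat i.+1 O' x].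
Proof.
move=> iN OP; split.
  move=> [x [xN xK H]].
  pose x0 j : nat := odd (x j); pose x1 j := x j %/ 2.
  have xE j : x j = 2 * x1 j + x0 j.
    by rewrite /x1 /x0 -modn2 mulnC -divn_eq.
  have x01 j : x0 j <= 1 by apply: leq_b1.
  (* On active rows the numerator is between 0 and [4 * P], so the subtraction is exact and [minn]
     has no effect; [minn] bounds the value on the other codes. *)
  pose O' c := minn (2 * P) ((rhs (decode c) x0 + O c + P - lhs (decode c) x0) %/ 2).
  have O'E r : act r ->
      O' (code r) = (rhs r x0 + O (code r) + P - lhs r x0) %/ 2.
    move=> ar; rewrite /O' codeK //; apply/minn_idPr.
    by have := rhs_le ar x01; have := OP r ar; lia.
  exists x0, O'; split=> //.
  - by move=> c; apply: geq_minl.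
  - by move=> j kj; rewrite /x0 xK.
  - by move=> r ar; rewrite O'E //; have := lhs_le ar x01; lia.
  exists x1; split=> [j|j kj|r ar].
  - by rewrite /x1 ltn_divLR // -expnSr -subSn // subSS xN.
  - by rewrite /x1 xK // expnSr divnMA.
  have := H r ar; rewrite O'E // (lhs_linear r xE) (rhs_linear r xE).
  by have := lhs_le ar x01; lia.
move=> [x0 [O' [x01 O'P x0K H0 [x1 [x1N x1K H1]]]]].
exists (fun j => 2 * x1 j + x0 j); split=> [j|j kj|r ar].
- have := x1N j; have := x01 j; rewrite -(subnSK iN) expnS; lia.
- by rewrite x1K // x0K // expnSr divnMA mulnC -modn2 -divn_eq.
rewrite (lhs_linear r (y := x1) (z := x0)) // (rhs_linear r (y := x1) (z := x0)) //.
by have := H0 r ar; have := H1 r ar; lia.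
Qed.

End System.

(** * The rows of the game are linear and bounded on bit vectors *)

Section Rows.
Variables (L : nat) (M : nat -> nat -> bool) (u : nat -> nat) (a0 b0 : nat).
Variable sg : nat -> nat -> bool.

Lemma sum_linear l (c : nat -> nat) (f x y z : nat -> nat) :
  (forall j, x j = 2 * y j + z j) ->
  \sum_(0 <= i < l) c i * x (f i) =
  2 * (\sum_(0 <= i < l) c i * y (f i)) + \sum_(0 <= i < l) c i * z (f i).
Proof.
move=> E; rewrite big_distrr -big_split; apply: eq_bigr => i _ /=.
by rewrite E; lia.
Qed.

Lemma sum_linear1 l (f x y z : nat -> nat) :
  (forall j, x j = 2 * y j + z j) ->
  \sum_(0 <= i < l) x (f i) =
  2 * (\sum_(0 <= i < l) y (f i)) + \sum_(0 <= i < l) z (f i).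
Proof.
by move=> E; rewrite big_distrr -big_split; apply: eq_bigr => i _ /=.
Qed.

Lemma lhs_linear h U ty : linear (fun x => lhs L M sg x h U ty).
Proof.
move=> x y z E; rewrite /lhs; do ![case: ifP => _] => //; last first.
  exact: sum_linear1.
rewrite big_distrr -big_split; apply: eq_bigr => i _ /=.
by rewrite (sum_linear1 _ _ E).
Qed.

Lemma rhs_linear h U ty : linear (fun x => rhs L M u a0 b0 x h U ty).
Proof.
move=> x y z E; rewrite /rhs /inflow; do ![case: ifP => _] => //;
  rewrite ?E !(sum_linear _ _ _ E); lia.
Qed.

Definition active H (r : nat * nat * nat) :=
  [/\ r.1.1 < H, sg r.1.1 L, r.1.2 < L & r.2 < 5].

Lemma rowsP H (P : nat -> nat -> nat -> bool) :
  reflect (forall r, active H r -> P r.1.1 r.1.2 r.2) (rows L sg H P).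
Proof.
apply: (iffP allP) => [HP [[h U] ty] [/= hH al UL ty5]|HP h].
  have := HP h; rewrite mem_iota hH al => /(_ isT) /allP/(_ U).
  by rewrite mem_iota UL => /(_ isT) /allP/(_ ty); rewrite mem_iota ty5 => /(_ isT).
rewrite mem_iota => /andP[_ hH]; apply/implyP => al; apply/allP => U.
rewrite mem_iota => /andP[_ UL]; apply/allP => ty; rewrite mem_iota => /andP[_ ty5].
exact: (HP (h, U, ty)).
Qed.

Lemma ix_lt H h U V : h < H -> U <= L -> V <= L -> ix L h U V < H * (L.+1 * L.+1).
Proof. by move=> hH UL VL; rewrite /ix; nia. Qed.

Lemma parent_lt H h : h < H -> parent L h < H.
Proof. by rewrite /parent => hH; apply: leq_ltn_trans (leq_div _ _) _; lia. Qed.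

Definition agree H (x y : nat -> nat) := forall j, j < H * (L.+1 * L.+1) -> x j = y j.

Lemma agree_ix H x y (h U V : nat) : agree H x y -> h < H -> U <= L -> V <= L ->
  x (ix L h U V) = y (ix L h U V).
Proof. by move=> xy hH UL VL; apply: xy; apply: ix_lt. Qed.

Lemma inflow_agree H x y h U : agree H x y -> h < H -> U < L ->
  inflow L M u a0 b0 x h U = inflow L M u a0 b0 y h U.
Proof.
move=> xy hH UL; apply: eq_big_nat => i /andP[_ iL].
by rewrite (agree_ix xy) // ltnW.
Qed.

Lemma lhs_agree H x y r : agree H x y -> active H r ->
  lhs L M sg x r.1.1 r.1.2 r.2 = lhs L M sg y r.1.1 r.1.2 r.2.
Proof.
case: r => [[h U] ty] xy [/= hH _ UL _]; have H0 : 0 < H by lia.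
have UL' := ltnW UL; rewrite /lhs; do ![case: ifP => _] => //.
- apply: eq_big_nat => i /andP[_ iL]; apply: eq_big_nat => j /andP[_ jL].
  by rewrite (agree_ix xy) // ltnW.
- by apply: eq_big_nat => i /andP[_ iL]; rewrite (agree_ix xy) // ltnW.
- by rewrite (agree_ix xy).
- by rewrite (agree_ix xy).
by rewrite (agree_ix xy).
Qed.

Lemma rhs_agree H x y r : agree H x y -> active H r ->
  rhs L M u a0 b0 x r.1.1 r.1.2 r.2 = rhs L M u a0 b0 y r.1.1 r.1.2 r.2.
Proof.
case: r => [[h U] ty] xy [/= hH _ UL _]; have H0 : 0 < H by lia.
have UL' := ltnW UL; have pH := parent_lt hH.
rewrite /rhs; do ![case: ifP => _]; rewrite ?(inflow_agree xy) ?(agree_ix xy) //.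
congr addn; apply: eq_big_nat => i /andP[_ iL].
by rewrite (agree_ix xy) // ltnW.
Qed.

Lemma sum_le1 l (F : nat -> nat) c : (forall i, F i <= c) -> \sum_(0 <= i < l) F i <= l * c.
Proof.
move=> Fc; apply: leq_trans (leq_sum _ (fun i _ => Fc i)) _.
by rewrite sum_nat_const_nat subn0.
Qed.

Lemma lhs_bits H x r : (forall j, x j <= 1) -> active H r ->
  lhs L M sg x r.1.1 r.1.2 r.2 <= H * (L.+1 * L.+1) + 2.
Proof.
case: r => [[h U] ty] x1 [/= hH _ UL _].
have H1 : L * L <= H * (L.+1 * L.+1) by nia.
rewrite /lhs; do ![case: ifP => _] => //.
- apply: leq_trans (sum_le1 _ (fun i => sum_le1 _ (fun j => x1 _))) _; lia.
- by apply: leq_trans (sum_le1 _ (fun j => x1 _)) _; nia.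
- by apply: leq_trans (x1 _) _; lia.
- by apply: leq_trans (x1 _) _; lia.
by apply: leq_trans (x1 _) _; lia.
Qed.

Lemma rhs_bits H x r : (forall j, x j <= 1) -> active H r ->
  rhs L M u a0 b0 x r.1.1 r.1.2 r.2 <= H * (L.+1 * L.+1) + 2.
Proof.
case: r => [[h U] ty] x1 [/= hH _ UL _].
have H1 : L * L <= H * (L.+1 * L.+1) by nia.
have bx (b : bool) j : b * x j <= 1 by have := x1 j; case: b; lia.
rewrite /rhs /inflow; do ![case: ifP => _] => //; try by apply: leq_trans (x1 _) _; lia.
- by apply: leq_trans (sum_le1 _ (fun j => bx _ _)) _; nia.
- by apply: leq_trans (sum_le1 _ (fun j => bx _ _)) _; nia.
by apply: leq_trans (leq_add (x1 _) (sum_le1 _ (fun j => bx _ _))) _; nia.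
Qed.

Definition rcode (r : nat * nat * nat) := row L r.1.1 r.1.2 r.2.
Definition rdecode c := (c %/ 5 %/ L, c %/ 5 %% L, c %% 5).

Lemma rcodeK H r : active H r -> rdecode (rcode r) = r.
Proof.
case: r => [[h U] ty] [/= _ _ UL ty5]; rewrite /rdecode /rcode /row /=.
have L0 : 0 < L by lia.
by rewrite divnMDl // modnMDl !(divn_small ty5) !(modn_small ty5) addn0
  divnMDl // modnMDl divn_small // modn_small // addn0.
Qed.

Lemma rcode_lt H r : active H r -> rcode r < 5 * (H * (L.+1 * L.+1)).
Proof. by case: r => [[h U] ty] [/= hH _ UL ty5]; rewrite /rcode /row /=; nia. Qed.

End Rows.

Lemma prec_double X m : 0 < X -> prec 1 (fun _ z => minn X (2 * z)) m = minn X (2 ^ m).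
Proof.
move=> X0; elim: m => [|m IH] /=; first by rewrite expn0; lia.
by rewrite IH expnS; lia.
Qed.

Lemma ix_mod L h U V : V <= L -> ix L h U V %% L.+1 = V.
Proof. by move=> VL; rewrite /ix modnMDl modn_small. Qed.

(** The interface between the two halves of the proof: the table decides whether a plan exists, and
    the game is compared with plans only. *)
Definition plan L M u a0 b0 k H (sg : nat -> nat -> bool) (x : nat -> nat) :=
  [/\ comb L M a0 b0 sg H,
      forall U, U < L -> x (ix L 0 L U) = u U,
      x (ix L 0 L L) = k &
      forall r, active L sg H r ->
        lhs L M sg x r.1.1 r.1.2 r.2 + offL L a0 b0 r.1.1 r.1.2 r.2 <=
        rhs L M u a0 b0 x r.1.1 r.1.2 r.2 + offR L a0 b0 r.1.1 r.1.2 r.2].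

Section SgAgree.
Variables (L : nat) (M : nat -> nat -> bool) (a0 b0 H : nat).
Variables sg sg' : nat -> nat -> bool.
Hypothesis sgE : forall h V, h < H -> V <= L -> sg h V = sg' h V.

Lemma comb_agree : 0 < H -> comb L M a0 b0 sg H = comb L M a0 b0 sg' H.
Proof.
move=> H0; rewrite /comb sgE //; congr andb; apply: eq_in_all => h.
rewrite mem_iota => /andP[_ hH]; rewrite sgE //; congr implb; congr [&& _, _ & _].
  apply: eq_in_all => U; rewrite mem_iota => /andP[_ UL].
  by rewrite sgE // ltnW.
apply: eq_in_all => v; rewrite mem_iota => /andP[_ vL].
have L0 : 0 < L by case: (L) vL.
case: ltnP => //= cH; rewrite /legal !sgE //; first exact/ltnW/ltn_pmod.
by rewrite ltnW // ltn_divLR.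
Qed.

Lemma active_agree r : active L sg H r <-> active L sg' H r.
Proof. by split=> -[h1 h2 h3 h4]; split=> //; rewrite ?sgE // -?sgE. Qed.

Lemma lhs_sg_agree x r : active L sg H r ->
  lhs L M sg x r.1.1 r.1.2 r.2 = lhs L M sg' x r.1.1 r.1.2 r.2.
Proof. by case=> h1 h2 h3 h4; rewrite /lhs sgE // ltnW. Qed.

End SgAgree.

(** * A table obeying the recursion decides the existence of a plan *)

Section FillCorrect.
Variables (w : seq bool) (X k : nat).
Let L := Lw w.
Let M := Mw w.
Let u := uw w.
Let a0 := aw w.
Let b0 := bw w.
Let H := nodes w X.
Let N := size w.
Let P := offset w X.
Hypothesis enoughX : enough w X.
Hypothesis kbitE : forall i, kbit w i = odd (k %/ 2 ^ i).
Hypothesis k_lt : k < 2 ^ N.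
Hypothesis u_lt : forall U, u U < 2 ^ N.
Hypothesis H_gt0 : 0 < H.

Lemma large_lt : 2 ^ (large w X * large w X) < X.
Proof.
have X0 : 0 < X by apply: leq_ltn_trans enoughX.
by move: enoughX; rewrite /enough prec_double // gtn_min ltnn.
Qed.

Lemma bits_code (f : nat -> nat) : (forall j, f j <= 1) ->
  exists2 c, c < X & forall j, j < nvars w X -> bit c j = f j :> nat.
Proof.
move=> f1; have [|c cb cE] := @digits_exist 2 (nvars w X) f; first by move=> r _; apply: f1.
exists c; first apply: leq_trans cb (leq_trans _ (ltnW large_lt)).
  by rewrite leq_exp2l // /large; nia.
by move=> j jv; rewrite /bit -modn2 cE.
Qed.

Lemma digits_code (f : nat -> nat) : (forall c, f c <= 2 * P) ->
  exists2 o, o < X & forall c, c < 5 * nvars w X -> digit w X o c = f c.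
Proof.
move=> fP; have [|o ob oE] := @digits_exist (base w X) (5 * nvars w X) f.
  by move=> r _; rewrite ltnS.
exists o; last exact: oE.
apply: leq_trans ob (leq_trans _ (ltnW large_lt)).
rewrite [2 ^ _]expnM; apply: (@leq_trans (large w X ^ large w X)).
  apply: (@leq_trans (large w X ^ (5 * nvars w X))).
    by rewrite leq_wexp2r // /base /offset /large; lia.
  by rewrite leq_pexp2l // /large; lia.
by rewrite leq_wexp2r // ltnW // ltn_expl.
Qed.

Lemma sg_code (sgb : nat -> nat -> bool) :
  exists2 sg, sg < X & forall h V, h < H -> V <= L -> sgw w sg h V = sgb h V.
Proof.
have [|c cX cE] := @bits_code (fun i => sgb (i %/ L.+1) (i %% L.+1)).
  by move=> j; apply: leq_b1.
exists c => // h V hH VL; apply/eqP; rewrite /sgw -/L.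
have := cE (h * L.+1 + V); rewrite divnMDl // modnMDl (divn_small (_ : V < L.+1)) //.
rewrite (modn_small (_ : V < L.+1)) // addn0 => E.
have /E : h * L.+1 + V < nvars w X by rewrite /nvars -[ncls w]/L -[nodes w X]/H; nia.
by case: (bit _ _); case: (sgb _ _).
Qed.

Definition known j := exists2 U, U <= L & j = ix L 0 L U.
Definition kval j := if j %% L.+1 == L then k else u (j %% L.+1).

Lemma kvalE U : U <= L -> kval (ix L 0 L U) = if U == L then k else u U.
Proof. by move=> UL; rewrite /kval ix_mod. Qed.

Lemma kval_lt j : kval j < 2 ^ N.
Proof. by rewrite /kval; case: ifP. Qed.

Section Fixed.
Variable sg : nat.

Let act := active L (sgw w sg) H.
Let lhsr r x := lhs L M (sgw w sg) x r.1.1 r.1.2 r.2.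
Let rhsr r x := rhs L M u a0 b0 x r.1.1 r.1.2 r.2.

Definition solves i O x := sat (rcode L) act lhsr rhsr N P known kval i O x.

Let sat_lastE := @sat_last _ (rcode L) act lhsr rhsr N P known kval
  (fun r => @lhs_linear L M (sgw w sg) r.1.1 r.1.2 r.2)
  (fun r => @rhs_linear L M u a0 b0 r.1.1 r.1.2 r.2) (fun j _ => kval_lt j).

Let lhsr_le r x (ar : act r) (x1 : forall j, x j <= 1) : lhsr r x <= P :=
  @lhs_bits L M (sgw w sg) H x r x1 ar.
Let rhsr_le r x (ar : act r) (x1 : forall j, x j <= 1) : rhsr r x <= P :=
  @rhs_bits L M u a0 b0 (sgw w sg) H x r x1 ar.

Let sat_stepE := @sat_step _ (rcode L) (rdecode L) act (@rcodeK L (sgw w sg) H)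
  lhsr rhsr N P known kval
  (fun r => @lhs_linear L M (sgw w sg) r.1.1 r.1.2 r.2)
  (fun r => @rhs_linear L M u a0 b0 r.1.1 r.1.2 r.2) lhsr_le rhsr_le.

Lemma digit_le o c : digit w X o c <= 2 * P.
Proof. by rewrite /digit -ltnS ltn_pmod. Qed.

Definition known_bits i (x0 : nat) :=
  [&& all (fun U => bit x0 (ix L 0 L U) ==> bit (u U) i) (iota 0 L),
      all (fun U => bit (u U) i ==> bit x0 (ix L 0 L U)) (iota 0 L),
      bit x0 (ix L 0 L L) ==> kbit w i & kbit w i ==> bit x0 (ix L 0 L L)].

Lemma known_bitsP i x0 : reflect
  (forall j, known j -> bit x0 j = odd (kval j %/ 2 ^ i)) (known_bits i x0).
Proof.
apply: (iffP and4P) => [[/allP H1 /allP H2 /implyP H3 /implyP H4] j [U UL ->]|HK].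
  apply/idP/idP; rewrite kvalE //; case: eqP => [->|/eqP UnL]; rewrite -?kbitE //.
    by apply/implyP; apply: H1; rewrite mem_iota; lia.
  by apply/implyP; apply: H2; rewrite mem_iota; lia.
have HU U : U < L -> bit x0 (ix L 0 L U) = bit (u U) i.
  by move=> UL; rewrite HK ?kvalE ?(ltn_eqF UL) ?(ltnW UL) //; exists U => //; apply: ltnW.
have HL : bit x0 (ix L 0 L L) = kbit w i.
  by rewrite HK ?kvalE ?eqxx ?kbitE //; exists L.
rewrite HL implybb; split=> //; apply/allP => U; rewrite mem_iota => /andP[_ UL];
  by rewrite HU // implybb.
Qed.

Variable A : nat -> bool.
Hypothesis fillA : forall z, z < slots w X -> A z = fill w X A z.

Lemma slot_lt lev o : lev <= N -> sg < X -> o < X -> slot X lev sg o < slots w X.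
Proof. by move=> le_lev sgX oX; rewrite /slots /slot -/N; nia. Qed.

Lemma fill_slot lev o : lev <= N -> sg < X -> o < X ->
  A (slot X lev sg o) = (if lev == 0 then
    rows L (sgw w sg) H (fun h U ty => P <= digit w X o (row L h U ty))
  else has (fun x0 => has (fun o' =>
    [&& known_bits (N - lev) x0,
        rows L (sgw w sg) H (fun h U ty =>
          lhsr (h, U, ty) (fun j => bit x0 j) + 2 * digit w X o' (row L h U ty) <=
          rhsr (h, U, ty) (fun j => bit x0 j) + digit w X o (row L h U ty) + P) &
        A (slot X lev.-1 sg o')]) (iota 0 X)) (iota 0 X)).
Proof.
move=> le_lev sgX oX; rewrite fillA ?slot_lt // /fill.
have X0 : 0 < X by lia.
rewrite /slot modnMDl (modn_small oX) divnMDl // (divn_small oX) addn0.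
rewrite modnMDl (modn_small sgX) divnMDl // (divn_small sgX) addn0.
case: ifP => // _; apply: eq_has => x0; apply: eq_has => o'.
by rewrite /known_bits -!andbA.
Qed.

Lemma fillP lev o : lev <= N -> sg < X -> o < X ->
  A (slot X lev sg o) <-> exists x, solves (N - lev) (digit w X o) x.
Proof.
move=> + sgX; elim: lev o => [|lev IH] o le_lev oX; rewrite fill_slot //=.
  rewrite subn0; split=> [/rowsP HR|HX]; first exact/sat_lastE.
  by apply/rowsP => r ar; apply: (iffLR (sat_lastE _) HX).
have le_lev' := ltnW le_lev.
have lt_i : N - lev.+1 < N by lia.
have iE : (N - lev.+1).+1 = N - lev by rewrite subnSK.
have HS := sat_stepE lt_i (fun r _ => digit_le o (rcode L r)).
rewrite iE in HS; apply: iff_trans (iff_sym HS); split.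
  case/hasP => x0; rewrite mem_iota => /andP[_ x0X] /hasP[o'].
  rewrite mem_iota => /andP[_ o'X] /and3P[/known_bitsP HK /rowsP HR HA].
  exists (fun j => bit x0 j), (digit w X o'); split.
  - by move=> j; apply: leq_b1.
  - exact: digit_le.
  - by move=> j /HK->.
  - by move=> r ar; apply: HR.
  by apply/IH.
case=> [x0 [O' [x01 O'P x0K HR [x1 Hx1]]]].
have [c cX cE] := bits_code x01; have [o' o'X o'E] := digits_code O'P.
have ag : agree L H (fun j => bit c j) x0 by [].
have dE r : act r -> digit w X o' (rcode L r) = O' (rcode L r).
  by move=> ar; apply: o'E; apply: rcode_lt ar.
apply/hasP; exists c; first by rewrite mem_iota.
apply/hasP; exists o'; first by rewrite mem_iota.
apply/and3P; split.
- apply/known_bitsP => j kj; have [U UL jE] := kj.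
  have := cE j; rewrite x0K // jE => E.
  have /E : ix L 0 L U < nvars w X by apply: ix_lt.
  by rewrite -jE; case: (bit _ _); case: (odd _).
- apply/rowsP => -[[h V] ty] ar; have := HR _ ar; rewrite -dE //.
  by rewrite /lhsr /rhsr -(lhs_agree M ag ar) -(rhs_agree M u a0 b0 ag ar).
apply/IH => //; exists x1; case: Hx1 => H1 H2 H3; split=> // r ar.
by rewrite dE //; apply: H3.
Qed.

End Fixed.

Variable A : nat -> bool.
Hypothesis fillA : forall z, z < slots w X -> A z = fill w X A z.

Lemma occ_le2 h V : occ L a0 b0 h V <= 2.
Proof. by rewrite /occ; do 2!case: (_ == _). Qed.

Lemma divider_winsP : divider_wins w X A <->
  exists sg x, (forall j, x j < 2 ^ N) /\ plan L M u a0 b0 k H sg x.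
Proof.
split.
  case/hasP => sg; rewrite mem_iota => /andP[_ sgX] /andP[comb_sg /hasP[o]].
  rewrite mem_iota => /andP[_ oX] /andP[/rowsP HO /(fillP fillA (leqnn N) sgX oX)].
  rewrite subnn => -[x [xN xK HR]]; exists (sgw w sg), x.
  split; first by move=> j; have := xN j; rewrite subn0.
  split=> // [U UL||r ar].
  - by rewrite xK ?kvalE ?divn1 ?(ltn_eqF UL) ?(ltnW UL) //; exists U; rewrite // ltnW.
  - by rewrite xK ?kvalE ?divn1 ?eqxx //; exists L.
  have := HR r ar; have /eqP := HO r ar; rewrite -/(rcode _ _) -/P -/L -/M -/a0 -/b0 -/u.
  by move: (digit _ _ _ _) (lhs _ _ _ _ _ _ _) (rhs _ _ _ _ _ _ _ _ _) (offL _ _ _ _ _ _)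
    (offR _ _ _ _ _ _) P => d a b c f p; lia.
case=> sgb [x [xN [comb_sg xu xk HR]]].
have [sg sgX sgE] := sg_code sgb.
pose f c := let r := rdecode L c in
  P + offR L a0 b0 r.1.1 r.1.2 r.2 - offL L a0 b0 r.1.1 r.1.2 r.2.
have offR2 h U ty : offR L a0 b0 h U ty <= 2.
  by rewrite /offR; case: ifP => // _; apply: occ_le2.
have offL2 h U ty : offL L a0 b0 h U ty <= 2.
  by rewrite /offL; case: ifP => // _; apply: occ_le2.
have P2 : 2 <= P by rewrite /P /offset leq_addl.
have [|o oX oE] := @digits_code f.
  by move=> c; rewrite /f; have := offR2 (rdecode L c).1.1 (rdecode L c).1.2 (rdecode L c).2; lia.
have oE' r : active L (sgw w sg) H r -> digit w X o (rcode L r) =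
    P + offR L a0 b0 r.1.1 r.1.2 r.2 - offL L a0 b0 r.1.1 r.1.2 r.2.
  by move=> ar; rewrite oE ?(rcode_lt ar) // /f (rcodeK ar).
apply/hasP; exists sg; first by rewrite mem_iota.
apply/andP; split; first by rewrite (comb_agree M a0 b0 sgE).
apply/hasP; exists o; first by rewrite mem_iota.
apply/andP; split.
  apply/rowsP => r ar; apply/eqP; have := oE' r ar; rewrite /rcode => ->.
  by have := offL2 r.1.1 r.1.2 r.2; rewrite -/P -/L -/a0 -/b0; lia.
apply/(fillP fillA (leqnn N) sgX oX); rewrite subnn; exists x; split.
- by move=> j; rewrite subn0.
- move=> j [U UL ->]; rewrite kvalE // divn1; case: eqP => [->//|/eqP UnL].
  by rewrite xu // ltn_neqAle UnL.
move=> r ar; rewrite oE' //; have ar' := iffLR (active_agree sgE r) ar.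
have := HR r ar'; rewrite -(lhs_sg_agree M sgE x ar) /solves.
have := offL2 r.1.1 r.1.2 r.2; move: P2.
by move: (lhs _ _ _ _ _ _ _) (rhs _ _ _ _ _ _ _ _ _) (offL _ _ _ _ _ _)
  (offR _ _ _ _ _ _) P => a b c d p; lia.
Qed.

End FillCorrect.

(** * Placing agents *)

Lemma subset_of_card (T : finType) (A : {set T}) m : m <= #|A| ->
  exists2 B : {set T}, B \subset A & #|B| = m.
Proof.
move=> mA; exists [set x in take m (enum A)].
  by apply/subsetP => x; rewrite inE => /mem_take; rewrite mem_enum.
rewrite cardsE (card_uniqP _) ?take_uniq ?enum_uniq // size_take -cardE.
by case: ltngtP mA => //.
Qed.

Lemma subset_between (T : finType) (A B : {set T}) m :
  A \subset B -> #|A| <= m -> m <= #|B| ->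
  exists C : {set T}, [/\ A \subset C, C \subset B & #|C| = m].
Proof.
move=> AB Am mB; have [|C CB Cm] := @subset_of_card _ (B :\: A) (m - #|A|).
  by rewrite cardsD (setIidPr AB); lia.
have dAC : [disjoint A & C].
  by move: CB; rewrite subsetD disjoint_sym => /andP[].
exists (A :|: C); rewrite subsetUl subUset AB.
split=> //; first by apply: subset_trans CB (subsetDl _ _).
by rewrite cardsU disjoint_setI0 // cards0 Cm; lia.
Qed.

(** Elements beyond the demands [f] receive the default [d]. *)
Lemma distribute (T : finType) (A : {set T}) (f : nat -> nat) m d :
  \sum_(0 <= V < m) f V <= #|A| ->
  exists g : T -> nat, (forall i, g i = d \/ g i < m) /\
    forall V, V < m -> f V <= #|[set i in A | g i == V]|.
Proof.
elim: m A => [|m IH] A; first by exists (fun=> d); split=> // i; left.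
rewrite big_nat_recr //= => le_A.
have [|B BA Bm] := @subset_of_card _ A (f m); first by lia.
have [|g [g_lt Hg]] := IH (A :\: B); first by rewrite cardsD (setIidPr BA) Bm; lia.
exists (fun i => if i \in B then m else g i); split=> [i|V].
  by case: ifP => _; [right|case: (g_lt i) => [->|]; [left|right; apply: leqW]].
rewrite ltnS leq_eqVlt => /orP[/eqP->|Vm].
  rewrite -Bm; apply/subset_leq_card/subsetP => i iB.
  by rewrite inE iB eqxx (subsetP BA).
apply: leq_trans (Hg V Vm) (subset_leq_card _); apply/subsetP => i.
by rewrite !inE => /andP[/andP[/negbTE-> ->] /eqP->]; rewrite eqxx.
Qed.

Lemma transversal_image (T T' : finType) (d : T -> T') (A : {set T}) :
  exists B : {set T}, [/\ B \subset A, d @: B = d @: A & #|B| = #|d @: A|].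
Proof.
have [->|[i0 i0A]] := set_0Vmem A; first by exists set0; rewrite imset0 !cards0 sub0set.
pose g v := odflt i0 [pick i in A | d i == v].
have gK v : v \in d @: A -> g v \in A /\ d (g v) = v.
  case/imsetP => i iA ->; rewrite /g; case: pickP => [j /andP[jA /eqP]|/(_ i)] //.
  by rewrite iA eqxx.
exists (g @: (d @: A)); split.
- by apply/subsetP => _ /imsetP[v /gK[gA _] ->].
- apply/setP => v; apply/imsetP/idP => [[_ /imsetP[v' v'A ->] ->]|vA].
    by have [_ ->] := gK _ v'A.
  by exists (g v); [apply: imset_f|have [_ ->] := gK _ vA].
apply: card_in_imset => v v' /gK[_ {2}<-] /gK[_ {2}<-]; exact: congr1.
Qed.

Section Placement.
Variables (k n : nat) (cl : 'I_n -> nat).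
Implicit Types (d : {ffun 'I_k -> 'I_n}).

Definition cnt d V := #|[set i | cl (d i) == V]|.
Definition cov d V := #|d @: [set i | cl (d i) == V]|.

(** Mobile agents bound for a class are matched, in enumeration order, with its vertices held
    neither by [F] nor by an agent that stays. Surplus agents go to any vertex of the class outside
    [F]. *)
Lemma place (tgt : 'I_k -> nat) (mob : {set 'I_k}) d (F : {set 'I_n}) :
  (forall i, i \in mob -> exists2 y, y \notin F & cl y = tgt i) ->
  (forall i, i \notin mob -> cl (d i) = tgt i /\ d i \notin F) ->
  exists d', [/\ forall i, i \notin mob -> d' i = d i,
    forall i, cl (d' i) = tgt i /\ d' i \notin F &
    forall V, minn #|[set y | (cl y == V) && (y \notin F)]|
      (#|d @: [set i | (i \notin mob) && (tgt i == V)]| +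
       #|[set i in mob | tgt i == V]|) <= cov d' V].
Proof.
move=> Hmob Hstay.
pose K V := d @: [set i | (i \notin mob) && (tgt i == V)].
pose Y V := [set y | (cl y == V) && (y \notin F)].
pose Z V := [set i in mob | tgt i == V].
pose y0 i := odflt (d i) [pick y | (cl y == tgt i) && (y \notin F)].
pose h i := if i \in mob then
  nth (y0 i) (enum (Y (tgt i) :\: K (tgt i))) (index i (enum (Z (tgt i)))) else d i.
have y0P i : i \in mob -> cl (y0 i) = tgt i /\ y0 i \notin F.
  move=> /Hmob[y yF yt]; rewrite /y0; case: pickP => [z /andP[/eqP]|/(_ y)] //.
  by rewrite yt eqxx yF.
exists [ffun i => h i].
have hP i : cl (h i) = tgt i /\ h i \notin F.
  rewrite /h; case: ifP => [im|/negbT/Hstay//].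
  set l := enum _; set j := index _ _.
  case: (ltnP j (size l)) => [jl|jl]; last by rewrite nth_default //; apply: y0P.
  have := mem_nth (y0 i) jl; rewrite /l mem_enum !inE.
  by case/and3P => _ /eqP -> ->.
split=> [i im|i|V]; rewrite ?ffunE //.
  by rewrite /h (negbTE im).
rewrite -/(K V) -/(Y V) -/(Z V).
pose m := minn #|Z V| #|Y V :\: K V|.
pose B := [set y in take m (enum (Y V :\: K V))].
have KY : K V \subset Y V.
  apply/subsetP => _ /imsetP[i + ->]; rewrite !inE => /andP[im /eqP <-].
  by have [-> ->] := Hstay i im; rewrite eqxx.
have cB : #|B| = m.
  rewrite cardsE (card_uniqP _) ?take_uniq ?enum_uniq // size_take -cardE.
  by rewrite /m; case: (ltnP (minn _ _)) => // H; apply/eqP; rewrite eqn_leq H geq_minr.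
have dKB : [disjoint K V & B].
  rewrite disjoint_sym disjoint_subset; apply/subsetP => y; rewrite !inE.
  by move/mem_take; rewrite mem_enum inE => /andP[].
have sub : K V :|: B \subset [ffun i => h i] @: [set i | cl ([ffun i => h i] i) == V].
  rewrite subUset; apply/andP; split; apply/subsetP => y.
    case/imsetP => i; rewrite inE => /andP[im iV] ->; apply/imsetP; exists i.
      by rewrite inE ffunE; have [-> _] := hP i.
    by rewrite ffunE /h (negbTE im).
  rewrite inE => /(nthP y)[j]; rewrite size_take_min leq_min => /andP[jm _].
  have {jm}[jm jZ jY] : [/\ j < m, j < #|Z V| & j < #|Y V :\: K V|].
    have mZ : m <= #|Z V| by apply: geq_minl.
    have mY : m <= #|Y V :\: K V| by apply: geq_minr.
    by split; rewrite // (leq_trans jm).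
  rewrite nth_take // => yE.
  have [i0 _] : exists i0 : 'I_k, True.
    by have /card_gt0P[i _] : 0 < #|Z V| by lia; exists i.
  pose i := nth i0 (enum (Z V)) j.
  have : i \in Z V by rewrite -mem_enum mem_nth // -cardE.
  rewrite inE => /andP[im /eqP iV].
  have hi : h i = y.
    rewrite /h im iV index_uniq ?enum_uniq -?cardE // -yE.
    by apply: set_nth_default; rewrite -cardE.
  apply/imsetP; exists i; rewrite ?inE ffunE ?hi //.
  by rewrite -hi; have [-> _] := hP i; rewrite iV.
apply: leq_trans (subset_leq_card sub).
rewrite cardsU disjoint_setI0 // cards0 subn0 cB /m cardsD (setIidPr KY).
by have := subset_leq_card KY; lia.
Qed.

(** The agents that stay should cover as much as possible. They are chosen inside a transversal, one
    agent for each occupied vertex, or around it if more of them stay. *)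
Lemma assign L d (f : nat -> nat -> nat) : (forall v, cl v < L) ->
  (forall U, U < L -> \sum_(0 <= V < L) f U V <= cnt d U) ->
  exists tgt : 'I_k -> nat,
    [/\ forall i, tgt i < L,
        forall U V, U < L -> V < L ->
          f U V <= #|[set i | (cl (d i) == U) && (tgt i == V)]| &
        forall U, U < L ->
          minn (f U U) (cov d U) <= #|d @: [set i | (cl (d i) == U) && (tgt i == U)]|].
Proof.
move=> cl_lt Hf.
have H1 (U : 'I_L) : exists g : {ffun 'I_k -> nat}, [/\ forall i, g i < L,
    forall V, V < L -> f U V <= #|[set i | (cl (d i) == U) && (g i == V)]| &
    minn (f U U) (cov d U) <= #|d @: [set i | (cl (d i) == U) && (g i == U)]|].
  pose A := [set i | cl (d i) == U].
  have fUA := Hf U (ltn_ord U).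
  have fUU : \sum_(0 <= V < L) (if V == U then 0 else f U V) + f U U <= #|A|.
    apply: leq_trans fUA; rewrite !big_mkord (bigD1 U) //= eqxx add0n.
    rewrite [leqRHS](bigD1 U) //= addnC leq_add2l.
    by apply: leq_sum => i _; case: ifP.
  have [T [TA dTA cT]] := transversal_image d A.
  have [S [SA cS cov_S]] : exists S : {set 'I_k},
      [/\ S \subset A, #|S| = f U U & minn (f U U) (cov d U) <= #|d @: S|].
    case: (leqP (f U U) #|T|) => le_T.
      have [S ST cS] := subset_of_card le_T; exists S; split=> //.
        exact: subset_trans TA.
      rewrite card_in_imset ?cS ?geq_minl // => i j iS jS.
      have /imset_injP : #|d @: T| == #|T| by rewrite dTA cT.
      by apply; apply: (subsetP ST).
    have [S [TS SA cS]] := subset_between TA (ltnW le_T) (leq_trans (leq_addl _ _) fUU).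
    exists S; split=> //; apply: leq_trans (geq_minr _ _) _.
    by rewrite /cov -/A -dTA subset_leq_card ?imsetS.
  (* Agents that no flow claims stay in [U], the default. *)
  have [|g [g_lt Hg]] := @distribute _ (A :\: S) (fun V => if V == U then 0 else f U V) L U.
    by rewrite cardsD (setIidPr SA) cS; lia.
  exists [ffun i => if i \in S then U : nat else g i]; split.
  - by move=> i; rewrite ffunE; case: ifP => // _; case: (g_lt i) => [->|].
  - move=> V VL; case: (eqVneq V U) => [->|VU].
      rewrite -cS; apply/subset_leq_card/subsetP => i iS.
      by rewrite inE ffunE iS eqxx andbT; have := subsetP SA i iS; rewrite inE.
    have := Hg V VL; rewrite (negbTE VU) => /leq_trans; apply.
    apply/subset_leq_card/subsetP => i.
    by rewrite !inE ffunE => /andP[/andP[/negbTE-> ->] ->].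
  apply: leq_trans cov_S _; apply/subset_leq_card/imsetS/subsetP => i iS.
  by rewrite inE ffunE iS eqxx andbT; have := subsetP SA i iS; rewrite inE.
have [G HG] := fin_all_exists H1.
exists (fun i => G (Ordinal (cl_lt (d i))) i); split.
- by move=> i; have [H _ _] := HG (Ordinal (cl_lt (d i))); apply: H.
- move=> U V UL VL; have [_ H _] := HG (Ordinal UL).
  apply: leq_trans (H V VL) _; apply/subset_leq_card/subsetP => i.
  rewrite !inE => /andP[/eqP E gV].
  have -> : Ordinal (cl_lt (d i)) = Ordinal UL by apply: val_inj.
  by rewrite gV andbT; apply/eqP.
move=> U UL; have [_ _ H] := HG (Ordinal UL).
apply: leq_trans H _; apply/subset_leq_card/imsetS/subsetP => i.
rewrite !inE => /andP[/eqP E gV].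
have -> : Ordinal (cl_lt (d i)) = Ordinal UL by apply: val_inj.
by rewrite gV andbT; apply/eqP.
Qed.

End Placement.

(** * The game as a linear system *)

Lemma card_fibers (T : finType) (A : {set T}) (g : T -> nat) L :
  (forall i, i \in A -> g i < L) ->
  #|A| = \sum_(0 <= U < L) #|[set i in A | g i == U]|.
Proof.
move=> g_lt; rewrite big_mkord.
transitivity (\sum_(U < L) \sum_(i in A | g i == U) 1).
  rewrite -sum1_card (exchange_big_dep (fun i => i \in A)) //=; last by move=> U i _ /andP[].
  apply: eq_bigr => i iA; rewrite (eq_bigl (pred1 (Ordinal (g_lt i iA)))) ?big_pred1_eq //.
  by move=> U; rewrite iA /= -val_eqE /= eq_sym.
by apply: eq_bigr => U _; rewrite sum1dep_card.
Qed.

Section Game.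
Variables (n : nat) (e : rel 'I_n) (k : nat).
Variables (L : nat) (M : nat -> nat -> bool) (u : nat -> nat) (cl : 'I_n -> nat).
Hypothesis simple_e : simple_graph e.
Hypothesis cl_lt : forall v, cl v < L.
Hypothesis cl_twins : forall a b x, cl a = cl b -> x != a -> x != b -> e a x = e b x.
Hypothesis MP : forall a b, M a b <-> exists x y : 'I_n, [/\ cl x = a, cl y = b & e x y].
Hypothesis uE : forall a, u a = #|[set v | cl v == a]|.
Implicit Types (d : {ffun 'I_k -> 'I_n}) (r j : 'I_n).

Lemma adj_M x y : e x y -> M (cl x) (cl y).
Proof. by move=> xy; apply/MP; exists x, y. Qed.

(** The ends of an edge between the classes are exchanged for the twins [x] and [y] one at a time.
    When the end [y'] is already [x], all four vertices are twins and [x'] is exchanged for [y]. *)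
Lemma M_adj x y : x != y -> M (cl x) (cl y) -> e x y.
Proof.
have [sym irr] := simple_e.
move=> xy /MP[x' [y' [xE yE xy']]].
have x'y' : x' != y' by apply: contraTneq xy' => ->; apply: irr.
have [y'x|y'x] := eqVneq y' x.
  subst y'; have [<-|x'y] := eqVneq x' y; first by rewrite sym.
  rewrite sym -(cl_twins (a := x')) // 1?eq_sym //; congruence.
have E : e x y' by rewrite -(cl_twins xE) // eq_sym.
by rewrite sym -(cl_twins yE) 1?sym // eq_sym.
Qed.

Definition free r j V := [set v | (cl v == V) && (v \notin [set r; j])].

Lemma card_free r j V : r != j ->
  #|free r j V| + ((cl r == V) + (cl j == V)) = u V.
Proof.
move=> rj; rewrite uE; set C := [set v | cl v == V].
have -> : free r j V = C :\ r :\ j.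
  by apply/setP => v; rewrite !inE negb_or; case: (v == r); case: (v == j); rewrite ?andbF ?andbT.
rewrite (cardsD1 r C) (cardsD1 j (C :\ r)) !inE (eq_sym j r) rj /=; lia.
Qed.

Lemma cov_free d r j V : (forall i, d i <> r) -> (forall i, d i <> j) ->
  d @: [set i | cl (d i) == V] \subset free r j V.
Proof.
move=> dr dj; apply/subsetP => _ /imsetP[i iV ->]; move: iV; rewrite !inE => -> /=.
by rewrite negb_or; apply/andP; split; apply/eqP; [apply: dr|apply: dj].
Qed.

Lemma leq_mul_bool (b : bool) x y : (b -> x <= y) -> b * x <= y.
Proof. by case: b => [/(_ isT)|_]; rewrite ?mul1n ?mul0n. Qed.

(** The rows of one node yield an actual move of Divider. An agent assigned to a forbidden pair
    stays in its class; nothing is lost, as only allowed pairs enter the sums. *)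
Lemma realize_step r j d (f : nat -> nat -> nat) (c : nat -> nat)
  (ok := fun U V => ((cl r == V) + (cl j == V) < u V) && ((U == V) || M U V)) :
  r != j -> (forall i, d i <> r) -> (forall i, d i <> j) ->
  (forall U, U < L -> \sum_(0 <= V < L) f U V <= cnt cl d U) ->
  (forall V, V < L -> c V <= \sum_(0 <= U < L) ok U V * f U V) ->
  (forall V, V < L -> c V + ((cl r == V) + (cl j == V)) <= u V) ->
  (forall V, V < L -> ~~ M V V ->
     c V <= cov cl d V + \sum_(0 <= U < L) ((U != V) && ok U V) * f U V) ->
  exists d' : {ffun 'I_k -> 'I_n},
    (forall i, [/\ adjc e (d i) (d' i), d' i <> r & d' i <> j]) /\
    forall V, V < L -> \sum_(0 <= U < L) ok U V * f U V <= cnt cl d' V /\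
      c V <= cov cl d' V.
Proof.
move=> rj dr dj Hf c_in c_av c_cov.
have [tgt0 [tgt0_lt Htgt0 Hcov0]] := assign cl_lt Hf.
pose tgt i := if ok (cl (d i)) (tgt0 i) then tgt0 i else cl (d i).
have tgt_lt i : tgt i < L by rewrite /tgt; case: ifP.
have Htgt U V : U < L -> V < L ->
    ok U V * f U V <= #|[set i | (cl (d i) == U) && (tgt i == V)]|.
  move=> UL VL; apply: leq_mul_bool => okUV; apply: leq_trans (Htgt0 U V UL VL) _.
  apply/subset_leq_card/subsetP => i; rewrite !inE => /andP[/eqP E /eqP E0].
  by rewrite /tgt E E0 okUV !eqxx.
have Hcov U : U < L ->
    minn (f U U) (cov cl d U) <= #|d @: [set i | (cl (d i) == U) && (tgt i == U)]|.
  move=> UL; apply: leq_trans (Hcov0 U UL) _; apply/subset_leq_card/imsetS/subsetP => i.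
  rewrite !inE => /andP[/eqP E /eqP E0]; rewrite /tgt E E0.
  by case: ifP; rewrite ?E !eqxx.
pose F := [set r; j].
have dF i : d i \notin F.
  by rewrite !inE negb_or; apply/andP; split; apply/eqP; [apply: dr|apply: dj].
have av_free V : (cl r == V) + (cl j == V) < u V -> exists2 y, y \notin F & cl y = V.
  rewrite -(card_free V rj) -[X in X < _]add0n ltn_add2r => /card_gt0P[y].
  by rewrite inE => /andP[/eqP yV yF]; exists y.
have tgt_ok i : tgt i = cl (d i) \/ ok (cl (d i)) (tgt i).
  by rewrite /tgt; case: ifP; [right|left].
(* An agent that changes its class can choose any vertex there, and so can one in a clique class.
   Only those that stay in an independent class keep their vertex. *)
pose mob := [set i | M (tgt i) (tgt i) || (cl (d i) != tgt i)].
have [|i|d' [stay d'P Hd']] := @place k n cl tgt mob d F.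
- move=> i _; case: (tgt_ok i) => [->|/andP[/av_free]] //.
  by exists (d i).
- by rewrite inE negb_or negbK => /andP[_ /eqP->].
exists d'; split=> [i|V VL].
  have [tE] := d'P i; rewrite !inE negb_or => /andP[/eqP nr /eqP nj]; split=> //.
  rewrite /adjc; case: eqVneq => //= nd; apply: M_adj => //; rewrite tE.
  case: (boolP (i \in mob)) => [im|/stay E]; last by rewrite E eqxx in nd.
  move: im; rewrite inE; case: (tgt_ok i) => [->|/andP[_]]; first by rewrite eqxx orbF.
  case: eqVneq => //= ->; rewrite orbF //.
have sum_tgt : \sum_(0 <= U < L) ok U V * f U V <= #|[set i | tgt i == V]|.
  rewrite (card_fibers (g := fun i => cl (d i)) (L := L)) //.
  rewrite big_nat [leqRHS]big_nat; apply: leq_sum => U /andP[_ UL].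
  apply: leq_trans (Htgt U V UL VL) _; apply/subset_leq_card/subsetP => i.
  by rewrite !inE andbC.
have cntE : cnt cl d' V = #|[set i | tgt i == V]|.
  by apply: eq_card => i; rewrite !inE; have [-> _] := d'P i.
split; first by rewrite cntE.
apply: leq_trans (Hd' V); rewrite leq_min; apply/andP; split.
  by have := c_av V VL; rewrite -(card_free V rj) leq_add2r.
case: (boolP (M V V)) => MV.
  apply: leq_trans (c_in V VL) (leq_trans sum_tgt (leq_trans _ (leq_addl _ _))).
  apply/subset_leq_card/subsetP => i; rewrite !inE => /eqP E; rewrite E MV eqxx //.
have stayE : [set i | (i \notin mob) && (tgt i == V)] =
    [set i | (cl (d i) == V) && (tgt i == V)].
  apply/setP => i; rewrite !inE; case: (eqVneq (tgt i) V) => [->|_]; last by rewrite !andbF.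
  by rewrite (negbTE MV) /= negbK.
have mobE : [set i in mob | tgt i == V] = [set i in [set i | tgt i == V] | cl (d i) != V].
  apply/setP => i; rewrite !inE; case: (eqVneq (tgt i) V) => [->|_]; last by rewrite andbF.
  by rewrite (negbTE MV) /= andbT.
rewrite stayE mobE.
have arr_le : \sum_(0 <= U < L) ((U != V) && ok U V) * f U V <=
    #|[set i in [set i | tgt i == V] | cl (d i) != V]|.
  rewrite (card_fibers (g := fun i => cl (d i)) (L := L)) //.
  rewrite big_nat [leqRHS]big_nat; apply: leq_sum => U /andP[_ UL].
  apply: leq_mul_bool => /andP[UV okUV]; have := Htgt U V UL VL; rewrite okUV mul1n.
  move/leq_trans; apply; apply/subset_leq_card/subsetP => i.
  by rewrite !inE => /andP[/eqP-> ->]; rewrite UV eqxx.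
have in_le : \sum_(0 <= U < L) ok U V * f U V <=
    f V V + \sum_(0 <= U < L) ((U != V) && ok U V) * f U V.
  rewrite !big_mkord (bigD1 (Ordinal VL)) //=; apply: leq_add.
    by apply: leq_mul_bool.
  rewrite [leqRHS](bigD1 (Ordinal VL)) //= eqxx /= mul0n add0n.
  by apply: eq_leq; apply: eq_bigr => U UV; rewrite -(inj_eq val_inj) /= in UV; rewrite UV.
(* What the staying agents cover is limited by their number and by what was covered before. The rows
   bound [c V] by each of the two plus the arrivals. *)
apply: leq_trans (leq_add (Hcov V VL) arr_le); rewrite addn_minl leq_min c_cov // andbT.
exact: leq_trans (c_in V VL) in_le.
Qed.

(** At the initial placement all agents are mobile; the class of [z] takes those without a usable
    target. *)
Lemma realize_root s t z (f : nat -> nat) (c : nat -> nat) :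
  s != t -> z \notin [set s; t] ->
  \sum_(0 <= V < L) f V <= k ->
  (forall V, V < L -> f V = 0 \/ (cl s == V) + (cl t == V) < u V) ->
  (forall V, V < L -> c V <= f V) ->
  (forall V, V < L -> c V + ((cl s == V) + (cl t == V)) <= u V) ->
  exists d : {ffun 'I_k -> 'I_n}, (forall i, d i <> s /\ d i <> t) /\
    forall V, V < L -> f V <= cnt cl d V /\ c V <= cov cl d V.
Proof.
move=> st zF Hf f_av c_f c_av.
have [|tgt0 [tgt0P Htgt0]] := @distribute _ [set: 'I_k] f L (cl z).
  by rewrite cardsT card_ord.
have tgt_lt i : tgt0 i < L by case: (tgt0P i) => [->|].
pose tgt i := if (cl s == tgt0 i) + (cl t == tgt0 i) < u (tgt0 i) then tgt0 i else cl z.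
have [|i|d [_ dP Hd]] := @place k n cl tgt setT [ffun=> z] [set s; t].
- move=> i _; rewrite /tgt; case: ifP => [|_]; last by exists z.
  rewrite -(card_free _ st) -[X in X < _]add0n ltn_add2r => /card_gt0P[y].
  by rewrite inE => /andP[/eqP yV yF]; exists y.
- by rewrite inE.
exists d; split=> [i|V VL].
  by have [_] := dP i; rewrite !inE negb_or => /andP[/eqP ? /eqP ?].
have f_tgt : f V <= #|[set i | tgt i == V]|.
  case: (f_av V VL) => [->//|av]; apply: leq_trans (Htgt0 V VL) _.
  apply/subset_leq_card/subsetP => i; rewrite !inE /= => /eqP E.
  by rewrite /tgt E av.
have cntE : cnt cl d V = #|[set i | tgt i == V]|.
  by apply: eq_card => i; rewrite !inE; have [-> _] := dP i.
split; first by rewrite cntE.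
apply: leq_trans (Hd V); rewrite leq_min; apply/andP; split.
  by have := c_av V VL; rewrite -(card_free V st) leq_add2r.
apply: leq_trans (c_f V VL) (leq_trans f_tgt (leq_trans _ (leq_addl _ _))).
by apply/subset_leq_card/subsetP => i; rewrite !inE.
Qed.

(** The number of nodes of depth less than [m], which in heap order is the first index of depth
    [m]. *)
Definition hn m := prec 0 (fun _ h => 1 + L * L * h) m.

Lemma hnS q : hn q.+1 = 1 + L * L * hn q.
Proof. by []. Qed.

Lemma hn_child q h v : hn q <= h -> v < L * L -> hn q.+1 <= h * (L * L) + v.+1.
Proof. by rewrite hnS => qh vL; nia. Qed.

Lemma hn_child_lt q h v : h < hn q -> v < L * L -> h * (L * L) + v.+1 < hn q.+1.
Proof. by rewrite hnS => hq vL; nia. Qed.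

Lemma child_coord h a b : a < L -> b < L ->
  exists2 v, v < L * L & [/\ v %/ L = a, v %% L = b,
    parent L (h * (L * L) + v.+1) = h,
    forall a0, posR L a0 (h * (L * L) + v.+1) = a &
    forall b0, posJ L b0 (h * (L * L) + v.+1) = b].
Proof.
move=> aL bL; have L0 : 0 < L by lia.
have vL : a * L + b < L * L by nia.
have E1 : (a * L + b) %/ L = a by rewrite divnMDl // divn_small // addn0.
have E2 : (a * L + b) %% L = b by rewrite modnMDl modn_small.
have E3 : (h * (L * L) + (a * L + b)) %% (L * L) = a * L + b.
  by rewrite modnMDl modn_small.
exists (a * L + b) => //; split=> // [|a0|b0]; rewrite /parent /posR /posJ addnS /= ?E3 //.
by rewrite divnMDl ?muln_gt0 ?L0 // divn_small // addn0.
Qed.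

Lemma hn_mono r q q' : q <= q' -> hn q <= hn q'.
Proof.
move=> /subnK <-; elim: (q' - q) => // a /leq_trans; apply.
rewrite addSn hnS; have : 0 < L * L by rewrite muln_gt0 (leq_ltn_trans _ (cl_lt r)).
by nia.
Qed.

(** * From a plan to a win of Divider *)

Section PlanWins.
Variables (s t z : 'I_n) (tau : nat) (sg : nat -> nat -> bool) (x : nat -> nat).
Hypothesis st : s != t.
Hypothesis zF : z \notin [set s; t].
Hypothesis planP : plan L M u (cl s) (cl t) k (hn tau) sg x.

Let inflw := inflow L M u (cl s) (cl t) x.
Let occr := occ L (cl s) (cl t).

Lemma plan_rows h U : h < hn tau -> sg h L -> U < L ->
  [/\ h != 0 -> \sum_(0 <= V < L) x (ix L h U V) <= inflw (parent L h) U,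
      x (ix L h U L) <= inflw h U,
      h != 0 -> ~~ M U U -> x (ix L h U L) <= x (ix L (parent L h) U L) +
        \sum_(0 <= W < L) ((W != U) && flowok L M u (cl s) (cl t) h W U) * x (ix L h W U),
      x (ix L h U L) + occr h U <= u U &
      sg h U -> u U <= x (ix L h U L) + occr h U].
Proof.
have [_ xu _ HR] := planP; move=> hH al UL.
have act ty : ty < 5 -> active L sg (hn tau) (h, U, ty) by move=> ty5; split.
split.
- move=> h0; have := HR _ (act 0 isT); rewrite /lhs /rhs /offL /offR /= (negbTE h0).
  by rewrite !addn0.
- by have := HR _ (act 1 isT); rewrite /lhs /rhs /offL /offR /= !addn0.
- move=> h0 MU; have := HR _ (act 2 isT); rewrite /lhs /rhs /offL /offR /=.
  by rewrite (negbTE h0) (negbTE MU) !addn0.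
- by have := HR _ (act 3 isT); rewrite /lhs /rhs /offL /offR /= addn0 xu.
move=> sU; have := HR _ (act 4 isT); rewrite /lhs /rhs /offL /offR /= sU addn0 xu //.
Qed.

(** The actual agents may do better than the plan, so their counts and covers are only bounded from
    below. *)
Definition inv h r j (d : {ffun 'I_k -> 'I_n}) :=
  [/\ sg h L, cl r = posR L (cl s) h, cl j = posJ L (cl t) h, r != j &
    forall V, V < L -> inflw h V <= cnt cl d V /\ x (ix L h V L) <= cov cl d V].

(** By the last row at least as many vertices are covered as are free of Facilitator; as Divider
    covers only such vertices, he covers them all. *)
Lemma blocked_covered h r j d v : h < hn tau -> inv h r j d ->
  (forall i, d i <> r /\ d i <> j) -> sg h (cl v) -> v != r -> v != j ->
  exists i, d i = v.
Proof.
move=> hH [al rE jE rj covP] davoid sv vr vj.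
have [_ _ _ _ /(_ sv)] := plan_rows hH al (cl_lt v).
have [_ c_cov] := covP _ (cl_lt v); rewrite /occr /occ -rE -jE -(card_free _ rj).
rewrite leq_add2r => /leq_trans/(_ c_cov) le_cov.
have sub : d @: [set i | cl (d i) == cl v] \subset free r j (cl v).
  by apply: cov_free => i; have [] := davoid i.
have /setP/(_ v) : d @: [set i | cl (d i) == cl v] = free r j (cl v).
  by apply/eqP; rewrite eqEcard sub.
by rewrite !inE eqxx negb_or vr vj => /imsetP[i _ ->]; exists i.
Qed.

(** Induction on the moves left; the bound on [h] says that its depth is at most [tau - m]. *)
Lemma inv_nfwin m h r j d : m <= tau -> h < hn (tau - m).+1 -> inv h r j d ->
  (forall i, d i <> r /\ d i <> j) -> ~ fwin e m r j d.
Proof.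
have [sym irr] := simple_e.
elim: m h r j d => [|m IH] h r j d mtau hq I davoid /=.
  by have [_ _ _ rj _] := I => -[/eqP|//]; rewrite (negbTE rj).
have [al rE jE rj covP] := I; case=> [/eqP|]; first by rewrite (negbTE rj).
case=> r' [j' [rr' jj' dr' dj' win]].
have hH : h < hn tau by apply: leq_trans hq (hn_mono r _); lia.
have [combP _ _ _] := planP.
have /and3P[nadj /allP common /allP kids] : [&& ~~ M (posR L (cl s) h) (posJ L (cl t) h),
    all (fun U => M (posR L (cl s) h) U && M (posJ L (cl t) h) U ==> sg h U) (iota 0 L) &
    all (fun v => (h * (L * L) + v.+1 < hn tau) && legal M sg h (posR L (cl s) h) (v %/ L)
              && legal M sg h (posJ L (cl t) h) (v %% L) ==> sg (h * (L * L) + v.+1) L)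
          (iota 0 (L * L))].
  case/andP: combP => _ /allP/(_ h); rewrite mem_iota hH => /(_ isT).
  by move/implyP; apply.
rewrite -rE -jE in nadj common kids.
have nrj : ~~ e r j by apply: contra nadj; apply: adj_M.
have uncov v : sg h (cl v) -> v != r -> v != j -> (forall i, d i <> v) -> False.
  by move=> sv vr vj dv; have [i /dv] := blocked_covered hH I davoid sv vr vj.
(* If one of them stays, a meeting needs [r] and [j] adjacent; if both move, it needs an uncovered
   vertex in a class adjacent to both, and such classes are blocked. *)
have r'j' : r' != j'.
  apply/eqP => E; subst j'; case/orP: rr' => [/eqP E|rr'].
    subst r'; case/orP: jj' => [/eqP E|]; first by rewrite E eqxx in rj.
    by rewrite sym (negbTE nrj).
  case/orP: jj' => [/eqP E|jj']; first by subst r'; rewrite rr' in nrj.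
  apply: (uncov r') => //; last 2 first.
  - by apply: contraTneq rr' => ->; apply: irr.
  - by apply: contraTneq jj' => ->; apply: irr.
  have /implyP := common (cl r') ltac:(by rewrite mem_iota cl_lt).
  by apply; rewrite !adj_M.
have leg a a' : adjc e a a' -> a \in [set r; j] -> (forall i, d i <> a') ->
    legal M sg h (cl a) (cl a').
  rewrite /legal; case/orP => [/eqP-> _ _|aa' arj da']; first by rewrite eqxx.
  rewrite (adj_M aa') /=; apply/orP; right; apply/negP => sa'.
  apply: (uncov a' sa') => //; apply: contraTneq aa' => ->.
    case/set2P: arj => ->; first exact: irr.
    by rewrite sym.
  by case/set2P: arj => ->; last exact: irr.
have [v vL [v1 v2 parE posRE posJE]] := child_coord h (cl_lt r') (cl_lt j').
set h' := h * (L * L) + v.+1 in parE posRE posJE.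
have h'q : h' < hn (tau - m).+1.
  by have := hn_child_lt hq vL; rewrite subnSK.
(* After the last move of Facilitator the tree provides no node; Divider stays where he is, and no
   meeting has taken place. *)
case: m IH mtau hq win h'q => [|m] IH mtau hq win h'q.
  have [] := win d; last by [].
    by move=> i; split; [rewrite /adjc eqxx|apply: dr'|apply: dj'].
  by move/eqP; rewrite (negbTE r'j').
have h'H : h' < hn tau by apply: leq_trans h'q (hn_mono r _); lia.
have al' : sg h' L.
  have /implyP := kids v ltac:(by rewrite mem_iota vL); apply.
  rewrite -/h' h'H v1 v2 /=; apply/andP; split.
    by apply: leg => //; rewrite !inE eqxx.
  by apply: leg => //; rewrite !inE eqxx orbT.
have h'0 : h' != 0 by rewrite /h' addnS.
have flowE U V : flowok L M u (cl s) (cl t) h' U V =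
    ((cl r' == V) + (cl j' == V) < u V) && ((U == V) || M U V).
  by rewrite /flowok /occ posRE posJE (negbTE h'0).
have inE' V : inflw h' V = \sum_(0 <= U < L)
    (((cl r' == V) + (cl j' == V) < u V) && ((U == V) || M U V)) * x (ix L h' U V).
  by apply: eq_bigr => U _; rewrite flowE.
have occE V : occr h' V = (cl r' == V) + (cl j' == V).
  by rewrite /occr /occ posRE posJE.
have [||||d' [mv Hd']] := @realize_step r' j' d (fun U V => x (ix L h' U V))
    (fun V => x (ix L h' V L)) r'j' dr' dj'.
- move=> U UL; have [/(_ h'0) + _ _ _ _] := plan_rows h'H al' UL; rewrite parE.
  by move/leq_trans; apply; have [] := covP U UL.
- by move=> V VL; have [_ + _ _ _] := plan_rows h'H al' VL; rewrite inE'.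
- by move=> V VL; have [_ _ _ + _] := plan_rows h'H al' VL; rewrite occE.
- move=> V VL MV; have [_ _ /(_ h'0 MV) + _ _] := plan_rows h'H al' VL; rewrite parE.
  move/leq_trans; apply; apply: leq_add; first by have [] := covP V VL.
  by apply: eq_leq; apply: eq_bigr => U _; rewrite flowE.
apply: (IH h' r' j' d' (ltnW mtau) h'q) (win d' mv); last by move=> i; have [] := mv i.
by split=> // V VL; rewrite inE'; apply: Hd'.
Qed.

Lemma plan_wins : 0 < tau -> exists2 d0 : {ffun 'I_k -> 'I_n},
  (forall i, d0 i <> s /\ d0 i <> t) & ~ fwin e tau s t d0.
Proof.
move=> tau0; have [/andP[al _] _ xk HR] := planP.
have L0 : 0 < L by apply: leq_ltn_trans (cl_lt s).
have H0 : 0 < hn tau by case: (tau) tau0.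
have occE V : occr 0 V = (cl s == V) + (cl t == V) by [].
have [||||d [d0P Hd]] := @realize_root s t z (inflw 0) (fun V => x (ix L 0 V L)) st zF.
- have := HR (0, 0, 0) (And4 H0 al L0 isT); rewrite /lhs /rhs /offL /offR /= !addn0 xk.
  apply: leq_trans; rewrite [leqRHS]exchange_big /=; apply: leq_sum => V _.
  by apply: leq_sum => U _; apply: leq_mul_bool.
- move=> V VL; rewrite -occE; case: ltnP => ov; [by right|left].
  by apply: big1 => U _; rewrite /flowok ltnNge -/(occr 0 V) ov mul0n.
- by move=> V VL; have [] := plan_rows H0 al VL.
- by move=> V VL; rewrite -occE; have [] := plan_rows H0 al VL.
by exists d => //; apply: (inv_nfwin (leqnn _) (h := 0)) => //; rewrite ?subnn.
Qed.

End PlanWins.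

(** * From a winning strategy of Divider to a plan *)

Section WinsPlan.
Variables (s t : 'I_n) (tau N : nat) (d0 : {ffun 'I_k -> 'I_n}).
Hypothesis tau_gt0 : 0 < tau.
Hypothesis d0P : forall i, d0 i <> s /\ d0 i <> t.
Hypothesis nfwin0 : ~ fwin e tau s t d0.
Hypothesis k_lt : k < 2 ^ N.
Hypothesis u_lt : forall U, u U < 2 ^ N.

Let H := hn tau.
Let pR := posR L (cl s).
Let pJ := posJ L (cl t).

Definition position := ('I_n * 'I_n * {ffun 'I_k -> 'I_n})%type.

Definition can_move (p : position) h := exists r' j',
  [/\ adjc e p.1.1 r', adjc e p.1.2 j', cl r' = pR h, cl j' = pJ h &
      forall i, p.2 i <> r' /\ p.2 i <> j'].

(* [st h] is the position after history [h] when Divider follows a fixed winning *)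
(* strategy, and [None] if Facilitator cannot play [h].                         *)
Definition good_at (st : nat -> option position) h :=
  [/\ h = 0 -> st 0 = Some (s, t, d0),
      forall p', 0 < h -> st h = Some p' -> exists2 p, st (parent L h) = Some p &
        forall i, adjc e (p.2 i) (p'.2 i),
      forall p, 0 < h -> st (parent L h) = Some p -> can_move p h -> st h <> None &
      forall p, st h = Some p ->
        [/\ cl p.1.1 = pR h, cl p.1.2 = pJ h,
            forall i, p.2 i <> p.1.1 /\ p.2 i <> p.1.2 &
            exists2 q, hn q <= h & ~ fwin e (tau - q) p.1.1 p.1.2 p.2]].

Lemma parent_lt_self h : 0 < h -> parent L h < h.
Proof. by rewrite /parent => h0; apply: leq_ltn_trans (leq_div _ _) _; rewrite ltn_predL. Qed.

Lemma depth_lt q h : hn q <= h -> h < H -> q < tau.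
Proof.
move=> qh hH; rewrite ltnNge; apply/negP => /(hn_mono s) le_q.
by have := leq_ltn_trans (leq_trans le_q qh) hH; rewrite ltnn.
Qed.

(** Built in heap order, where parents come first. Classical logic decides whether a history can be
    played, and one choice of vertices in the two classes is fixed for it. *)
Lemma strategy_exists m : exists st, forall h, h < m -> h < H -> good_at st h.
Proof.
elim: m => [|m [st IH]]; first by exists (fun=> None).
case: (ltnP m H) => [mH|Hm]; last first.
  by exists st => h _ hH; apply: IH => //; apply: leq_trans hH Hm.
have keep o h : h < m -> good_at st h -> good_at (upd st m o) h.
  move=> hm; rewrite /good_at !(@upd_ne _ _ m) ?(ltn_eqF hm) //.
    by apply/eqP => E; have := leq_ltn_trans (leq_trans (leq_pred h) (leqnn h)) hm;
      have := leq_div h.-1 (L * L); rewrite /parent in E; lia.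
  by apply/eqP; lia.
have at_m o : upd st m o m = o by rewrite /upd eqxx.
case: (posnP m) => [m0|m_gt0].
  exists (upd st m (Some (s, t, d0))) => h hm hH.
  have -> : h = m by lia.
  split=> [|p'|p|p]; rewrite ?m0 // -m0 at_m // => -[<-] /=; rewrite m0; split=> //.
  by exists 0; rewrite ?subn0.
have pm := parent_lt_self m_gt0.
have at_p o : upd st m o (parent L m) = st (parent L m) by rewrite upd_ne // ltn_eqF.
case: (classic (exists2 p, st (parent L m) = Some p & can_move p m)) => [[p pS cm]|no]; last first.
  exists (upd st m None) => h; rewrite ltnS leq_eqVlt => /orP[/eqP->|hm] hH; last first.
    exact/keep/IH.
  split=> [E|p'|p _|p]; rewrite ?at_m //; first by rewrite E in m_gt0.
  by rewrite at_p => pS cm; case: no; exists p.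
have [_ _ _ /(_ p pS)[SR SJ Savoid [q qp nf]]] := IH _ pm (ltn_trans pm mH).
have qtau := depth_lt qp (ltn_trans pm mH).
have [r' [j' [rr' jj' r'E j'E dN]]] := cm.
have [d' mv nf'] : exists2 d' : {ffun 'I_k -> 'I_n},
    (forall i, [/\ adjc e (p.2 i) (d' i), d' i <> r' & d' i <> j']) &
    ~ fwin e (tau - q.+1) r' j' d'.
  (* Without a good answer to [r'] and [j'], this very move would win for Facilitator. *)
  apply: NNPP => no; apply: nf; rewrite -subnSK //=; right; exists r', j'; split=> //.
  - by move=> i; have [] := dN i.
  - by move=> i; have [] := dN i.
  by move=> d' mv; apply: NNPP => nf'; apply: no; exists d'.
exists (upd st m (Some (r', j', d'))) => h.
rewrite ltnS leq_eqVlt => /orP[/eqP->|hm] hH; last exact/keep/IH.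
split=> [E|p' _|p' _ _|p']; rewrite ?at_m //; first by rewrite E in m_gt0.
  by case=> <-; exists p; rewrite ?at_p // => i; have [] := mv i.
case=> <-; split=> //= [i|]; first by have [] := mv i.
exists q.+1 => //; have L0 : 0 < L * L by rewrite muln_gt0 (leq_ltn_trans _ (cl_lt s)).
have -> : m = parent L m * (L * L) + (m.-1 %% (L * L)).+1.
  by rewrite addnS /parent -divn_eq prednK.
by apply: hn_child => //; rewrite ltn_pmod.
Qed.

Section Strategy.
Variable st : nat -> option position.
Hypothesis stP : forall h, h < H -> good_at st h.

Definition sgb h V := if st h is Some p then
    (V == L) || [forall v, (v \in free p.1.1 p.1.2 V) ==> [exists i, p.2 i == v]]
  else false.

(** At the root agents count as coming from their own class, so that [inflow] gives the counts there
    too. *)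
Definition flow h U V := if st h is Some p then
    if h == 0 then if U == V then cnt cl p.2 V else 0
    else if st (parent L h) is Some p0 then
      #|[set i | (cl (p0.2 i) == U) && (cl (p.2 i) == V)]|
    else 0
  else 0.

Definition cover h U := if st h is Some p then cov cl p.2 U else 0.

Definition xval c :=
  let h := c %/ L.+1 %/ L.+1 in let U := c %/ L.+1 %% L.+1 in let V := c %% L.+1 in
  if U == L then if V == L then k else u V
  else if V == L then cover h U else flow h U V.

Lemma xvalE h U V : U <= L -> V <= L -> xval (ix L h U V) =
  if U == L then if V == L then k else u V
  else if V == L then cover h U else flow h U V.
Proof.
move=> UL VL; rewrite /xval /ix; have Q0 : 0 < L.+1 by [].
rewrite !(divnMDl _ _ Q0) !modnMDl (divn_small (_ : V < L.+1)) // addn0.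
by rewrite !(divnMDl _ _ Q0) !modnMDl (divn_small (_ : U < L.+1)) // addn0 !modn_small.
Qed.

Lemma card_agents (A : {set 'I_k}) : #|A| <= k.
Proof. by rewrite -[leqRHS](card_ord k) max_card. Qed.

Lemma xval_lt c : xval c < 2 ^ N.
Proof.
have lt_k m : m <= k -> m < 2 ^ N by move=> mk; apply: leq_ltn_trans k_lt.
have covk (d : {ffun 'I_k -> 'I_n}) V : cov cl d V <= k.
  exact: leq_trans (leq_imset_card _ _) (card_agents _).
have cntk (d : {ffun 'I_k -> 'I_n}) V : cnt cl d V <= k by apply: card_agents.
rewrite /xval; case: ifP => _; first by case: ifP.
case: ifP => _; apply: lt_k; first by rewrite /cover; case: (st _).
rewrite /flow; case: (st _) => // p; case: ifP => _; first by case: ifP.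
by case: (st _) => // p0; apply: card_agents.
Qed.

Lemma alive_nwin h p : h < H -> st h = Some p -> exists2 m, True & ~ fwin e m.+1 p.1.1 p.1.2 p.2.
Proof.
move=> hH hS; have [_ _ _ /(_ p hS)[_ _ _ [q qh nf]]] := stP hH.
by exists (tau - q.+1) => //; rewrite subnSK // (depth_lt qh hH).
Qed.

Lemma alive_neq h p : h < H -> st h = Some p -> p.1.1 != p.1.2.
Proof. by move=> hH /(alive_nwin hH)[m _ nf]; apply/eqP => E; apply: nf; left. Qed.

Lemma alive_avoid h p : h < H -> st h = Some p ->
  forall i, p.2 i <> p.1.1 /\ p.2 i <> p.1.2.
Proof. by move=> hH hS; have [_ _ _ /(_ p hS)[]] := stP hH. Qed.

Lemma occE h p V : h < H -> st h = Some p ->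
  occ L (cl s) (cl t) h V = (cl p.1.1 == V) + (cl p.1.2 == V).
Proof. by move=> hH hS; have [_ _ _ /(_ p hS)[-> ->]] := stP hH. Qed.

(** Forbidden pairs carry no flow: an agent that ends in [V] itself shows a vertex of [V] that
    Facilitator does not hold. *)
Lemma flow_ok h p U V : h < H -> st h = Some p ->
  flowok L M u (cl s) (cl t) h U V * flow h U V = flow h U V.
Proof.
move=> hH hS; case: (posnP (flow h U V)) => [->|]; first by rewrite muln0.
suff key : (exists i, cl (p.2 i) = V) -> [|| h == 0, U == V | M U V] ->
    flowok L M u (cl s) (cl t) h U V.
  rewrite /flow hS; case: eqP => [h0|/eqP h0].
    case: eqP => // UV /card_gt0P[i]; rewrite inE => /eqP iV.
    have -> : flowok L M u (cl s) (cl t) h U V by apply: key; [exists i|rewrite h0].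
    by rewrite mul1n.
  have [_ /(_ p) + _ _] := stP hH; rewrite lt0n h0 => /(_ isT hS)[p0 -> mv].
  case/card_gt0P => i; rewrite inE => /andP[/eqP iU /eqP iV].
  have -> : flowok L M u (cl s) (cl t) h U V; last by rewrite mul1n.
  apply: key; first by exists i.
  case/orP: (mv i) => [/eqP E|/adj_M]; first by rewrite -iU -iV E eqxx orbT.
  by rewrite iU iV => ->; rewrite !orbT.
case=> i iV ok; rewrite /flowok ok andbT (occE _ hH hS).
rewrite -(card_free V (alive_neq hH hS)) -[X in X < _]add0n ltn_add2r.
have davoid := alive_avoid hH hS.
have sub := cov_free V (fun i => proj1 (davoid i)) (fun i => proj2 (davoid i)).
by apply/card_gt0P; exists (p.2 i); apply: (subsetP sub); apply: imset_f; rewrite inE iV.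
Qed.

Lemma inflow_cnt h p V : h < H -> st h = Some p -> V < L ->
  inflow L M u (cl s) (cl t) xval h V = cnt cl p.2 V.
Proof.
move=> hH hS VL; transitivity (\sum_(0 <= U < L) flow h U V).
  apply: eq_big_nat => U /andP[_ UL].
  by rewrite xvalE ?(ltnW UL) ?(ltnW VL) // (ltn_eqF UL) (ltn_eqF VL) (flow_ok _ _ hH hS).
rewrite /flow hS; case: eqP => [h0|/eqP h0].
  rewrite big_mkord (bigD1 (Ordinal VL)) //= eqxx big1 ?addn0 // => U.
  by rewrite -val_eqE /= => /negbTE->.
have [_ /(_ p) + _ _] := stP hH; rewrite lt0n h0 => /(_ isT hS)[p0 -> mv].
rewrite /cnt (card_fibers (g := fun i => cl (p0.2 i)) (L := L)) //.
by apply: eq_bigr => U _; apply: eq_card => i; rewrite !inE andbC.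
Qed.

Lemma strategy_plan : plan L M u (cl s) (cl t) k H sgb xval.
Proof.
have [sym irr] := simple_e.
have L0 : 0 < L by apply: leq_ltn_trans (cl_lt s).
have H0 : 0 < H by rewrite /H; case: (tau) tau_gt0.
have st0 : st 0 = Some (s, t, d0) by have [+ _ _ _] := stP H0; apply.
split.
- rewrite /comb {1}/sgb st0 eqxx /=; apply/allP => h; rewrite mem_iota => /andP[_ hH].
  apply/implyP; rewrite {1}/sgb; case hS: (st h) => [[[r j] d]|] // _.
  have rj := alive_neq hH hS; have davoid := alive_avoid hH hS.
  have [m _ nf] := alive_nwin hH hS; rewrite /= in rj davoid nf.
  have [_ _ _ /(_ _ hS)[/= rE jE _ _]] := stP hH.
  rewrite -[posR _ _ _]/(pR h) -[posJ _ _ _]/(pJ h) -rE -jE.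
  have fw0 m' v d' : fwin e m' v v d' by case: m' => [|m'] /=; left.
  (* An uncovered vertex within reach of both agents would end the game at once, against [nf]. *)
  have nowin v : adjc e r v -> adjc e j v -> (forall i, d i <> v) -> False.
    by move=> rv jv dv; apply: nf => /=; right; exists v, v; split.
  apply/and3P; split.
  + apply/negP => /(M_adj rj) rj'; apply: (nowin j); rewrite /adjc ?rj' ?eqxx ?orbT //.
    by move=> i; have [] := davoid i.
  + apply/allP => U _; apply/implyP => /andP[rU jU].
    rewrite /sgb hS; apply/orP; right.
    apply/forallP => v; apply/implyP; rewrite !inE negb_or => /and3P[/eqP vU vr vj].
    rewrite -vU in rU jU; apply: contraT; rewrite negb_exists => /forallP nv.
    case: (nowin v) => //.
    * by rewrite /adjc (M_adj _ rU) ?orbT // eq_sym.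
    * by rewrite /adjc (M_adj _ jU) ?orbT // eq_sym.
    by move=> i; apply/eqP.
  apply/allP => v; rewrite mem_iota => /andP[_ vL]; apply/implyP => /andP[/andP[h'H lR] lJ].
  have vL' : v %/ L < L by rewrite ltn_divLR.
  have [v' v'L [v'1 v'2 parE posRE posJE]] := child_coord h vL' (ltn_pmod v L0).
  have vE : v' = v by rewrite (divn_eq v L) (divn_eq v' L) v'1 v'2.
  rewrite vE in parE posRE posJE; set h' := h * (L * L) + v.+1 in h'H parE posRE posJE *.
  have h'0 : 0 < h' by rewrite /h' addnS.
  have target a a' : a \in [set r; j] -> legal M sgb h (cl a) a' ->
      exists2 b, adjc e a b /\ cl b = a' & forall i, d i <> b.
    move=> arj; case/orP => [/eqP->|/andP[aa']].
      exists a; first by rewrite /adjc eqxx.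
      by case/set2P: arj => -> i; have [] := davoid i.
    rewrite /sgb hS /= negb_or => /andP[_]; rewrite negb_forall => /existsP[b].
    rewrite negb_imply !inE negb_or => /andP[/and3P[/eqP ba br bj]].
    rewrite negb_exists => /forallP nb; exists b; last by move=> i; apply/eqP.
    rewrite -ba in aa' *; split=> //; rewrite /adjc (M_adj _ aa') ?orbT //.
    by case/set2P: arj => ->; rewrite eq_sym.
  have [r' [rr' r'E] dr'] := target r _ ltac:(by rewrite !inE eqxx) lR.
  have [j' [jj' j'E] dj'] := target j _ ltac:(by rewrite !inE eqxx orbT) lJ.
  have [_ _ /(_ (r, j, d) h'0) + _] := stP h'H; rewrite parE => /(_ hS) some.
  rewrite /sgb; case E: (st h') => [p|]; first by rewrite eqxx.
  rewrite E in some; case: some => //; exists r', j'; split=> //=.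
  + by rewrite r'E -(posRE (cl s)).
  + by rewrite j'E -(posJE (cl t)).
- by move=> U UL; rewrite xvalE ?(ltnW UL) // eqxx (ltn_eqF UL).
- by rewrite xvalE // eqxx.
move=> [[h U] ty] [/= hH + UL ty5]; rewrite {1}/sgb; case hS: (st h) => [p|] // _.
have rj := alive_neq hH hS; have davoid := alive_avoid hH hS.
have UL' := ltnW UL; have UnL := ltn_eqF UL.
have xc h' : xval (ix L h' U L) = cover h' U by rewrite xvalE // UnL eqxx.
have xf h' V V' : V < L -> V' < L -> xval (ix L h' V V') = flow h' V V'.
  by move=> VL V'L; rewrite xvalE ?(ltnW VL) ?(ltnW V'L) // (ltn_eqF VL) (ltn_eqF V'L).
have inS := inflow_cnt hH hS UL.
have cov_sub : p.2 @: [set i | cl (p.2 i) == U] \subset free p.1.1 p.1.2 U.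
  by apply: cov_free => i; have [] := davoid i.
have coverE : cover h U = cov cl p.2 U by rewrite /cover hS.
have occS := occE U hH hS.
have freeS := card_free U rj.
rewrite /lhs /rhs /offL /offR occS.
case: ty ty5 => [|[|[|[|[|//]]]]] _ /=; rewrite ?addn0.
- case: eqP => [h0|/eqP h0].
    rewrite xvalE // eqxx; apply: (@leq_trans (\sum_(0 <= V < L) cnt cl d0 V)).
      rewrite exchange_big /=; apply: eq_leq; apply: eq_big_nat => V /andP[_ VL].
      rewrite -(_ : inflow L M u (cl s) (cl t) xval 0 V = cnt cl d0 V); last first.
        by rewrite (inflow_cnt _ st0).
      apply: eq_big_nat => W /andP[_ WL]; rewrite !xf //.
      by rewrite (flow_ok _ _ H0 st0).
    apply: leq_trans (card_agents [set: 'I_k]).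
    rewrite (card_fibers (A := [set: _]) (g := fun i => cl (d0 i)) (L := L)) //.
    by apply: eq_leq; apply: eq_bigr => V _; apply: eq_card => i; rewrite !inE.
  have [_ /(_ p) + _ _] := stP hH; rewrite lt0n h0 => /(_ isT hS)[p0 pS mv].
  have pH : parent L h < H by apply: ltn_trans hH; apply: parent_lt_self; rewrite lt0n.
  rewrite (inflow_cnt pH pS UL) /cnt.
  rewrite (card_fibers (A := [set i | cl (p0.2 i) == U]) (g := fun i => cl (p.2 i)) (L := L)) //.
  apply: eq_leq; apply: eq_big_nat => V /andP[_ VL]; rewrite xf // /flow hS (negbTE h0) pS.
  by apply: eq_card => i; rewrite !inE.
- by rewrite xc inS coverE leq_imset_card.
- case: ifP => //; rewrite !xc coverE => /norP[h0 MU].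
  have [_ /(_ p) + _ _] := stP hH; rewrite lt0n h0 => /(_ isT hS)[p0 pS mv].
  rewrite {1}/cover pS.
  (* In an independent class, an occupied vertex either was occupied at the parent by the same agent
     or is held by a newcomer. *)
  have sub : p.2 @: [set i | cl (p.2 i) == U] \subset
     (p0.2 @: [set i | cl (p0.2 i) == U]) :|:
     (p.2 @: [set i in [set i | cl (p.2 i) == U] | cl (p0.2 i) != U]).
    apply/subsetP => _ /imsetP[i iU ->]; rewrite inE in iU; rewrite inE.
    case: (eqVneq (cl (p0.2 i)) U) => iU0; last first.
      by apply/orP; right; apply: imset_f; rewrite !inE iU iU0.
    apply/orP; left; have <- : p0.2 i = p.2 i; last by apply: imset_f; rewrite inE iU0.
    case/orP: (mv i) => [/eqP//|/adj_M]; rewrite iU0 (eqP iU).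
    by rewrite (negbTE MU).
  apply: leq_trans (subset_leq_card sub) _; apply: leq_trans (leq_card_setU _ _) _.
  apply: leq_add => //; apply: leq_trans (leq_imset_card _ _) _.
  rewrite (card_fibers (g := fun i => cl (p0.2 i)) (L := L)) //.
  rewrite big_nat [leqRHS]big_nat; apply: leq_sum => W /andP[_ WL].
  rewrite xf //; case: (eqVneq W U) => [->|WU] /=.
    rewrite mul0n leqn0 cards_eq0; apply/eqP/setP => i; rewrite !inE.
    by case: (cl (p0.2 i) == U); rewrite ?andbF.
  rewrite (flow_ok _ _ hH hS) /flow hS (negbTE h0) pS.
  by apply/subset_leq_card/subsetP => i; rewrite !inE => /andP[/andP[-> _] ->].
- rewrite xc coverE xvalE // UnL eqxx -freeS leq_add2r.
  exact: subset_leq_card.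
rewrite /sgb hS UnL /= xc coverE; case: ifP => // /forallP all_cov.
rewrite xvalE // UnL eqxx -freeS leq_add2r; apply/subset_leq_card/subsetP => v vF.
have /implyP/(_ vF)/existsP[i /eqP iv] := all_cov v.
by rewrite -iv; apply: imset_f; rewrite inE iv; move: vF; rewrite inE => /andP[].
Qed.

End Strategy.

Lemma wins_plan : exists sg x, (forall c, x c < 2 ^ N) /\
  plan L M u (cl s) (cl t) k (hn tau) sg x.
Proof.
have [st stP] := strategy_exists H.
have {}stP h : h < H -> good_at st h by move=> hH; apply: stP.
by exists (sgb st), (xval st); split; [exact: xval_lt|exact: strategy_plan].
Qed.

End WinsPlan.

End Game.

(** * The main program *)

Definition env := (seq bool * (nat -> bool) * (nat * nat))%type.
Definition envW (e : env) := e.1.1.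
Definition envA (e : env) := e.1.2.
Definition envX (e : env) := e.2.1.
Definition envz (e : env) := e.2.2.

(** [r0] is the verdict, [r1] the cap [X], [r2] the loop control, [r3] the table index and [r4] the
    result of a test. *)
Definition regs r0 r1 r2 r3 r4 A := Store (nth 0 [:: r0; r1; r2; r3; r4]) A.

Lemma regs_ge5 r0 r1 r2 r3 r4 A r : 5 <= r -> reg (regs r0 r1 r2 r3 r4 A) r = 0.
Proof. by move=> r5; rewrite /= nth_default. Qed.

Lemma sett_regs r0 r1 r2 r3 r4 A i x : i < 5 ->
  sett (regs r0 r1 r2 r3 r4 A) i x =
  let r := set_nth 0 [:: r0; r1; r2; r3; r4] i x in Store (nth 0 r) A.
Proof. by move=> i5; apply: store_ext => // j /=; rewrite nth_set_nth. Qed.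

Lemma U_program f : U envW envA [:: envX; envz] f ->
  exists c, forall d, d \in [:: 0; 2; 4] -> exists P, forall w r0 r1 r2 r3 r4 A m,
    nth 0 [:: r0; r1; r2; r3; r4] d = 0 -> 2 + size w + r1 + r3 <= m ->
    runs P w (regs r0 r1 r2 r3 r4 A)
      (sett (regs r0 r1 r2 r3 r4 A) d (f (w, A, (r1, r3)))) (m ^ c).
Proof.
move=> [_ [T [c Tc] H]]; exists c => d d024.
have [||||P HP] := H [:: 1; 3] d 5 => //.
- by move: d024; rewrite !inE; case: d => [|[|[|[|[|]]]]].
- by move: d024; rewrite !inE; case: d => [|[|[|[|[|]]]]].
exists P => w r0 r1 r2 r3 r4 A m d0 le_m.
have R := HP (w, A, (r1, r3)) (regs r0 r1 r2 r3 r4 A) erefl erefl d0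
  (@regs_ge5 r0 r1 r2 r3 r4 A).
apply: (runs_le R); apply: leq_trans (Tc _) _; rewrite leq_wexp2r // /sz 2!big_cons big_nil addn0.
by rewrite !addnA.
Qed.

Fixpoint filled w X i : nat -> bool :=
  if i is i.+1 then
    let A := filled w X i in if fill w X A i then upd A i true else A
  else fun=> false.

Lemma main_program : exists (P : prog) (a : nat), forall w,
  (early w -> exists2 s, runs P w s0 s ((2 + size w) ^ a) & 0 < reg s 0) /\
  (~~ early w -> forall X, enough w X -> (forall Y, Y < X -> ~~ enough w Y) ->
     exists2 s, runs P w s0 s ((2 + size w + X + slots w X) ^ a) &
       reg s 0 = ~~ divider_wins w X (filled w X (slots w X))).
Proof.
have UX : U envW envA [:: envX; envz] envX by apply: (@U_var _ envW envA _ 0).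
have Uz : U envW envA [:: envX; envz] envz by apply: (@U_var _ envW envA _ 1).
have [c1 H1] := U_program (U_early envW envA [:: envX; envz]).
have [c2 H2] := U_program (U_negb (U_early envW envA [:: envX; envz])).
have [c3 H3] := U_program (U_negb (U_enough UX)).
have [c4 H4] := U_program (U_slots UX).
have [c5 H5] := U_program (U_fill UX Uz).
have [c6 H6] := U_program (U_negb (U_divider_wins UX)).
have [P1 R1] := H1 0 isT; have [P2 R2] := H2 4 isT; have [P3 R3] := H3 2 isT.
have [P4 R4] := H4 2 isT; have [P5 R5] := H5 4 isT; have [P6 R6] := H6 0 isT.
rewrite /envW /envA /envX /envz /= {H1 H2 H3 H4 H5 H6 UX Uz} in R1 R2 R3 R4 R5 R6.
pose search := pwhile TestPos 2 (pseq (pop Dec 2) (pseq (pop Inc 1) P3)).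
pose mark := pcond TestPos 4 (pseq (pop Dec 4) (pop Put 3)).
pose table := pwhile TestPos 2 (pseq (pop Dec 2) (pseq P5 (pseq mark (pop Inc 3)))).
pose late := pseq (pop Dec 4) (pseq P3 (pseq search (pseq P4 (pseq table P6)))).
pose c := c1 + c2 + c3 + c4 + c5 + c6.
exists (pseq P1 (pseq P2 (pcond TestPos 4 late))), (c + 6) => w.
have s0E : s0 = regs 0 0 0 0 0 (fun=> false).
  by apply: store_ext => // -[|[|[|[|[|j]]]]] //=; rewrite nth_nil.
have Bc m c' : c' <= c -> 1 < m -> m ^ c' <= m ^ c.
  by move=> le_c m1; rewrite leq_exp2l.
have c1c : c1 <= c by rewrite /c; lia.
have c2c : c2 <= c by rewrite /c; lia.
have c3c : c3 <= c by rewrite /c; lia.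
have c4c : c4 <= c by rewrite /c; lia.
have c5c : c5 <= c by rewrite /c; lia.
have c6c : c6 <= c by rewrite /c; lia.
have pow6 m t : 1 < m -> t <= m ^ c * m ^ 6 -> t <= m ^ (c + 6).
  by move=> m1; rewrite expnD.
have b1 m : 1 < m -> 0 < m ^ c by move=> m1; rewrite expn_gt0 (ltnW m1).
split=> [ew|ne X eX minX].
  set m := 2 + size w; have m1 : 1 < m by [].
  exists (regs 1 0 0 0 0 (fun=> false)); last by [].
  apply: runs_le (pow6 m (m ^ c1 + (m ^ c2 + 1)) m1 _); last first.
    have := Bc m c1 c1c m1; have := Bc m c2 c2c m1; have := b1 m m1; nia.
  rewrite s0E; apply: runs_seq; first by apply: (R1 w 0 0 0 0 0 _ m) => //; rewrite !addn0.
  rewrite sett_regs //= ew; apply: runs_seq.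
    by apply: (R2 w 1 0 0 0 0 _ m) => //; rewrite !addn0.
  rewrite sett_regs //= ew; apply: runs_le (runs_cond (t := 0) _ _ _) _ => //.
set Z := slots w X; set m := 2 + size w + X + Z.
have m1 : 1 < m by [].
exists (regs (~~ divider_wins w X (filled w X Z)) X 0 Z 0 (filled w X Z)); last by [].
have exec_regs i r s s' : (exec w i r s).1 = s' -> runs (pop i r) w s s' 1.
  by move=> <-; apply: runs_op.
have inc1 i : (exec w Inc 1 (regs 0 i 0 0 0 (fun=> false))).1 = regs 0 i.+1 0 0 0 (fun=> false).
  by apply: store_ext => // -[|[|[|[|[|j]]]]].
have search_run : runs search w (regs 0 0 (~~ enough w 0) 0 0 (fun=> false))
    (regs 0 X (~~ enough w X) 0 0 (fun=> false)) (X * (1 + (1 + m ^ c3)).+1).+1.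
  apply: (runs_while (S := fun i => regs 0 i (~~ enough w i) 0 0 (fun=> false))) => i.
    move=> iX; split=> //=; move: iX; rewrite leq_eqVlt => /orP[/eqP->|iX].
      by rewrite eX ltnn.
    by rewrite minX ?iX.
  move=> iX; apply: runs_seq; last apply: runs_seq.
  - apply: (exec_regs _ _ _ (regs 0 i 0 0 0 (fun=> false))).
    by apply: store_ext => // -[|[|[|[|[|j]]]]] //=; rewrite /upd /= minX.
  - exact: exec_regs (inc1 i).
  have := R3 w 0 i.+1 0 0 0 (fun=> false) m erefl; rewrite sett_regs //=; apply.
  by rewrite /m addn0; lia.
have table_run : runs table w (regs 0 X Z 0 0 (fun=> false))
    (regs 0 X 0 Z 0 (filled w X Z)) (Z * (1 + (m ^ c5 + (3 + 1))).+1).+1.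
  pose S i := regs 0 X (Z - i) i 0 (filled w X i).
  have -> : regs 0 X Z 0 0 (fun=> false) = S 0 by rewrite /S subn0.
  have -> : regs 0 X 0 Z 0 (filled w X Z) = S Z by rewrite /S subnn.
  apply: (runs_while (S := S)) => i iZ; first by rewrite /= subn_gt0.
  apply: runs_seq; last apply: runs_seq; last apply: runs_seq.
  - apply: (exec_regs _ _ _ (regs 0 X (Z - i.+1) i 0 (filled w X i))).
    by apply: store_ext => // -[|[|[|[|[|j]]]]] //=; rewrite /upd /= subnS.
  - apply: (R5 w 0 X _ i 0 _ m) => //; rewrite /m; lia.
  - rewrite sett_regs //=.
    apply: (runs_cond (s' := regs 0 X (Z - i.+1) i 0 (filled w X i.+1))) => //=; rewrite lt0b => fi.
      rewrite fi -[2]/(1 + 1); apply: runs_seq.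
        apply: (exec_regs _ _ _ (regs 0 X (Z - i.+1) i 0 (filled w X i))).
        by apply: store_ext => // -[|[|[|[|[|j]]]]].
      by apply: exec_regs.
    by rewrite (negbTE fi).
  by apply: exec_regs; apply: store_ext => // -[|[|[|[|[|j]]]]].
have m0 : 2 + size w + 0 + 0 <= m by rewrite /m; lia.
apply: runs_le (pow6 m (m ^ c1 + (m ^ c2 + (1 + (m ^ c3 + ((X * (1 + (1 + m ^ c3)).+1).+1 +
  (m ^ c4 + ((Z * (1 + (m ^ c5 + (3 + 1))).+1).+1 + m ^ c6))))).+1)) m1 _).
  rewrite s0E; apply: runs_seq; first exact: (R1 w 0 0 0 0 0 _ m).
  rewrite sett_regs //= (negbTE ne); apply: runs_seq; first exact: (R2 w 0 0 0 0 0 _ m).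
  rewrite sett_regs //= ne; apply: runs_cond => //= _.
  apply: runs_seq.
    apply: (exec_regs _ _ _ (regs 0 0 0 0 0 (fun=> false))).
    by apply: store_ext => // -[|[|[|[|[|j]]]]].
  apply: runs_seq; first exact: (R3 w 0 0 0 0 0 _ m).
  rewrite sett_regs //=; apply: runs_seq search_run _; rewrite eX.
  apply: runs_seq; first by apply: (R4 w 0 X 0 0 0 _ m) => //; rewrite /m; lia.
  rewrite sett_regs //=; apply: runs_seq table_run _.
  have := R6 w 0 X 0 Z 0 (filled w X Z) m erefl; rewrite sett_regs //=; apply.
  exact: leqnn.
have e1 := Bc m _ c1c m1; have e2 := Bc m _ c2c m1; have e3 := Bc m _ c3c m1.
have e4 := Bc m _ c4c m1; have e5 := Bc m _ c5c m1; have e6 := Bc m _ c6c m1.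
have B1 := b1 m m1; have XZ : X + Z <= m by rewrite /m; lia.
move: (m ^ c) (m ^ c1) (m ^ c2) (m ^ c3) (m ^ c4) (m ^ c5) (m ^ c6) e1 e2 e3 e4 e5 e6 B1.
move=> B k1 k2 k3 k4 k5 k6 e1 e2 e3 e4 e5 e6 B1.
(* [B] bounds the cost of each of the six programs, the loops contribute the factor [m], and
   [32 <= m ^ 5]; hence the 6 in the exponent. *)
apply: (@leq_trans (B * (32 * m))).
  have : X * k3 <= X * B by rewrite leq_mul2l e3 orbT.
  have : Z * k5 <= Z * B by rewrite leq_mul2l e5 orbT.
  have : (X + Z) * B <= m * B by rewrite leq_mul2r XZ orbT.
  have : X + Z <= (X + Z) * B by rewrite -{1}[X + Z]muln1 leq_mul2l B1 orbT.
  have : 2 * B <= m * B by rewrite leq_mul2r m1 orbT.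
  have -> : X * (1 + (1 + k3)).+1 = X * k3 + 3 * X by lia.
  have -> : Z * (1 + (k5 + (3 + 1))).+1 = Z * k5 + 6 * Z by lia.
  move: (X * k3) (Z * k5) => a1 a2; rewrite mulnDl mulnCA (mulnC B m).
  move: (X * B) (Z * B) (m * B) => a3 a4 a5; clear -e1 e2 e3 e4 e5 e6 B1; lia.
rewrite leq_mul2l; apply/orP; right.
by rewrite expnSr leq_mul2r (@leq_exp2r 2 m 5) // m1 orbT.
Qed.

(** * The finished table *)

Lemma fill_ext w X A A' z : 0 < X -> (forall i, i < z -> A i = A' i) ->
  fill w X A z = fill w X A' z.
Proof.
move=> X0 AA'; rewrite /fill; case: ifP => // lev0.
apply: eq_in_has => x0 _; apply: eq_in_has => o'; rewrite mem_iota => /andP[_ o'X].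
rewrite AA' //; have : z = slot X (z %/ X %/ X) (z %/ X %% X) (z %% X).
  by rewrite /slot -!divn_eq.
rewrite /slot; move: (z %/ X %/ X) (z %/ X %% X) (z %% X) lev0 => [//|lev] b c _ /= ->.
by rewrite mulSn; nia.
Qed.

Lemma filledS w X i z : filled w X i.+1 z =
  if z == i then fill w X (filled w X i) i || filled w X i i else filled w X i z.
Proof.
have -> : filled w X i.+1 = if fill w X (filled w X i) i then upd (filled w X i) i true
  else filled w X i by [].
move: (filled w X i) (fill w X (filled w X i) i) => A b.
by case: b; rewrite /upd; case: (eqVneq z i) => // ->.
Qed.

Lemma filled_ge w X i z : i <= z -> filled w X i z = false.
Proof.
elim: i => [//|i IH] iz.
by rewrite filledS (gtn_eqF iz) (IH (ltnW iz)).
Qed.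

Lemma filled_lt w X i z : z < i -> filled w X i z = fill w X (filled w X z) z.
Proof.
elim: i => [|i IH]; first by rewrite ltn0.
rewrite ltnS leq_eqVlt => /orP[/eqP->|zi]; rewrite filledS.
  by rewrite eqxx (filled_ge _ _ (leqnn i)) orbF.
by rewrite (ltn_eqF zi) (IH zi).
Qed.

(** An entry consults only the preceding level, hence smaller indices, whose bits no longer change;
    so the finished table satisfies its own recursion. *)
Lemma filledP w X i z : 0 < X -> z < i -> filled w X i z = fill w X (filled w X i) z.
Proof.
move=> X0 zi; rewrite filled_lt //; apply: fill_ext => // j jz.
by rewrite !filled_lt // (ltn_trans jz).
Qed.

(** * Correctness and running time *)

Lemma nodes_minn X D m : 0 < D ->
  prec 0 (fun _ h => minn X (1 + D * h)) m = minn X (prec 0 (fun _ h => 1 + D * h) m).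
Proof. by move=> D0; elim: m => [|m IH] /=; [lia|rewrite IH; nia]. Qed.

Section Correct.
Variables (n : nat) (e : rel 'I_n) (s t : 'I_n) (k tau : nat).
Hypotheses (simple_e : simple_graph e) (conn_e : connected_graph e).
Hypotheses (tau_gt0 : 0 < tau).
Let w := encode e s t k tau.
Let L := ncls w.

Lemma early_rendezvous : early w -> rendezvous_in_time e s t k tau.
Proof.
rewrite earlyE => /orP[/eqP<-|st] d dP; first by case: (tau) => [|m]; left.
case: (tau) tau_gt0 => // m _; right; exists t, t; split.
- by rewrite /adjc st orbT.
- by rewrite /adjc eqxx.
- by move=> i; have [] := dP i.
- by move=> i; have [] := dP i.
by move=> d' _; case: m => [|m]; left.
Qed.

Hypothesis not_early : ~~ early w.

Let L_gt1 : 1 < L.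
Proof. exact: ncls_gt1. Qed.

Let LL_gt1 : 1 < L * L.
Proof. exact: (@leq_mul 2 1 L L L_gt1 (ltnW L_gt1)). Qed.

Lemma hn_ge m : m <= hn L m.
Proof.
elim: m => // m IH; rewrite hnS add1n ltnS.
by apply: leq_trans IH _; rewrite leq_pmull // ltnW.
Qed.

Lemma nodesE X : nodes w X = minn X (hn L (minn X tau)).
Proof.
rewrite /nodes tauc_encode nodes_minn // muln_gt0.
by rewrite -/L (ltnW L_gt1).
Qed.

Lemma nodes_hn X : enough w X -> nodes w X = hn L tau.
Proof.
move=> eX; have lX := large_lt eX.
(* As the capped number of nodes stays below [X], no cap was effective; a cap on [tau] would show,
   since there are at least as many nodes as moves. *)
have ltX : nodes w X < X.
  apply: leq_trans lX; rewrite ltnS ltnW //; apply: leq_trans (ltn_expl _ (isT : 1 < 2)) _.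
  by rewrite leq_exp2l // /large /nvars; nia.
move: ltX; rewrite nodesE; case: (leqP X tau) => Xt.
  by rewrite (minn_idPl (hn_ge X)) ltnn.
by rewrite gtn_min ltnn /= => /ltnW/minn_idPr.
Qed.

Lemma u_lt U : uw w U < 2 ^ size w.
Proof.
apply: leq_ltn_trans (n_lt e s t k tau); rewrite /uw csizeE.
by rewrite -[leqRHS]card_ord max_card.
Qed.

Lemma cls_tw (a b x : 'I_n) : cls w a = cls w b -> x != a -> x != b -> e a x = e b x.
Proof.
move=> /(cls_twins simple_e)/forallP/(_ x) + xa xb.
by rewrite (negbTE xa) (negbTE xb) => /eqP.
Qed.

Lemma cadj_iff a b : Mw w a b <->
  exists x y : 'I_n, [/\ cls w x = a, cls w y = b & e x y].
Proof. by split=> [/cadjP|H] //; apply/cadjP. Qed.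

Lemma third_vertex : exists z, z \notin [set s; t].
Proof.
have [sym irr] := simple_e; move: not_early; rewrite earlyE negb_or => /andP[st nst].
have /connectP[[|x p] /=] := conn_e s t; first by move=> _ /esym/eqP; rewrite (negbTE st).
case/andP=> sx _ _; exists x; rewrite !inE negb_or; apply/andP; split.
  by apply: contraTneq sx => ->.
by apply: contraNneq nst => <-.
Qed.

Lemma divider_wins_correct X : enough w X ->
  ~~ divider_wins w X (filled w X (slots w X)) <-> rendezvous_in_time e s t k tau.
Proof.
move=> eX; have X0 : 0 < X by apply: leq_ltn_trans eX.
have HE := nodes_hn eX; have H0 : 0 < nodes w X by rewrite HE; case: (tau) tau_gt0.
have DW := divider_winsP eX (@kbit_encode _ e s t k tau) (k_lt e s t k tau) u_lt H0
  (fun z => @filledP w X (slots w X) z X0).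
rewrite HE /aw /bw ds_encode dt_encode in DW.
have cl_lt := @cls_lt _ e s t k tau simple_e.
have st : s != t by move: not_early; rewrite earlyE; case: eqP.
split=> [/negP nd d dP|win].
  apply: NNPP => nf; apply: nd; apply/DW.
  exact: (wins_plan simple_e cl_lt cls_tw cadj_iff (@csizeE _ e s t k tau)
    tau_gt0 dP nf (k_lt e s t k tau) u_lt).
apply/negP => /DW[sg [x [_ pl]]]; have [z zF] := third_vertex.
have [d0 d0P nf] := plan_wins simple_e cl_lt cls_tw cadj_iff
  (@csizeE _ e s t k tau) st zF pl tau_gt0.
by apply: nf; apply: win.
Qed.

Definition width := 5 * (hn L tau * (L.+1 * L.+1)) + 5.

Lemma enough_width : enough w (2 ^ (width * width)).+1.
Proof.
set X := _.+1; rewrite /enough prec_double // gtn_min; apply/orP; right.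
have hn_le a b : a <= b -> hn L a <= hn L b.
  move=> /subnK <-; elim: (b - a) => // c /leq_trans; apply.
  by rewrite addSn hnS add1n ltnW // ltnS leq_pmull // ltnW.
have le_w : large w X <= width.
  rewrite /large /width /nvars leq_add2r leq_mul2l leq_mul2r nodesE.
  by rewrite (leq_trans (geq_minr _ _)) ?orbT // hn_le // geq_minr.
by rewrite ltnS leq_exp2l // leq_mul.
Qed.

Lemma hn_lt_exp m : hn L m < (L * L) ^ m.
Proof.
elim: m => // m IH; rewrite hnS expnS.
by move: IH LL_gt1; move: (L * L) (hn L m) => D h; move: (D ^ m) => p; nia.
Qed.

Lemma width_le : width * width <= nd e ^ (20 * tau).
Proof.
have L2 := L_gt1; have L0 := ltnW L2; have le_nd : L <= nd e by apply: ncls_le_nd.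
apply: leq_trans (leq_wexp2r _ le_nd).
have le_w : width <= L ^ (10 * tau).
  (* The exponent has [2 * tau] for the nodes, 4 for the square of [L.+1], and 4 for a constant
     factor of at most 10. *)
  apply: (@leq_trans (L ^ (2 * tau + 8))); last by rewrite leq_pexp2l //; lia.
  have Q4 : L.+1 * L.+1 <= L ^ 4.
    by rewrite (_ : 4 = 2 + 2) // expnD; apply: leq_mul; rewrite -mulnn; nia.
  have T4 : 10 <= L ^ 4 by apply: leq_trans (leq_wexp2r 4 L2).
  have h1 := ltnW (hn_lt_exp tau).
  have p1 : 0 < L ^ (2 * tau + 4) by rewrite expn_gt0 L0.
  have h2 : hn L tau * (L.+1 * L.+1) <= L ^ (2 * tau + 4).
    by rewrite expnD expnM -mulnn leq_mul.
  rewrite /width (_ : 2 * tau + 8 = 2 * tau + 4 + 4) ?addnA //; last by lia.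
  by rewrite [L ^ _]expnD; nia.
apply: leq_trans (leq_mul le_w le_w) _.
by rewrite -expnD leq_pexp2l //; lia.
Qed.

Lemma nd_gt1 : 1 < nd e.
Proof. exact: leq_trans L_gt1 (ncls_le_nd _ _ _ _ _). Qed.

End Correct.

Lemma steps_bound a Z : 1 < Z -> Z ^ a * (2 * Z ^ a + 5) + 2 <= Z ^ (2 * a + 4).
Proof.
move=> Z1; have -> : Z ^ (2 * a + 4) = Z ^ a * Z ^ a * Z ^ 4.
  by rewrite expnD mul2n -addnn expnD.
have Z4 : 16 <= Z ^ 4 by rewrite (leq_exp2r 2 Z (isT : 0 < 4)).
have : 0 < Z ^ a by rewrite expn_gt0 (ltnW Z1).
by move: (Z ^ a) (Z ^ 4) Z4 => z z4; nia.
Qed.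

(** One number serves as leading constant, as exponent of the input length and as factor of [tau]:
    the power absorbs the constants, the rest the exponents. *)
Definition factor b := 2 ^ (6 * b) + (20 + 2 * b).

Lemma factor_base b N Z : 0 < N -> Z <= N * 2 ^ 6 -> Z ^ b <= factor b * N ^ factor b.
Proof.
move=> N0 /(leq_wexp2r b)/leq_trans; apply.
rewrite expnMn -expnM mulnC leq_mul ?leq_addr // leq_pexp2l // /factor; lia.
Qed.

Lemma factor_bound b N Z l tau : 0 < N -> 1 < l -> 0 < tau ->
  Z <= N * 2 ^ (2 * l ^ (20 * tau) + 6) ->
  Z ^ b <= factor b * 2 ^ (l ^ (factor b * tau)) * N ^ factor b.
Proof.
move=> N0 l1 tau0 /(leq_wexp2r b)/leq_trans; apply.
rewrite expnMn -expnM mulnDl expnD mulnC.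
apply: leq_mul; last by rewrite leq_pexp2l // /factor; lia.
rewrite [leqLHS]mulnC; apply: leq_mul; first by rewrite leq_addr.
rewrite leq_exp2l // mulnAC.
apply: (@leq_trans (l ^ (2 * b * tau) * l ^ (20 * tau))).
  rewrite leq_mul2r; apply/orP; right.
  apply: leq_trans (ltnW (ltn_expl _ l1)) _; rewrite leq_pexp2l ?(ltnW l1) //.
  by rewrite leq_pmulr.
rewrite -expnD leq_pexp2l ?(ltnW l1) // -mulnDl leq_mul2r /factor.
by apply/orP; right; lia.
Qed.

Theorem theorem5 :
  exists (M : TM) (c : nat),
    forall (n : nat) (e : rel 'I_n) (s t : 'I_n) (k tau : nat),
      simple_graph e -> connected_graph e -> 0 < k -> 0 < tau ->
      exists b : bool,
        tm_run M (encode e s t k tau)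
          (c * 2 ^ (nd e ^ (c * tau)) * (size (encode e s t k tau)) ^ c)
          = Some b /\
        (b = true <-> rendezvous_in_time e s t k tau).
Proof.
have [P [a main]] := main_program.
exists (machine P), (factor (2 * a + 4)) => n e s t k tau simple_e conn_e _ tau0.
set b := 2 * a + 4; set w := encode e s t k tau; set N := size w.
have N0 : 0 < N by rewrite /N /w /encode size_cat size_unary.
have [mainE mainL] := main w.
case: (boolP (early w)) => [ew|ne].
  have [st run res] := mainE ew; exists true; split; last first.
    by split=> // _; apply: early_rendezvous.
  rewrite -res; apply: machine_run run _; apply: leq_trans (steps_bound _ _) _ => //.
  apply: leq_trans (factor_base (N := N) _ N0 _) _; first by rewrite -/N; lia.
  by rewrite leq_mul2r leq_pmulr ?orbT // expn_gt0.
have ex_enough : exists X, enough w X by eexists; apply: enough_width.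
case: (ex_minnP ex_enough) => X eX minX.
have X_le : X <= (2 ^ (nd e ^ (20 * tau))).+1.
  apply: leq_trans (minX _ (enough_width simple_e conn_e ne)) _.
  by rewrite ltnS leq_exp2l // width_le.
have [Y YX|st run res] := mainL ne X eX.
  by apply/negP => /minX; rewrite leqNgt YX.
exists (0 < reg st 0); split; last first.
  rewrite res lt0b; have := divider_wins_correct simple_e conn_e tau0 ne eX.
  by case: (divider_wins _ _ _) => /=.
apply: machine_run run _; apply: leq_trans (steps_bound _ _) _ => //.
apply: factor_bound => //; first exact: nd_gt1 ne.
set G := nd e ^ _; have G0 : 0 < 2 ^ G by rewrite expn_gt0.
have -> : 2 ^ (2 * G + 6) = 2 ^ G * 2 ^ G * 64 by rewrite expnD mul2n -addnn expnD.
(* The table has a number of slots quadratic in [X], which accounts for the factor 2 in the exponent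
   [2 * G + 6]. *)
rewrite /slots -/N; move: X_le; rewrite -/G; move: (2 ^ G) G0 => g g0 X_le.
apply: (@leq_trans ((N + 2) * ((X + 1) * (X + 1)))); first by nia.
apply: (@leq_trans (3 * N * ((4 * g) * (4 * g)))); last by nia.
by rewrite !leq_mul //; lia.
Qed.
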